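(* For any dilator $D$, exactly one of the following holds: (1) $\mathsf{RCA}_0\vDash_\omega\text{``$D$ is a dilator''}$; (2) $\mathsf{RCA}_0\vDash_\omega\big(\text{``$D$ is a dilator''}\to\Pi^0_2\textsf{-}\mathsf{TI}^\star\big)$.
   Context: Linear orders have underlying set a subset of $\mathbb N$. $\mathsf{LO}$ is the category of linear orders with order embeddings; $\mathsf{Nat}$ is its full subcategory on the finite orders $n=\{0,\ldots,n-1\}$. For embeddings $f,g:X\to Y$ write $f\le g$ if $f(x)\le g(x)$ for all $x$. $[X]^{<\omega}$ is the set of finite subsets of $X$, and $[f]^{<\omega}(a)=\{f(x):x\in a\}$. A (coded) predilator consists of a functor $D:\mathsf{Nat}\to\mathsf{LO}$ that is monotone ($f\le g$ implies $D(f)\le D(g)$) and a natural transformation $\mathrm{supp}:D\Rightarrow[\cdot]^{<\omega}$ such that for every morphism $f:m\to n$ of $\mathsf{Nat}$, every $\tau\in D(n)$ with $\mathrm{supp}_n(\tau)\subseteq\mathrm{rng}(f)$ lies in $\mathrm{rng}(D(f))$; such data is coded by a subset of $\mathbb N$. For a finite order $a$ let $\mathrm{en}_a:|a|\to a$ be its increasing enumeration, and for an embedding $f:a\to b$ of finite orders let $|f|:|a|\to|b|$ be the unique morphism with $\mathrm{en}_b\circ|f|=f\circ\mathrm{en}_a$. For a linear order $\alpha$, $\overline D(\alpha)$ is the set of pairs $(\sigma,a)$ with $a\in[\alpha]^{<\omega}$, $\sigma\in D(|a|)$ and $\mathrm{supp}_{|a|}(\sigma)=\{0,\ldots,|a|-1\}$,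 ordered by $(\sigma,a)\le(\tau,b)$ iff $D(|\iota_a|)(\sigma)\le D(|\iota_b|)(\tau)$ for the inclusions $\iota_a:a\hookrightarrow a\cup b$, $\iota_b:b\hookrightarrow a\cup b$. $D$ is a dilator if $\overline D(\alpha)$ is well-founded for every well order $\alpha$; ``$D$ is a dilator'' is the corresponding statement of second-order arithmetic (with the code of $D$ as parameter). For a linear order $\alpha$, $2^\alpha$ is the order of terms $2^{x_{n-1}}+\ldots+2^{x_0}$ with $x_0<\ldots<x_{n-1}$ in $\alpha$, compared lexicographically with the largest exponent taking precedence. $\Pi^0_2\textsf{-}\mathsf{TI}^\star$ is the statement: for every linear order $\alpha$ such that $2^\alpha$ is well-founded, $\Pi^0_2$-induction (with parameters) along $\alpha$ holds. $\mathsf T\vDash_\omega\varphi(X_1,\ldots,X_n)$ (set parameters exactly $X_1,\dots,X_n$) means there is $Y\subseteq\mathbb N$ such that every $\omega$-model $\mathcal M\vDash\mathsf T$ with $X_1,\ldots,X_n,Y\in\mathcal M$ satisfies $\varphi(X_1,\ldots,X_n)$. *)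

(* Defs.v *)
From mathcomp Require Import all_boot.
From mathcomp Require Import finmap.
From mathcomp Require Import boolp classical_sets.

Set Implicit Arguments.
Unset Strict Implicit.
Unset Printing Implicit Defensive.

Local Open Scope classical_set_scope.

(* An omega-model is given by its second-order part. *)
Definition omega_model := set (set nat).

Inductive term : Type :=
| Var of nat
| Zero
| One
| Add of term & term
| Mul of term & term.

(* Arithmetical formulas of second-order arithmetic, with set parameters.
   Number variables are de Bruijn indices: each number quantifier binds index 0.
   In [BAll t p] and [BEx t p] (bounded quantifiers "for all/some x < t") the
   bound [t] lies outside the scope of the bound variable, so that the latter
   cannot occur in it.  [Mem t i] says that [t] belongs to the [i]-th set
   parameter. *)
Inductive form : Type :=
| Eq of term & term
| Lt of term & term
| Mem of term & nat
| Not of form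
| And of form & form
| Or of form & form
| Imp of form & form
| BAll of term & form
| BEx of term & form
| All of form
| Ex of form.

Definition scons (x : nat) (v : nat -> nat) : nat -> nat :=
  fun i => if i is j.+1 then v j else x.

Fixpoint eval (v : nat -> nat) (t : term) : nat :=
  match t with
  | Var i => v i
  | Zero => 0
  | One => 1
  | Add s t => eval v s + eval v t
  | Mul s t => eval v s * eval v t
  end.

Fixpoint sat (S : nat -> set nat) (v : nat -> nat) (p : form) : Prop :=
  match p with
  | Eq s t => eval v s = eval v t
  | Lt s t => eval v s < eval v t
  | Mem t i => S i (eval v t)
  | Not p => ~ sat S v p
  | And p q => sat S v p /\ sat S v q
  | Or p q => sat S v p \/ sat S v q
  | Imp p q => sat S v p -> sat S v q
  | BAll t p => forall x, x < eval v t -> sat S (scons x v) p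
  | BEx t p => exists x, x < eval v t /\ sat S (scons x v) p
  | All p => forall x, sat S (scons x v) p
  | Ex p => exists x, sat S (scons x v) p
  end.

Fixpoint delta00 (p : form) : bool :=
  match p with
  | Eq _ _ | Lt _ _ | Mem _ _ => true
  | Not p | BAll _ p | BEx _ p => delta00 p
  | And p q | Or p q | Imp p q => delta00 p && delta00 q
  | All _ | Ex _ => false
  end.

Definition sigma01 (p : form) : bool := if p is Ex q then delta00 q else false.
Definition pi01 (p : form) : bool := if p is All q then delta00 q else false.
Definition pi02 (p : form) : bool := if p is All q then sigma01 q else false.

(* [M] satisfies the universal closures of the instances of both schemata of
   RCA_0; the distinguished variable of a formula is index 0, all its other
   variables are parameters.  The remaining axioms of RCA_0 do not involve sets
   and hold for the standard natural numbers. *)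
Record RCA0 (M : omega_model) : Prop := {
  RCA0_sigma01_induction :
    forall (p : form) (S : nat -> set nat) (v : nat -> nat),
      sigma01 p -> (forall i, M (S i)) ->
      sat S (scons 0 v) p ->
      (forall n, sat S (scons n v) p -> sat S (scons n.+1 v) p) ->
      forall n, sat S (scons n v) p;
  RCA0_delta01_comprehension :
    forall (p q : form) (S : nat -> set nat) (v : nat -> nat),
      sigma01 p -> pi01 q -> (forall i, M (S i)) ->
      (forall n, sat S (scons n v) p <-> sat S (scons n v) q) ->
      exists X, M X /\ (forall n, X n <-> sat S (scons n v) p)
}.

(* A theory [T] is given by the class of its omega-models, and a statement [phi]
   with set parameters [Xs] by the class of omega-models satisfying it, i.e. by
   its relativization, in which set quantifiers range over the omega-model. *)
Definition omega_entails (T : omega_model -> Prop) (Xs : seq (set nat))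
    (phi : omega_model -> Prop) : Prop :=
  exists Y : set nat, forall M : omega_model,
    T M -> [set` Xs] `<=` M -> M Y -> phi M.

Definition pair_code (i j : nat) : nat := (i + j) ^ 2 + i.

(* The underlying set of a linear order is recovered from the (reflexive)
   relation as [lo_set] below. *)
Record linord : Type := LinOrd {
  lo_le :> nat -> nat -> Prop;
  lo_field : forall x y, lo_le x y -> lo_le x x /\ lo_le y y;
  lo_anti : forall x y, lo_le x y -> lo_le y x -> x = y;
  lo_trans : forall x y z, lo_le x y -> lo_le y z -> lo_le x z;
  lo_total : forall x y, lo_le x x -> lo_le y y -> lo_le x y \/ lo_le y x
}.

Definition lo_set (X : linord) : set nat := [set x | X x x].

Definition lo_lt (X : linord) (x y : nat) : Prop := X x y /\ x <> y.

Definition lo_code (X : linord) : set nat :=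
  [set k | exists x y, X x y /\ k = pair_code x y].

Definition lo_embedding (X Y : linord) (f : nat -> nat) : Prop :=
  forall x y, lo_set X x -> lo_set X y ->
    lo_set Y (f x) /\ (X x y <-> Y (f x) (f y)).

(* [M] satisfies that the order [lt] on [A] is well-founded, i.e. has no infinite
   descending sequence.  Elements of [T] are coded by numbers via [c]. *)
Definition well_founded_in (M : omega_model) (T : Type) (c : T -> nat)
    (A : set T) (lt : T -> T -> Prop) : Prop :=
  ~ exists F : nat -> T,
      [/\ forall i, A (F i),
          forall i, lt (F i.+1) (F i)
        & M [set k | exists i, k = pair_code i (c (F i))]].

Definition well_order_in (M : omega_model) (X : linord) : Prop :=
  well_founded_in M id (lo_set X) (lo_lt X).

(* Morphisms of the category Nat; the order on ['I_m] is that of [nat]. *)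
Definition emb (m n : nat) : Type :=
  {f : {ffun 'I_m -> 'I_n} |
    [forall i : 'I_m, forall j : 'I_m, (i < j) ==> (f i < f j)]}.

Definition emb_fun m n (f : emb m n) : 'I_m -> 'I_n := val f.
Coercion emb_fun : emb >-> Funclass.

Lemma emb_id_subproof n :
  [forall i : 'I_n, forall j : 'I_n,
     (i < j) ==> ([ffun x : 'I_n => x] i < [ffun x : 'I_n => x] j)].
Proof. by apply/forallP => i; apply/forallP => j; rewrite !ffunE implybb. Qed.

Definition emb_id n : emb n n := exist _ [ffun x => x] (emb_id_subproof n).

Lemma emb_lt m n (f : emb m n) (i j : 'I_m) : i < j -> f i < f j.
Proof. by move: (valP f) => /forallP/(_ i)/forallP/(_ j)/implyP; apply. Qed.

Lemma emb_comp_subproof l m n (g : emb m n) (f : emb l m) :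
  [forall i : 'I_l, forall j : 'I_l,
     (i < j) ==> ([ffun x => g (f x)] i < [ffun x => g (f x)] j)].
Proof.
apply/forallP => i; apply/forallP => j; apply/implyP => ij.
by rewrite !ffunE; do 2!apply: emb_lt.
Qed.

Definition emb_comp l m n (g : emb m n) (f : emb l m) : emb l n :=
  exist _ [ffun x => g (f x)] (emb_comp_subproof g f).

(* The values of [dmap f] and [supp] matter only on the underlying set of the
   relevant [dobj n]. *)
Record predilator : Type := Predilator {
  dobj :> nat -> linord;
  dmap : forall m n, emb m n -> nat -> nat;
  supp : forall n, nat -> {set 'I_n};
  dmap_embedding : forall m n (f : emb m n),
    lo_embedding (dobj m) (dobj n) (dmap f);
  dmap_id : forall n x, lo_set (dobj n) x -> dmap (emb_id n) x = x;
  dmap_comp : forall l m n (g : emb m n) (f : emb l m) x,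
    lo_set (dobj l) x -> dmap (emb_comp g f) x = dmap g (dmap f x);
  dmap_monotone : forall m n (f g : emb m n), (forall i, f i <= g i) ->
    forall x, lo_set (dobj m) x -> dobj n (dmap f x) (dmap g x);
  supp_natural : forall m n (f : emb m n) x, lo_set (dobj m) x ->
    supp n (dmap f x) = (f @: supp m x)%SET;
  supp_condition : forall m n (f : emb m n) t, lo_set (dobj n) t ->
    supp n t \subset codom f ->
    exists2 s, lo_set (dobj m) s & dmap f s = t
}.

Arguments supp D {n} : rename.

(* [CodeSeq.code] is a bijection from [seq nat] to [nat]. *)
Definition predilator_code (D : predilator) : set nat :=
  [set k | exists n x y,
     D n x y /\ k = CodeSeq.code [:: 0; n; x; y]] `|`
  [set k | exists m n (f : emb m n) x, lo_set (D m) x /\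
     k = CodeSeq.code [:: 1, m, n, x, dmap D f x & [seq val (f i) | i <- enum 'I_m]]] `|`
  [set k | exists n x, lo_set (D n) x /\
     k = CodeSeq.code [:: 2, n, x & [seq val i | i <- enum (supp D x : {set 'I_n})]]].

(* The increasing enumeration of a finite suborder [a] of [X]. *)
Definition en (X : linord) (a : {fset nat}) (i : 'I_#|` a|) : nat :=
  nth 0 (sort (fun x y => `[< X x y >]) a) i.

(* For a subset [b] of [X] and [a] contained in [b], [card_incl X a b h] says that
   [h] is the morphism |iota| for the inclusion iota of [a] into [b]. *)
Definition card_incl (X : linord) (a b : {fset nat})
    (h : emb #|` a| #|` b|) : Prop :=
  forall i, en X (h i) = en X i.

Lemma card_incl_exists_unique (X : linord) (a b : {fset nat}) :
  (forall x, x \in a -> x \in b) -> (forall x, x \in b -> lo_set X x) ->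
  exists! h, card_incl X (a := a) (b := b) h.
Proof.
move=> ab bX.
pose r := fun x y => `[< X x y >].
have sort_r (c : {fset nat}) : (forall x, x \in c -> lo_set X x) ->
    sorted r (sort r c).
  move=> cX; apply: (@sort_sorted_in _ [in c]); last by apply/allP.
  move=> x y /cX xX /cX yX.
  by case: (lo_total xX yX) => h; apply/orP; [left|right]; apply/asboolP.
have r_tr : transitive r.
  by move=> y x z /asboolP xy /asboolP yz; apply/asboolP; apply: lo_trans yz.
have size_sr (c : {fset nat}) : size (sort r c) = #|` c| by rewrite size_sort.
have en_mem (c : {fset nat}) (i : 'I_#|` c|) : en X i \in c.
  by rewrite /en -(mem_sort r) mem_nth // size_sr.
have uniq_sr (c : {fset nat}) : uniq (sort r c) by rewrite sort_uniq fset_uniq.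
have en_inj (c : {fset nat}) : injective (@en X c).
  move=> i j /eqP; rewrite /en nth_uniq ?size_sr // => /eqP; exact: val_inj.
have en_mono (c : {fset nat}) : (forall x, x \in c -> lo_set X x) ->
    forall i j : 'I_#|` c|, i <= j -> X (en X i) (en X j).
  move=> cX i j; rewrite leq_eqVlt => /orP[/eqP /val_inj ->|ij].
    exact/cX/en_mem.
  apply/asboolP; have := sort_r c cX => /(sorted_ltn_nth r_tr 0).
  by apply=> //; rewrite inE size_sr.
have aX x : x \in a -> lo_set X x by move/ab/bX.
have idxP (i : 'I_#|` a|) : index (en X i) (sort r b) < #|` b|.
  by rewrite -size_sr index_mem mem_sort; apply/ab/en_mem.
pose h := [ffun i => Ordinal (idxP i)].
have hE i : en X (h i) = en X i.
  by rewrite ffunE /en /= nth_index // mem_sort; apply/ab/en_mem.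
have hP : [forall i : 'I_#|` a|, forall j : 'I_#|` a|, (i < j) ==> (h i < h j)].
  apply/forallP => i; apply/forallP => j; apply/implyP => ij.
  rewrite ltnNge; apply/negP => /(en_mono _ bX); rewrite !hE => ji.
  have /(lo_anti ji)/en_inj ij' := en_mono _ aX _ _ (ltnW ij).
  by rewrite ij' ltnn in ij.
exists (exist _ h hP); split => [i|g gE]; first exact: hE.
apply/val_inj/ffunP => i; apply: en_inj; rewrite [LHS]hE.
by rewrite -(gE i).
Qed.

Definition dbar_set (D : predilator) (X : linord) : set (nat * {fset nat}) :=
  [set p | [/\ forall x, x \in p.2 -> lo_set X x,
               lo_set (D #|` p.2|) p.1
             & supp D p.1 = [set: 'I_#|` p.2|]%SET]].

Definition dbar_le (D : predilator) (X : linord) (p q : nat * {fset nat}) : Prop :=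
  exists (f : emb #|` p.2| #|` (p.2 `|` q.2)%fset|)
         (g : emb #|` q.2| #|` (p.2 `|` q.2)%fset|),
    [/\ card_incl X f, card_incl X g
      & D #|` (p.2 `|` q.2)%fset| (dmap D f p.1) (dmap D g q.1)].

Definition dbar_lt (D : predilator) (X : linord) (p q : nat * {fset nat}) : Prop :=
  dbar_le D X p q /\ p <> q.

Definition dbar_elt_code (p : nat * {fset nat}) : nat :=
  CodeSeq.code (p.1 :: sort leq p.2).

Definition dilator_in (M : omega_model) (D : predilator) : Prop :=
  forall X : linord, M (lo_code X) -> well_order_in M X ->
    well_founded_in M dbar_elt_code (dbar_set D X) (dbar_lt D X).

(* Truth is satisfaction in the full omega-model. *)
Definition dilator (D : predilator) : Prop := dilator_in [set: set nat] D.

(* The term 2^{x_(n-1)} + ... + 2^{x_0} is represented by the sequence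
   [:: x_(n-1); ...; x_0]. *)
Fixpoint descending (X : linord) (s : seq nat) : Prop :=
  match s with
  | [::] => True
  | x :: s' => [/\ lo_set X x,
                   (if s' is y :: _ then lo_lt X y x else True)
                 & descending X s']
  end.

Fixpoint exp2_lt (X : linord) (s t : seq nat) : Prop :=
  match s, t with
  | _, [::] => False
  | [::], _ :: _ => True
  | x :: s', y :: t' => lo_lt X x y \/ (x = y /\ exp2_lt X s' t')
  end.

Definition pi02_TI_star (M : omega_model) : Prop :=
  forall X : linord, M (lo_code X) ->
    well_founded_in M CodeSeq.code [set s | descending X s] (exp2_lt X) ->
    forall (p : form) (S : nat -> set nat) (v : nat -> nat),
      pi02 p -> (forall i, M (S i)) ->
      (forall x, lo_set X x ->
         (forall y, lo_lt X y x -> sat S (scons y v) p) ->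
         sat S (scons x v) p) ->
      forall x, lo_set X x -> sat S (scons x v) p.

(* Main.v *)
(* If [D] fails to be provably a dilator, some omega-model contains a well order
   [X] (in its sense) and a descending sequence in [D(X)].  In each element of
   [D(X)] the variables carry a linear priority.  Since [D] is a dilator, the
   variables of each priority stabilize along the sequence; this yields an
   infinite branch of terms of [D] that are compared lexicographically in their
   variables.  Now suppose that Pi^0_2-induction fails along [X] while [2^X] is
   well-founded in [M].  A descending sequence of counterexamples is limit
   computable; the finite stacks of current guesses for it assign values to the
   variables of the branch so that each change of guess lowers the value of the
   first variable concerned.  These values form an order [W] that is ranked by
   [2^X], hence is a well order in [M], but [M] computes a descending sequence in
   [D(W)].  So [D] is not a dilator in [M].

   The two alternatives exclude each other because any countably many sets
   belong to an omega-model of RCA_0 in which Pi^0_2-TI^* fails: a Turing ideal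
   over a generic order [X] of type omega + omega^*, in which [2^X] is
   well-founded while the Pi^0_2 set omega is progressive. *)
Require Import Defs.
From mathcomp Require Import all_boot.
From mathcomp Require Import finmap zify.
From mathcomp Require Import boolp classical_sets.

Set Implicit Arguments.
Unset Strict Implicit.
Unset Printing Implicit Defensive.

(** Computability is replaced by continuity. The witness [Y] of an entailment is arbitrary, so it
    may list, for countably many operators at once, which finite pieces of an argument force which
    values; a model of [RCA0] containing this list is closed under each operator wherever it is
    continuous. So a construction inside a model only has to use, for each output bit, finitely many
    bits of the argument at hand, and the branch, chosen outside of all models, may be built into
    the operators.

    Two kinds of well-foundedness occur. A model's orders are well-founded only for sequences of the
    model, whereas a chain of terms that dominate each other is selected by choice and need not
    belong to it. Such chains are excluded by the true dilator property at omega^2: shared variables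
    start blocks of type omega, which have room for the unboundedly many other variables. The values
    of a single variable, in contrast, form a sequence of the model, whose own well-foundedness
    makes them stabilize. *)

(** * Continuity at a point *)

Definition agree_below (b : nat) (A A' : set nat) : Prop :=
  forall x, x < b -> A' x = A x.

(** Continuity of [G] at the point [A] alone, with [T] discrete. Nothing is asked at other points,
    so an unbounded search may be used as soon as it succeeds at [A]. *)
Definition fin_det (T : Type) (G : set nat -> T) (A : set nat) : Prop :=
  exists b, forall A', agree_below b A A' -> G A' = G A.

Lemma fin_det_const T (c : T) A : fin_det (fun _ => c) A.
Proof. by exists 0. Qed.

Lemma fin_det_bit x A : fin_det (fun A' => A' x) A.
Proof. by exists x.+1 => A'; apply. Qed.

(** Near [A] the value [G A'] is frozen at [G A], so [H] has to be continuous for this one value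
    only. This is how computations whose later queries depend on earlier answers are handled. *)
Lemma fin_det_bind T U (G : set nat -> T) (H : T -> set nat -> U) A :
  fin_det G A -> fin_det (H (G A)) A -> fin_det (fun A' => H (G A') A') A.
Proof.
move=> [b hb] [c hc]; exists (maxn b c) => A' hA.
by rewrite hb ?hc // => x hx; apply: hA; lia.
Qed.

Lemma fin_det_map T U (h : T -> U) (G : set nat -> T) A :
  fin_det G A -> fin_det (fun A' => h (G A')) A.
Proof. by move=> [b hb]; exists b => A' /hb ->. Qed.

Lemma fin_det_map2 T1 T2 U (h : T1 -> T2 -> U) G1 G2 A :
  fin_det G1 A -> fin_det G2 A -> fin_det (fun A' => h (G1 A') (G2 A')) A.
Proof.
move=> d1 d2; apply: (fin_det_bind (H := fun x A' => h x (G2 A'))) => //.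
exact: fin_det_map.
Qed.

Lemma fin_det_seq (I : eqType) U (l : seq I) (H : I -> set nat -> U) A :
  (forall i, i \in l -> fin_det (H i) A) ->
  fin_det (fun A' => [seq H i A' | i <- l]) A.
Proof.
elim: l => [|i l ih] h /=; first exact: fin_det_const.
apply: fin_det_map2; first by apply: h; rewrite inE eqxx.
by apply: ih => j jl; apply: h; rewrite inE jl orbT.
Qed.

Lemma fin_det_filter (I : eqType) (l : seq I) (H : I -> set nat -> bool) A :
  (forall i, i \in l -> fin_det (H i) A) ->
  fin_det (fun A' => [seq i <- l | H i A']) A.
Proof.
elim: l => [|i l ih] h /=; first exact: fin_det_const.
apply: (fin_det_map2 (fun (b : bool) s => if b then i :: s else s)).
  by apply: h; rewrite inE eqxx.
by apply: ih => j jl; apply: h; rewrite inE jl orbT.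
Qed.

Lemma fin_det_forall_lt n (H : nat -> set nat -> Prop) A :
  (forall i, i < n -> fin_det (H i) A) ->
  fin_det (fun A' => forall i, i < n -> H i A') A.
Proof.
elim: n => [|n ih] h; first by exists 0 => A' _; apply: propext; split.
have [b hb] := h n (ltnSn n).
have [c hc] := ih (fun i hi => h i (ltnW hi)).
exists (maxn b c) => A' hA; apply: propext.
have e1 : H n A' = H n A by apply: hb => x hx; apply: hA; lia.
have e2 : (forall i, i < n -> H i A') = (forall i, i < n -> H i A).
  by apply: hc => x hx; apply: hA; lia.
split=> hh i; rewrite ltnS leq_eqVlt => /orP[/eqP->|].
- by rewrite -e1; apply: hh.
- by move: i; rewrite -e2 => i hi; apply: hh; lia.
- by rewrite e1; apply: hh.
- by move: i; rewrite e2 => i hi; apply: hh; lia.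
Qed.

Lemma fin_det_not (H : set nat -> Prop) A :
  fin_det H A -> fin_det (fun A' => ~ H A') A.
Proof. exact: fin_det_map. Qed.

Lemma fin_det_exists_lt n (H : nat -> set nat -> Prop) A :
  (forall i, i < n -> fin_det (H i) A) ->
  fin_det (fun A' => exists i, i < n /\ H i A') A.
Proof.
move=> h.
have [b hb] := fin_det_not (fin_det_forall_lt (fun i hi => fin_det_not (h i hi))).
have e A' : (exists i, i < n /\ H i A') = ~ (forall i, i < n -> ~ H i A').
  apply: propext; split=> [[i [hi Hi]] hn|]; first exact: hn i hi Hi.
  by move=> hn; apply: contrapT => hne; apply: hn => i hi Hi; apply: hne; exists i.
by exists b => A' hA; rewrite !e; apply: hb.
Qed.

Definition cont_at (Phi : set nat -> set nat) (A : set nat) : Prop :=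
  forall n, fin_det (fun A' => Phi A' n) A.

(** [(i + j) ^ 2 + i] lies below [(i + j).+1 ^ 2], so the code determines [i + j]. *)
Lemma pair_code_inj i j i' j' :
  pair_code i j = pair_code i' j' -> i = i' /\ j = j'.
Proof.
rewrite /pair_code => e.
have h : i + j = i' + j'.
  case: (ltngtP (i + j) (i' + j')) => // h; exfalso.
    have : (i + j).+1 ^ 2 <= (i' + j') ^ 2 by rewrite leq_exp2r.
    by rewrite -addn1 sqrnD; lia.
  have : (i' + j').+1 ^ 2 <= (i + j) ^ 2 by rewrite leq_exp2r.
  by rewrite -addn1 sqrnD; lia.
by move: e; rewrite h => e; split; lia.
Qed.

Lemma leq_pair_code i j : i <= pair_code i j /\ j <= pair_code i j.
Proof.
rewrite /pair_code; split; first by lia.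
have : i + j <= (i + j) ^ 2 by case: (i + j) => // n; rewrite -mulnn; nia.
lia.
Qed.

Definition graph (z : nat -> nat) : set nat :=
  fun k => exists i, k = pair_code i (z i).

Lemma graphE z i x : graph z (pair_code i x) <-> z i = x.
Proof.
split=> [[j /pair_code_inj[<- <-]]//|<-].
by exists i.
Qed.

(** Since [i <= pair_code i x], membership of [n] in the graph involves only the values at
    [i <= n]. *)
Lemma cont_at_graph (Z : set nat -> nat -> nat) A :
  (forall i, fin_det (fun A' => Z A' i) A) ->
  cont_at (fun A' => graph (Z A')) A.
Proof.
move=> h n.
have [b hb] : fin_det (fun A' => exists i, i < n.+1 /\ n = pair_code i (Z A' i)) A.
  apply: fin_det_exists_lt => i _.
  exact: (fin_det_map (fun z => n = pair_code i z) (h i)).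
exists b => A' /hb e.
have e' (z : nat -> nat) : graph z n = (exists i, i < n.+1 /\ n = pair_code i (z i)).
  apply: propext; split=> [[i ->]|[i [_ ->]]]; exists i => //.
  by split=> //; rewrite ltnS; exact: (leq_pair_code _ _).1.
by rewrite !e'.
Qed.

Definition rel_code (R : nat -> nat -> Prop) : set nat :=
  fun k => exists x y, R x y /\ k = pair_code x y.

Lemma rel_codeE R x y : rel_code R (pair_code x y) <-> R x y.
Proof.
split=> [[x' [y' [h /pair_code_inj[-> ->]]]]//|h].
by exists x, y.
Qed.

Lemma cont_at_rel_code (R : set nat -> nat -> nat -> Prop) A :
  (forall x y, fin_det (fun A' => R A' x y) A) ->
  cont_at (fun A' => rel_code (R A')) A.
Proof.
move=> h n.
have [b hb] : fin_det (fun A' => exists x, x < n.+1 /\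
    exists y, y < n.+1 /\ (R A' x y /\ n = pair_code x y)) A.
  apply: fin_det_exists_lt => x _; apply: fin_det_exists_lt => y _.
  exact: (fin_det_map (fun z => z /\ n = pair_code x y) (h x y)).
exists b => A' /hb e.
have e' (r : nat -> nat -> Prop) : rel_code r n =
    (exists x, x < n.+1 /\ exists y, y < n.+1 /\ (r x y /\ n = pair_code x y)).
  apply: propext; split=> [[x [y [hr ->]]]|[x [_ [y [_ [hr ->]]]]]]; last by exists x, y.
  have [hx hy] := leq_pair_code x y.
  by exists x; split=> //; exists y.
by rewrite !e'.
Qed.

(** * Closure of omega-models of RCA0 under continuous operators *)

Definition pairT (s t : term) : term := Add (Mul (Add s t) (Add s t)) s.

Definition numT (n : nat) : term := iter n (Add One) Zero.

Lemma eval_numT v n : eval v (numT n) = n.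
Proof. by elim: n => //= n ->. Qed.

Definition bit (s j : nat) : bool := odd (s %/ 2 ^ j).

Lemma exists_bits (A : set nat) k :
  exists s, forall j, j < k -> bit s j <-> A j.
Proof.
pose F := fix F (B : nat -> bool) k := if k is k'.+1 then B 0 + (F (fun j => B j.+1) k').*2 else 0.
have FP B n j : j < n -> bit (F B n) j = B j.
  elim: n B j => // n ih B [|j] hj /=; rewrite /bit.
    by rewrite expn0 divn1 oddD odd_double addbF oddb.
  rewrite expnS divnMA divn2 halfD odd_double andbF half_double /= add0n.
  have -> : (B 0 : nat)./2 = 0 by case: (B 0).
  by rewrite add0n; exact: ih.
exists (F (fun j => `[< A j >]) k) => j hj; rewrite FP //.
by split=> /asboolP.
Qed.

Definition codes_below (s k : nat) (A : set nat) : Prop :=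
  forall j, j < k -> bit s j <-> A j.

Section Oracle.

Variables (I : countType) (Phi : I -> set nat -> set nat).

(** The finite pieces [(s, k)] that force [n] into [Phi e A] carry tag 1, those that force it out
    tag 2. Tag 0 tabulates binary digits, so that [codes_below] is expressed by a bounded formula in
    a language without exponentiation. *)
Definition oracle : set nat := fun y =>
  (exists s j, bit s j /\ y = pair_code 0 (pair_code s j)) \/
  (exists e n s k, (forall A, codes_below s k A -> Phi e A n) /\
     y = pair_code 1 (pair_code (pair_code (choice.pickle e) n) (pair_code s k))) \/
  (exists e n s k, (forall A, codes_below s k A -> ~ Phi e A n) /\
     y = pair_code 2 (pair_code (pair_code (choice.pickle e) n) (pair_code s k))).

Lemma oracle0 s j : oracle (pair_code 0 (pair_code s j)) <-> bit s j.
Proof.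
split=> [|h]; last by left; exists s, j.
case=> [[s' [j' [h]]]|[]] => [|[e [n [s' [k [_]]]]]|[e [n [s' [k [_]]]]]].
- by case/pair_code_inj=> _ /pair_code_inj[-> ->].
- by case/pair_code_inj.
- by case/pair_code_inj.
Qed.

Lemma oracle1 e n s k :
  oracle (pair_code 1 (pair_code (pair_code (choice.pickle e) n) (pair_code s k))) <->
  (forall A, codes_below s k A -> Phi e A n).
Proof.
split=> [|h]; last by right; left; exists e, n, s, k.
case=> [[s' [j' [h]]]|[]] => [|[e' [n' [s' [k' [h]]]]]|[e' [n' [s' [k' [h]]]]]];
  case/pair_code_inj=> // _.
by case/pair_code_inj=> /pair_code_inj[/(pcan_inj (@choice.pickleK I)) -> ->] /pair_code_inj[-> ->].
Qed.

Lemma oracle2 e n s k :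
  oracle (pair_code 2 (pair_code (pair_code (choice.pickle e) n) (pair_code s k))) <->
  (forall A, codes_below s k A -> ~ Phi e A n).
Proof.
split=> [|h]; last by right; right; exists e, n, s, k.
case=> [[s' [j' [h]]]|[]] => [|[e' [n' [s' [k' [h]]]]]|[e' [n' [s' [k' [h]]]]]];
  case/pair_code_inj=> // _.
by case/pair_code_inj=> /pair_code_inj[/(pcan_inj (@choice.pickleK I)) -> ->] /pair_code_inj[-> ->].
Qed.

(* Variables: 0 = k, 1 = s, 2 = bound for both, 3 = n, 4 = e; set 0 is the
   oracle and set 1 is the argument of the operator. *)
Let matrix (tag : nat) : form :=
  And (Defs.Mem (pairT (numT tag) (pairT (pairT (Var 4) (Var 3)) (pairT (Var 1) (Var 0)))) 0)
      (BAll (Var 0)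
         (And (Imp (Defs.Mem (pairT (numT 0) (pairT (Var 2) (Var 0))) 0) (Defs.Mem (Var 0) 1))
              (Imp (Defs.Mem (Var 0) 1) (Defs.Mem (pairT (numT 0) (pairT (Var 2) (Var 0))) 0)))).

(** At an argument of continuity every [n] is decided by a finite piece. Membership is thus both
    Sigma^0_1, some piece of [A] forces [n] in, and Pi^0_1, no piece of [A] forces [n] out, and
    Delta^0_1 comprehension applies. *)
Lemma oracle_closed (M : omega_model) : RCA0 M -> M oracle ->
  forall e A, M A -> cont_at (Phi e) A -> M (Phi e A).
Proof.
move=> hM MY e A MA hc.
pose S := fun i => if i is 0 then oracle else A.
pose v : nat -> nat := fun _ => choice.pickle e.
have satm tag k s z n : sat S (scons k (scons s (scons z (scons n v)))) (matrix tag) <->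
    oracle (pair_code tag (pair_code (pair_code (choice.pickle e) n) (pair_code s k))) /\
    codes_below s k A.
  rewrite /matrix /= -!/(pairT _ _) !eval_numT !mulnn -!/(pair_code _ _).
  split=> -[h1 h2]; split=> // j hj.
    have [] := h2 j hj; rewrite /= -!/(pair_code _ _) => a b.
    by split=> [/oracle0 /a|/b /oracle0].
  rewrite /= -!/(pair_code _ _); have [a b] := h2 j hj.
  by split=> [/oracle0 /a|/b] // ?; apply/oracle0.
(* The one unbounded variable only bounds [s] and [k], which brings two unbounded quantifiers into
   the form demanded by [sigma01] and [pi01]. *)
pose p := Ex (BEx (Var 0) (BEx (Var 1) (matrix 1))).
pose q := All (BAll (Var 0) (BAll (Var 1) (Not (matrix 2)))).
have satp n : sat S (scons n v) p <-> Phi e A n.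
  split.
    move=> [z [s [_ [k [_ /satm[/oracle1 h hs]]]]]]; exact: h.
  move=> hP; have [k hk] := hc n; have [s hs] := exists_bits A k.
  exists (maxn s k).+1; exists s; split; first by rewrite /=; lia.
  exists k; split; first by rewrite /=; lia.
  apply/satm; split=> //; apply/oracle1 => A' hA'; rewrite hk // => x hx.
  by apply: propext; rewrite -(hs x hx) -(hA' x hx).
have satq n : sat S (scons n v) q <-> Phi e A n.
  split.
    move=> h; apply: contrapT => hP.
    have [k hk] := hc n; have [s hs] := exists_bits A k.
    apply: (h (maxn s k).+1 s _ k); try by rewrite /=; lia.
    apply/satm; split=> //; apply/oracle2 => A' hA'; rewrite hk // => x hx.
    by apply: propext; rewrite -(hs x hx) -(hA' x hx).
  by move=> hP z s _ k _ /satm[/oracle2 h /h].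
have := @RCA0_delta01_comprehension M hM p q S v isT isT.
case=> [[|i]//|n|X [MX hX]].
  by rewrite satp satq.
by suff <- : X = Phi e A by []; apply/funext => n; apply/propext; rewrite hX satp.
Qed.

End Oracle.

(** * Least-number search and thinning of sequences *)

Definition least (P : nat -> Prop) : nat :=
  if pselect (exists n, `[< P n >]) is left h then ex_minn h else 0.

Lemma leastP (P : nat -> Prop) : (exists n, P n) ->
  P (least P) /\ forall m, P m -> least P <= m.
Proof.
move=> [n Pn]; rewrite /least; case: pselect => [h|[]]; last first.
  by exists n; apply/asboolP.
case: ex_minnP => m /asboolP Pm hm; split=> // k Pk.
by apply: hm; apply/asboolP.
Qed.

Lemma least_eq (P : nat -> Prop) n : P n -> (forall m, m < n -> ~ P m) -> least P = n.
Proof.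
move=> Pn hn; have [|h1 h2] := @leastP P; first by exists n.
by apply/eqP; rewrite eqn_leq h2 //= leqNgt; apply/negP => /hn.
Qed.

(** The bits that settle [P] up to the least solution at [A] also keep nearby searches from stopping
    elsewhere; a solution is required at [A] only. *)
Lemma fin_det_least (P : set nat -> nat -> Prop) A :
  (forall n, fin_det (fun A' => P A' n) A) -> (exists n, P A n) ->
  fin_det (fun A' => least (P A')) A.
Proof.
move=> hP hex; have [Pn hn] := leastP hex; set n := least (P A) in Pn hn *.
have [b hb] := hP n.
have [c hc] := @fin_det_forall_lt n (fun m A' => ~ P A' m) A
  (fun m _ => fin_det_not (hP m)).
exists (maxn b c) => A' hA; apply: least_eq.
  by rewrite hb // => x hx; apply: hA; lia.
rewrite hc => [m hm /hn|x hx]; first by rewrite leqNgt hm.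
by apply: hA; lia.
Qed.

Definition val_at (A : set nat) (i : nat) : nat :=
  least (fun z => A (pair_code i z)).

Lemma val_at_graph z i : val_at (graph z) i = z i.
Proof.
apply: least_eq => [|m hm]; first exact/graphE.
by move/graphE => e; rewrite e ltnn in hm.
Qed.

Lemma fin_det_val_at z i : fin_det (fun A => val_at A i) (graph z).
Proof.
apply: fin_det_least => [n|]; first exact: fin_det_bit.
by exists (z i); apply/graphE.
Qed.

(* Enumerates the places at which the sequence coded by [A] has changed since
   the previous such place. *)
Fixpoint change (A : set nat) (n : nat) : nat :=
  if n is n'.+1 then
    least (fun j => change A n' < j /\ val_at A j <> val_at A (change A n'))
  else 0.

Definition thin (A : set nat) : set nat := graph (fun n => val_at A (change A n)).

(** The hypothesis makes all searches in [change] succeed at [graph z]. *)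
Lemma cont_at_thin z :
  (forall N, exists2 i, N < i & z i <> z N) -> cont_at thin (graph z).
Proof.
move=> hz; have hch n : fin_det (fun A => change A n) (graph z).
  elim: n => [|n ih]; first exact: fin_det_const.
  apply: (fin_det_bind (H := fun c A =>
    least (fun j => c < j /\ val_at A j <> val_at A c)) ih).
  set c := change _ _; apply: fin_det_least => [j|].
    exact: (fin_det_map2 (fun u v => c < j /\ u <> v) (fin_det_val_at z j) (fin_det_val_at z c)).
  by have [j cj hj] := hz c; exists j; rewrite !val_at_graph.
apply: cont_at_graph => i.
exact: (fin_det_bind (H := fun c A => val_at A c) (hch i) (fin_det_val_at z _)).
Qed.

(** Well-foundedness in [M] excludes strictly descending sequences; here it is applied to weakly
    descending ones. If the sequence changed infinitely often, [thin] would be continuous at its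
    graph and would give a strictly descending sequence in [M]. *)
Lemma eventually_constant (M : omega_model) T (c : T -> nat) (S : set T)
    (lt : T -> T -> Prop) (F : nat -> T) :
  (forall A, M A -> cont_at thin A -> M (thin A)) ->
  well_founded_in M c S lt ->
  (forall x y, S x -> S y -> c x = c y -> x = y) ->
  (forall x y z, S x -> S y -> S z -> lt x y -> lt y z -> lt x z) ->
  (forall i, S (F i)) ->
  (forall i, F i.+1 = F i \/ lt (F i.+1) (F i)) ->
  M (graph (fun i => c (F i))) ->
  exists N, forall i, N <= i -> F i = F N.
Proof.
move=> hM hwf cinj ltr SF hF MF; apply: contrapT => hnc; apply: hwf.
set z := fun i => c (F i) in MF.
have hle i j : i <= j -> F j = F i \/ lt (F j) (F i).
  move=> /subnK <-; elim: (j - i) => [|k ih]; first by left.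
  rewrite addSn; case: (hF (k + i)) => [->//|h1]; case: ih => [<-|h2]; right=> //.
  exact: ltr h2.
have hz N : exists2 i, N < i & z i <> z N.
  apply: contrapT => hN; apply: hnc; exists N => i; rewrite leq_eqVlt => /orP[/eqP->//|hi].
  by apply: contrapT => hne; apply: hN; exists i => // /cinj -/(_ (SF _) (SF _)).
exists (fun n => F (change (graph z) n)); split=> // [i|].
  have [] := @leastP (fun j => change (graph z) i < j /\
      val_at (graph z) j <> val_at (graph z) (change (graph z) i)).
    by have [j hj e] := hz (change (graph z) i); exists j; rewrite !val_at_graph.
  rewrite -[least _]/(change (graph z) i.+1) !val_at_graph /z => -[h1 h2] _.
  by case: (hle _ _ (ltnW h1)) => // e; rewrite e in h2.
have -> : [set k | exists i, k = pair_code i (c (F (change (graph z) i)))]%classic =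
    thin (graph z).
  by congr graph; apply/funext => n; rewrite val_at_graph.
exact: hM (cont_at_thin hz).
Qed.

(** * Renaming of variables and bounded comprehension *)

Definition up (r : nat -> nat) (i : nat) : nat := if i is j.+1 then (r j).+1 else 0.

Fixpoint ren_term (r : nat -> nat) (t : term) : term :=
  match t with
  | Var i => Var (r i)
  | Zero => Zero
  | One => One
  | Add s t => Add (ren_term r s) (ren_term r t)
  | Mul s t => Mul (ren_term r s) (ren_term r t)
  end.

Fixpoint ren (r : nat -> nat) (p : form) : form :=
  match p with
  | Eq s t => Eq (ren_term r s) (ren_term r t)
  | Lt s t => Lt (ren_term r s) (ren_term r t)
  | Defs.Mem t i => Defs.Mem (ren_term r t) i
  | Not p => Not (ren r p)
  | And p q => And (ren r p) (ren r q)
  | Or p q => Or (ren r p) (ren r q)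
  | Imp p q => Imp (ren r p) (ren r q)
  | BAll t p => BAll (ren_term r t) (ren (up r) p)
  | BEx t p => BEx (ren_term r t) (ren (up r) p)
  | All p => All (ren (up r) p)
  | Ex p => Ex (ren (up r) p)
  end.

Lemma eval_ren v r t : eval v (ren_term r t) = eval (fun i => v (r i)) t.
Proof. by elim: t => //= [s -> t ->|s -> t ->]. Qed.

Lemma sat_ren S v r p : sat S v (ren r p) = sat S (fun i => v (r i)) p.
Proof.
have scons_up x w q : (fun i => scons x w (up q i)) = scons x (fun i => w (q i)).
  by apply/funext => -[].
elim: p v r => /= [s t|s t|t i|p ih|p ihp q ihq|p ihp q ihq|p ihp q ihq|t p ih|t p ih|p ih|p ih] v r;
  rewrite ?eval_ren ?ih ?ihp ?ihq //.
- by apply: propext; split=> h x hx; have := h x hx; rewrite ih scons_up.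
- by apply: propext; split=> -[x [hx h]]; exists x; split=> //; move: h; rewrite ih scons_up.
- by apply: propext; split=> h x; have := h x; rewrite ih scons_up.
- by apply: propext; split=> -[x h]; exists x; move: h; rewrite ih scons_up.
Qed.

Lemma delta00_ren r p : delta00 (ren r p) = delta00 p.
Proof.
by elim: p r => //= [p ihp q ihq|p ihp q ihq|p ihp q ihq] r; rewrite ihp ihq.
Qed.

(** A vacuous unbounded quantifier makes the formula both Sigma^0_1 and Pi^0_1; renaming by [succn]
    keeps its variables clear of the new index 0. *)
Lemma delta00_comprehension (M : omega_model) (p : form) (S : nat -> set nat) v :
  RCA0 M -> (forall i, M (S i)) -> delta00 p -> M (fun n => sat S (scons n v) p).
Proof.
move=> hM MS hp; pose q := ren succn p.
have hq z n : sat S (scons z (scons n v)) q = sat S (scons n v) p by rewrite sat_ren.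
have := @RCA0_delta01_comprehension M hM (Ex q) (All q) S v.
rewrite /= delta00_ren => /(_ hp hp MS)[n|X [MX hX]].
  by split=> [[z]|h]; [rewrite hq => h z'|exists 0; move: (h 0)]; rewrite !hq.
suff <- : X = (fun n => sat S (scons n v) p) by [].
apply/funext => n; apply: propext; rewrite hX; split=> [[z]|h]; first by rewrite hq.
by exists 0; rewrite hq.
Qed.

Definition join (A B : set nat) : set nat := fun n =>
  exists x, (n = pair_code 0 x /\ A x) \/ (n = pair_code 1 x /\ B x).

Lemma join0 A B x : join A B (pair_code 0 x) = A x.
Proof.
apply: propext; split=> [[y [[/pair_code_inj[_ ->]]|[/pair_code_inj[]]]]//|h].
by exists x; left.
Qed.

Lemma join1 A B x : join A B (pair_code 1 x) = B x.
Proof.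
apply: propext; split=> [[y [[/pair_code_inj[]]|[/pair_code_inj[_ ->]]]]//|h].
by exists x; right.
Qed.

Lemma join_closed (M : omega_model) A B : RCA0 M -> M A -> M B -> M (join A B).
Proof.
move=> hM MA MB; pose S := fun i => if i is 0 then A else B.
pose p := BEx (Add One (Var 0))
  (Or (And (Eq (Var 1) (pairT (numT 0) (Var 0))) (Defs.Mem (Var 0) 0))
      (And (Eq (Var 1) (pairT (numT 1) (Var 0))) (Defs.Mem (Var 0) 1))).
have := @delta00_comprehension M p S id hM _ isT.
suff -> : (fun n => sat S (scons n id) p) = join A B.
  by apply => -[].
apply/funext => n; apply: propext; rewrite /p /=.
split=> [[x [_ h]]|[x h]]; exists x; first by rewrite !mulnn in h.
split; last by rewrite !mulnn.
by case: h => -[-> _]; have := (leq_pair_code 0 x).2; have := (leq_pair_code 1 x).2; lia.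
Qed.

Definition triple_code (m n x : nat) : nat := pair_code m (pair_code n x).

(** The matrix of a Pi^0_2 formula, with all its parameters, is packed into one set, which can then
    be an argument of continuous operators. *)
Lemma matrix_closed (M : omega_model) (p : form) (S : nat -> set nat) v :
  RCA0 M -> (forall i, M (S i)) -> delta00 p ->
  exists2 B, M B & forall m n x,
    B (triple_code m n x) = sat S (scons m (scons n (scons x v))) p.
Proof.
move=> hM MS hp.
(* Index 3 is now the code of the triple, so the number parameters move up by one. *)
pose q := ren (fun i => if i is i.+3 then i.+4 else i) p.
pose b k := Add One (Var k).
pose r := BEx (b 0) (BEx (b 1) (BEx (b 2)
  (And (Eq (Var 3) (pairT (Var 0) (pairT (Var 1) (Var 2)))) q))).
have hr : delta00 r by rewrite /= delta00_ren.
have hq m n x c : sat S (scons m (scons n (scons x (scons c v)))) q =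
    sat S (scons m (scons n (scons x v))) p.
  by rewrite sat_ren; congr sat; apply/funext => -[|[|[|i]]].
exists (fun n => sat S (scons n v) r); first exact: delta00_comprehension.
move=> m n x; apply: propext; rewrite [sat _ _ r]/=; set c := triple_code m n x.
split.
  move=> [x' [_ [n' [_ [m' [_ []]]]]]]; rewrite /= !mulnn hq => e.
  by have [-> /pair_code_inj[-> ->]] := pair_code_inj e.
move=> h; have [h1 h2] := leq_pair_code m (pair_code n x).
have [h3 h4] := leq_pair_code n x.
exists x; split; first by rewrite /= /c /triple_code; lia.
exists n; split; first by rewrite /= /c /triple_code; lia.
exists m; split; first by rewrite /= /c /triple_code; lia.
by split; [rewrite /= !mulnn|rewrite hq].
Qed.

(** * Increasing functions and their extension *)

Definition incr (n : nat) (f : nat -> nat) : Prop :=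
  forall i j, i < j -> j < n -> f i < f j.

Lemma incr_leq n f i j : incr n f -> i <= j -> j < n -> f i <= f j.
Proof.
by move=> hf; rewrite leq_eqVlt => /orP[/eqP->//|ij] jn; apply/ltnW/hf.
Qed.

Lemma incr_inv n f i j : incr n f -> i < n -> j < n -> (f i < f j) = (i < j).
Proof.
move=> hf hi hj; case: (ltnP i j) => ij; first by rewrite hf.
by apply/negbTE; rewrite -leqNgt (incr_leq hf).
Qed.

Lemma incr_inj n f i j : incr n f -> i < n -> j < n -> f i = f j -> i = j.
Proof.
move=> hf hi hj e; case: (ltngtP i j) => // h.
  by have := hf _ _ h hj; rewrite e ltnn.
by have := hf _ _ h hi; rewrite e ltnn.
Qed.

Lemma incr_sorted n f : incr n f -> sorted ltn (mkseq f n).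
Proof.
move=> hf; apply/(sortedP 0) => i; rewrite size_mkseq => hi.
by rewrite !nth_mkseq //; [apply: hf|apply: ltnW].
Qed.

Lemma incr_eq n m f g : incr n f -> incr m g ->
  mkseq f n =i mkseq g m -> n = m /\ forall i, i < n -> f i = g i.
Proof.
move=> hf hg e; have es : mkseq f n = mkseq g m.
  by apply: (irr_sorted_eq ltn_trans ltnn) => //; exact: incr_sorted.
have en : n = m by rewrite -(size_mkseq f n) es size_mkseq.
by split=> // i hi; have := congr1 (fun s => nth 0 s i) es; rewrite !nth_mkseq -?en.
Qed.

Lemma bounded_below n (f : nat -> nat) : exists N, forall i, i < n -> f i < N.
Proof.
elim: n => [|n [N hN]]; first by exists 0.
exists (maxn N (f n).+1) => i; rewrite ltnS leq_eqVlt => /orP[/eqP->|/hN]; lia.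
Qed.

(* The factor [K] makes room for the values of [phi] between those of [p']. *)
Lemma extend_incr (J : finType) (p p' : J -> nat) N :
  (forall i j, p i < p j -> p' i < p' j) -> (forall i j, p i = p j -> p' i = p' j) ->
  exists K phi, [/\ 0 < K, incr N phi, forall j, phi (p j) = K * (p' j).+1
    & forall y z, y < N -> (forall j, p j < y -> p' j < z) ->
        (forall j, p j = y -> p' j <= z) -> phi y <= K * z.+1].
Proof.
move=> hlt heq; pose K := N.+1.
pose mx y := \max_(j | p j < y) (p' j).+1.
have lemx y j : p j < y -> (p' j).+1 <= mx y.
  by move=> h; rewrite /mx (bigD1 j) //= leq_maxl.
(* [K * mx y] is the value of [phi] at the last point of [p] below [y], or 0. For [y < N], adding
   [y.+1 <= N < K] keeps the values at other points distinct and below the next multiple of [K]. *)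
pose phi y := if [pick j | p j == y] is Some j then K * (p' j).+1 else K * mx y + y.+1.
have phiP j : phi (p j) = K * (p' j).+1.
  rewrite /phi; case: pickP => [i /eqP /heq -> //|/(_ j)]; by rewrite eqxx.
have mxle y z : (forall j, p j < y -> p' j < z) -> mx y <= z.
  by move=> h; apply/bigmax_leqP => j /h.
have phiN y : (forall j, p j <> y) -> phi y = K * mx y + y.+1.
  by move=> h; rewrite /phi; case: pickP => // j /eqP /h.
have dec y : (exists j, p j = y) \/ (forall j, p j <> y).
  by case: (pselect (exists j, p j = y)) => [|h]; [left|right => j e; apply: h; exists j].
exists K, phi; split=> // [y y' lt_y y'N|y z yN h1 h2].
  case: (dec y) (dec y') => [[j ej]|hy] [[j' ej']|hy']; subst.
  - by rewrite !phiP ltn_pmul2l // ltnS hlt.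
  - rewrite phiP phiN //.
    have : (p' j).+1 <= mx y'; last by nia.
    exact: lemx.
  - rewrite phiP phiN //.
    have : mx y <= p' j'; last by rewrite /K; nia.
    by apply: mxle => i hi; apply: hlt; lia.
  - rewrite !phiN //; have : mx y <= mx y'; last by nia.
    apply/bigmax_leqP => i hi; apply: lemx; lia.
case: (dec y) => [[j ej]|hy]; first by subst; rewrite phiP leq_pmul2l // ltnS h2.
by rewrite phiN //; have := mxle _ _ h1; nia.
Qed.

Lemma emb_of n N f : incr n f -> (forall i, i < n -> f i < N) ->
  exists e : emb n N, forall i, e i = f i :> nat.
Proof.
move=> hf hN; pose h := [ffun i : 'I_n => Ordinal (hN i (ltn_ord i))].
have hP : [forall i : 'I_n, forall j : 'I_n, (i < j) ==> (h i < h j)].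
  apply/forallP => i; apply/forallP => j; apply/implyP => ij.
  by rewrite !ffunE /=; apply: hf.
by exists (exist _ h hP) => i; rewrite /emb_fun /= ffunE.
Qed.

Lemma emb_ext n N (p q : emb n N) : (forall i, p i = q i :> nat) -> p = q.
Proof. by move=> h; apply/val_inj/ffunP => i; apply: val_inj; apply: h. Qed.

(** * Terms of a predilator under numerical assignments *)

Section Terms.

Variable D : predilator.

Definition full (n s : nat) : Prop := lo_set (D n) s /\ @supp D n s = [set: 'I_n]%SET.

(** The order between the terms [s] and [t] after their variables are evaluated by [f] and [g] in
    the natural numbers. For full terms, [dleE] shows that the size [N] of the common target is
    irrelevant. *)
Definition dle (n s : nat) (f : nat -> nat) (m t : nat) (g : nat -> nat) : Prop :=
  exists N (p : emb n N) (q : emb m N),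
    [/\ forall i, p i = f i :> nat, forall j, q j = g j :> nat
      & D N (dmap D p s) (dmap D q t)].

(** Any two targets embed as initial segments into a common larger one, and [D] of an embedding
    preserves and reflects the order. *)
Lemma dleE n s (f : nat -> nat) m t (g : nat -> nat) N (p : emb n N) (q : emb m N) : full n s -> full m t ->
  (forall i, p i = f i :> nat) -> (forall j, q j = g j :> nat) ->
  dle n s f m t g <-> D N (dmap D p s) (dmap D q t).
Proof.
move=> [hs _] [ht _] hp hq; split; last by exists N, p, q.
move=> [N' [p' [q' [hp' hq' h]]]].
have incl A B : A <= B -> exists e : emb A B, forall i, e i = i :> nat.
  by move=> AB; apply: (@emb_of A B id) => // i hi; apply: leq_trans AB.
have [a ha] := incl N (maxn N N') (leq_maxl _ _).
have [b hb] := incl N' (maxn N N') (leq_maxr _ _).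
have ds k A (e : emb k A) x : lo_set (D k) x -> lo_set (D A) (dmap D e x).
  by move=> hx; case: (dmap_embedding e hx hx).
have [_ ->] := dmap_embedding a (ds _ _ p s hs) (ds _ _ q t ht).
have [_] := dmap_embedding b (ds _ _ p' s hs) (ds _ _ q' t ht).
rewrite -!dmap_comp //.
have -> : emb_comp a p = emb_comp b p'.
  by apply: emb_ext => i; rewrite /emb_fun /= !ffunE ha hb hp hp'.
have -> : emb_comp a q = emb_comp b q'.
  by apply: emb_ext => i; rewrite /emb_fun /= !ffunE ha hb hq hq'.
by move=> <-.
Qed.

Lemma emb_pair n f m g : incr n f -> incr m g -> exists N (p : emb n N) (q : emb m N),
  (forall i, p i = f i :> nat) /\ (forall j, q j = g j :> nat).
Proof.
move=> hf hg; have [A hA] := bounded_below n f; have [B hB] := bounded_below m g.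
have [|p hp] := @emb_of n (maxn A B) f hf; first by move=> i /hA; lia.
have [|q hq] := @emb_of m (maxn A B) g hg; first by move=> i /hB; lia.
by exists (maxn A B), p, q.
Qed.

Lemma dle_eq n s f f' m t g g' : (forall i, i < n -> f i = f' i) ->
  (forall j, j < m -> g j = g' j) -> dle n s f m t g -> dle n s f' m t g'.
Proof.
move=> hf hg [N [p [q [hp hq h]]]]; exists N, p, q; split=> // i; by rewrite ?hp ?hq ?hf ?hg.
Qed.

Lemma dle_comp n s f m t g N phi : full n s -> full m t -> incr n f -> incr m g ->
  (forall i, i < n -> f i < N) -> (forall j, j < m -> g j < N) -> incr N phi ->
  dle n s f m t g <-> dle n s (fun i => phi (f i)) m t (fun j => phi (g j)).
Proof.
move=> hs ht hf hg hfN hgN hphi.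
have [p hp] := emb_of hf hfN; have [q hq] := emb_of hg hgN.
have [N' hN'] := bounded_below N phi; have [e he] := emb_of hphi hN'.
rewrite (dleE (p := p) (q := q)) // (dleE (p := emb_comp e p) (q := emb_comp e q)) //;
  try by move=> i; rewrite /emb_fun /= ffunE he ?hp ?hq.
case: hs ht => [hs _] [ht _]; rewrite !dmap_comp //.
by apply: (dmap_embedding e _ _).2; [case: (dmap_embedding p hs hs)|case: (dmap_embedding q ht ht)].
Qed.

Lemma dle_refl n s f : full n s -> incr n f -> dle n s f n s f.
Proof.
move=> hs hf; have [N hN] := bounded_below n f; have [p hp] := emb_of hf hN.
by exists N, p, p; split=> //; case: (dmap_embedding p hs.1 hs.1).
Qed.

Lemma dle_total n s f m t g : full n s -> full m t -> incr n f -> incr m g ->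
  dle n s f m t g \/ dle m t g n s f.
Proof.
move=> hs ht hf hg; have [N [p [q [hp hq]]]] := emb_pair hf hg.
rewrite (dleE (p := p) (q := q)) // (dleE (p := q) (q := p)) //.
by apply: lo_total; [case: (dmap_embedding p hs.1 hs.1)|case: (dmap_embedding q ht.1 ht.1)].
Qed.

Lemma dle_trans n s f m t g k u h : full n s -> full m t -> full k u ->
  incr n f -> incr m g -> incr k h ->
  dle n s f m t g -> dle m t g k u h -> dle n s f k u h.
Proof.
move=> hs ht hu hf hg hh; have [A hA] := bounded_below n f.
have [B hB] := bounded_below m g; have [C hC] := bounded_below k h.
pose N := maxn A (maxn B C).
have [|p hp] := @emb_of n N f hf; first by move=> i /hA; rewrite /N; lia.
have [|q hq] := @emb_of m N g hg; first by move=> i /hB; rewrite /N; lia.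
have [|r hr] := @emb_of k N h hh; first by move=> i /hC; rewrite /N; lia.
rewrite (dleE (p := p) (q := q)) // (dleE (p := q) (q := r)) // (dleE (p := p) (q := r)) //.
exact: lo_trans.
Qed.

Lemma dle_mono n s f g : full n s -> incr n f -> incr n g ->
  (forall i, i < n -> f i <= g i) -> dle n s f n s g.
Proof.
move=> hs hf hg hfg; have [N [p [q [hp hq]]]] := emb_pair hf hg.
exists N, p, q; split=> //; apply: dmap_monotone hs.1 => i.
by rewrite hp hq hfg.
Qed.

(** Equal elements have equal supports. For full terms these are the ranges of the assignments, and
    an increasing function is determined by its range. *)
Lemma dle_anti n s f m t g : full n s -> full m t -> incr n f -> incr m g ->
  dle n s f m t g -> dle m t g n s f ->
  [/\ n = m, s = t & forall i, i < n -> f i = g i].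
Proof.
move=> hs ht hf hg; have [N [p [q [hp hq]]]] := emb_pair hf hg.
rewrite (dleE (p := p) (q := q)) // (dleE (p := q) (q := p)) // => h1 h2.
have e := lo_anti h1 h2.
have : @supp D N (dmap D p s) = @supp D N (dmap D q t) by rewrite e.
case: (hs) (ht) => [hs1 hs2] [ht1 ht2]; rewrite !supp_natural // hs2 ht2.
move=> /setP es; have [|enm hfg] := incr_eq hf hg.
  move=> y; apply/mapP/mapP => -[i]; rewrite mem_iota /= add0n => hi ->.
    have := es (p (Ordinal hi)); rewrite imset_f ?inE // => /esym/imsetP[j _ hj].
    exists (val j); first by rewrite mem_iota add0n ltn_ord.
    by rewrite -hq -hj hp.
  have := es (q (Ordinal hi)); rewrite [RHS]imset_f ?inE // => /imsetP[j _ hj].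
  exists (val j); first by rewrite mem_iota add0n ltn_ord.
  by rewrite -hp -hj hq.
move: q hq e {es h1 h2 ht1 ht2} ht hg; case: m / enm => q hq e ht hg.
have epq : p = q by apply: emb_ext => i; rewrite hp hq hfg.
split=> //; rewrite -epq in e.
by apply: (@lo_anti (D n)); apply/(dmap_embedding p _ _).2; rewrite ?e;
  first [exact: hs.1|exact: ht.1|case: (dmap_embedding p ht.1 ht.1)].
Qed.

Lemma incr_scale N K : 0 < K -> incr N (fun x => K * x.+1).
Proof. by move=> K0 i j ij _; rewrite ltn_pmul2l // ltnS. Qed.

Lemma incr_comp n f N phi : incr n f -> (forall i, i < n -> f i < N) -> incr N phi ->
  incr n (fun i => phi (f i)).
Proof. by move=> hf hN hphi i j ij jn; apply: hphi; [apply: hf|apply: hN]. Qed.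

Lemma dle_scale n s f m t g K : 0 < K -> full n s -> full m t -> incr n f -> incr m g ->
  dle n s f m t g <-> dle n s (fun i => K * (f i).+1) m t (fun j => K * (g j).+1).
Proof.
move=> K0 hs ht hf hg; have [A hA] := bounded_below n f; have [B hB] := bounded_below m g.
apply: (dle_comp (N := maxn A B) (phi := fun x => K * x.+1) hs ht hf hg).
- by move=> i /hA; lia.
- by move=> i /hB; lia.
- exact: incr_scale.
Qed.

Definition same_pattern n (f f' : nat -> nat) m (g g' : nat -> nat) : Prop :=
  forall i j, i < n -> j < m ->
    (f i < g j) = (f' i < g' j) /\ (g j < f i) = (g' j < f' i).

Lemma dle_pattern n s f f' m t g g' : full n s -> full m t ->
  incr n f -> incr m g -> incr n f' -> incr m g' ->
  same_pattern n f f' m g g' ->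
  dle n s f m t g <-> dle n s f' m t g'.
Proof.
move=> hs ht hf hg hf' hg' hpat.
have [A hA] := bounded_below n f; have [B hB] := bounded_below m g.
pose p (x : 'I_n + 'I_m) := match x with inl i => f i | inr j => g j end.
pose p' (x : 'I_n + 'I_m) := match x with inl i => f' i | inr j => g' j end.
have [||K [phi [K0 hphi phiE _]]] := @extend_incr ('I_n + 'I_m)%type p p' (maxn A B).
- move=> [i|i] [j|j] /=; try by rewrite !(incr_inv hf, incr_inv hg, incr_inv hf', incr_inv hg').
    by rewrite (hpat i j _ _).1.
  by rewrite (hpat j i _ _).2.
- have hp (i : 'I_n) (j : 'I_m) : f i = g j -> f' i = g' j.
    by have [h1 h2] := hpat i j (ltn_ord i) (ltn_ord j); move: h1 h2; lia.
  move=> [i|i] [j|j] /=; try by [move/(incr_inj hf) => -> //|move/(incr_inj hg) => -> //|exact: hp].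
  by move/esym/hp.
have hAB i : i < n -> f i < maxn A B by move=> /hA; lia.
have hBA j : j < m -> g j < maxn A B by move=> /hB; lia.
rewrite (dle_comp hs ht hf hg hAB hBA hphi) (dle_scale K0 hs ht hf' hg').
split; apply: dle_eq => i hi.
- exact: (phiE (inl (Ordinal hi))).
- exact: (phiE (inr (Ordinal hi))).
- by rewrite -(phiE (inl (Ordinal hi))).
- by rewrite -(phiE (inr (Ordinal hi))).
Qed.

(** Functoriality is combined with monotonicity of [D]: an increasing map [phi] that carries [f] to
    a scaled copy of [f'] sends [g] pointwise weakly below the scaled copy of [g']. *)
Lemma dle_mono_pattern n s f f' m t g g' : full n s -> full m t ->
  incr n f -> incr m g -> incr n f' -> incr m g' ->
  (forall i j, i < n -> j < m -> f i < g j -> f' i < g' j) ->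
  (forall i j, i < n -> j < m -> f i = g j -> f' i <= g' j) ->
  dle n s f m t g -> dle n s f' m t g'.
Proof.
move=> hs ht hf hg hf' hg' hlt heq h.
have [A hA] := bounded_below n f; have [B hB] := bounded_below m g.
have [||K [phi [K0 hphi phiE phile]]] :=
  @extend_incr 'I_n (fun i => f i) (fun i => f' i) (maxn A B).
- by move=> i j; rewrite (incr_inv hf) ?(incr_inv hf').
- by move=> i j /(incr_inj hf) -> //.
have hAB i : i < n -> f i < maxn A B by move=> /hA; lia.
have hBA j : j < m -> g j < maxn A B by move=> /hB; lia.
apply/(dle_scale K0 hs ht hf' hg').
have ig : incr m (fun j => phi (g j)) by exact: incr_comp hphi.
have ig' : incr m (fun j => K * (g' j).+1).
  by move=> i j ij jm; rewrite ltn_pmul2l // ltnS hg'.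
have if' : incr n (fun j => K * (f' j).+1).
  by move=> i j ij jm; rewrite ltn_pmul2l // ltnS hf'.
apply: (dle_trans (m := m) (t := t) (g := fun j => phi (g j))) => //.
  move/(dle_comp hs ht hf hg hAB hBA hphi): h.
  by apply: dle_eq => // i hi; rewrite (phiE (Ordinal hi)).
apply: dle_mono => // j hj; apply: phile; first exact: hBA.
  by move=> i; apply: hlt.
by move=> i; apply: heq.
Qed.

End Terms.

(** * Existence of a variable with priority *)

Section Priority.

Variables (D : predilator) (n s : nat) (hs : full D n s).

Definition agree_on (C : pred nat) (f g : nat -> nat) : Prop :=
  forall c, c < n -> C c -> f c = g c.

(* If no variable outside [C] had priority, one could raise all variables
   outside [C] by steps that do not increase the value of the term: step [v]
   raises [v] and slightly lowers the other variables. *)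
Lemma priority_exists (C : pred nat) : (exists2 i, i < n & ~~ C i) ->
  exists v, [/\ v < n, ~~ C v & forall f g, incr n f -> incr n g ->
    agree_on C f g -> f v < g v -> ~ dle D n s g n s f].
Proof.
move=> [i0 i0n Ci0]; apply: contrapT => hno.
have bad v : v < n -> ~~ C v -> exists f g,
    [/\ incr n f, incr n g, agree_on C f g, f v < g v & dle D n s g n s f].
  move=> vn Cv; apply: contrapT => h; apply: hno; exists v; split=> // f g hf hg hag hv hd.
  by apply: h; exists f, g.
(* Transfers the failure [bad] for [v] to other assignments. Nothing is known about the sizes of the
   changes in [bad], so [g'] has to push every variable other than [v] and outside [C] below all old
   values of its block, a block being a run not interrupted by [C] or [v]. *)
have move_down v f' g' : v < n -> ~~ C v -> incr n f' -> incr n g' ->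
    agree_on C f' g' -> f' v < g' v ->
    (forall i j, i < n -> j < n -> ~~ C i -> ~~ C j -> i != v -> j != v ->
       (forall c, c < n -> C c || (c == v) -> ~~ (i < c < j) && ~~ (j < c < i)) ->
       g' i < f' j) ->
    dle D n s g' n s f'.
  move=> vn Cv hf' hg' hag' hv' hblock.
  have [f [g [hf hg hag hv hd]]] := bad v vn Cv.
  (* An element of [C] weakly between [i] and [j] separates the new values or contradicts the old
     inequality. Otherwise [i] and [j] lie in one gap of [C], and the position of [v] relative to
     them decides. *)
  have claim i j : i < n -> j < n -> g i <= f j -> ~~ ((i == j) && C i) -> g' i < f' j.
    move=> hi hj hij hne.
    case: (pselect (exists c, [/\ i <= c, c <= j & C c])) => [[c [ic cj Cc]]|no1].
      have cn : c < n by lia.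
      have h1 := incr_leq hg' ic cn; have h2 := incr_leq hf' cj hj.
      rewrite (hag' c cn Cc) in h2.
      case: (ltngtP i c) ic => // [ic _|eic _]; first by have := hg' _ _ ic cn; lia.
      case: (ltngtP c j) cj => // [cj _|ecj _].
        by have := hf' _ _ cj hj; rewrite (hag' c cn Cc); lia.
      by move: hne; rewrite eic ecj eqxx /= -ecj Cc.
    case: (pselect (exists c, [/\ j <= c, c <= i & C c])) => [[c [jc ci Cc]]|no2].
      exfalso; have cn : c < n by lia.
      have h1 := incr_leq hf jc cn; have h2 := incr_leq hg ci hi.
      rewrite (hag c cn Cc) in h1.
      case: (ltngtP j c) jc => // [jc _|ejc _].
        by have := hf _ _ jc cn; rewrite (hag c cn Cc); lia.
      case: (ltngtP c i) ci => // [ci _|eci _]; first by have := hg _ _ ci hi; lia.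
      by move: hne; rewrite -eci ejc eqxx Cc.
    have nC i' j' c : i' <= c -> c <= j' -> (i' = i /\ j' = j \/ i' = j /\ j' = i) -> ~~ C c.
      move=> h1 h2 h3; apply/negP => Cc.
      by case: h3 => -[e1 e2]; subst; [apply: no1|apply: no2]; exists c.
    have [Ci Cj] : ~~ C i /\ ~~ C j.
      split; case: (leqP i j) => ij.
      - by apply: (nC i j); lia.
      - by apply: (nC j i); lia.
      - by apply: (nC i j); lia.
      - by apply: (nC j i); lia.
    have bl k : k < n -> ~~ C k -> k != v -> g' k < f' k.
      by move=> kn Ck kv; apply: hblock => // c _ _; lia.
    case: (eqVneq i v) => [eiv|niv].
      subst i; case: (eqVneq j v) => [ejv|njv]; first by subst j; lia.
      have vj : v < j by rewrite -(incr_inv hf) //; lia.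
      by have := hg' _ _ vj hj; have := bl _ hj Cj njv; lia.
    case: (eqVneq j v) => [ejv|njv].
      subst j; have iv : i < v by rewrite -(incr_inv hg) //; lia.
      by have := hf' _ _ iv hj; have := bl _ hi Ci niv; lia.
    case: (boolP (i < v < j)) => [/andP[iv vj]|nb1].
      by have := bl _ hi Ci niv; have := hf' _ _ iv vn; have := hf' _ _ vj hj; lia.
    case: (boolP (j < v < i)) => [/andP[jv vi]|nb2].
      by have := hf _ _ jv vn; have := hg _ _ vi hi; lia.
    apply: hblock => // c cn /orP[Cc|/eqP->]; last by rewrite nb1.
    apply/andP; split; apply/negP => /andP[h1 h2].
      by have := nC i j c (ltnW h1) (ltnW h2); rewrite Cc => /(_ (or_introl (conj erefl erefl))).
    by have := nC j i c (ltnW h1) (ltnW h2); rewrite Cc => /(_ (or_intror (conj erefl erefl))).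
  apply: (dle_mono_pattern hs hs hg hf hg' hf' _ _ hd) => i j hi hj e.
    apply: claim => //; first exact: ltnW.
    by apply/negP => /andP[/eqP eij Ci]; subst; rewrite (hag j) ?ltnn in e.
  case: (boolP ((i == j) && C i)) => [/andP[/eqP <- Ci]|h]; first by rewrite (hag' i).
  by apply/ltnW/claim => //; rewrite e.
(* [nx j] names the gap of [C] that contains [j] by its upper end, with [n] as the end of the last
   gap. *)
pose nx j := least (fun c => j <= c /\ (C c \/ n <= c)).
have nxP j : [/\ j <= nx j, C (nx j) \/ n <= nx j
    & forall c, j <= c -> C c \/ n <= c -> nx j <= c].
  have [|[h1 h2] h3] := @leastP (fun c => j <= c /\ (C c \/ n <= c)).
    by exists (j + n); split; [lia|right; lia].
  by split=> // c h4 h5; apply: h3.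
have nx_gt j : j < n -> ~~ C j -> j < nx j.
  move=> jn Cj; have [h1 h2 _] := nxP j; rewrite ltn_neqAle h1 andbT.
  by apply/eqP => e; case: h2; rewrite -e; [apply/negP|lia].
have nx_mono i j : i <= j -> nx i <= nx j.
  by move=> ij; have [_ _ h] := nxP i; have [h1 h2 _] := nxP j; apply: h; first lia.
(* At stage [v] of [e], variables of [C] stay at multiples of [4 * B]; in each gap the variables
   with index below [v] occupy the second interval of length [B] below the upper end, the others the
   first. The offset [v * n.+1 + j] puts everything at stage [v] below everything at stage [v.+1] in
   the same interval. *)
pose B := n.+1 * n.+1.
pose e v j := if C j then B * (4 * j) else B * (4 * nx j - (j < v) - 1) + (v * n.+1 + j).
have eN v j : ~~ C j -> e v j = B * (4 * nx j - (j < v) - 1) + (v * n.+1 + j).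
  by rewrite /e => /negbTE ->.
have eC v j : C j -> e v j = B * (4 * j) by rewrite /e => ->.
have off v j : v <= n -> j < n -> v * n.+1 + j < B by rewrite /B; nia.
have e_lo v j : v <= n -> j < n -> ~~ C j -> B * (4 * nx j) <= e v j + 2 * B.
  move=> vn jn Cj; rewrite eN //; have := nx_gt j jn Cj; case: (j < v); nia.
have e_hi v j : v <= n -> j < n -> ~~ C j -> e v j < B * (4 * nx j).
  move=> vn jn Cj; rewrite eN //; have := off v j vn jn; have := nx_gt j jn Cj.
  by case: (j < v); nia.
have B0 : 0 < B by rewrite /B.
have ei v : v <= n -> incr n (e v).
  move=> vn i j ij jn; have hi : i < n by lia.
  have hm := nx_mono i j (ltnW ij).
  case: (boolP (C i)) (boolP (C j)) => Ci [] Cj.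
  - by rewrite !eC //; nia.
  - rewrite eC //; have := e_lo v j vn jn Cj; have := nx_gt j jn Cj; nia.
  - rewrite (eC _ j) //; have := e_hi v i vn hi Ci.
    have [_ _ h] := nxP i; have := h j (ltnW ij) (or_introl Cj); nia.
  - move: hm; rewrite leq_eqVlt => /orP[/eqP hm|hm].
      rewrite !eN // hm; have := nx_gt j jn Cj.
      have : (j < v : nat) <= (i < v) by lia.
      by case: (i < v); case: (j < v) => // _; nia.
    have := e_hi v i vn hi Ci; have := e_lo v j vn jn Cj; nia.
(* Read from [e v.+1] to [e v], this raises [v] to the upper interval and lowers the other variables
   outside [C], as [move_down] requires. If [v] is in [C], nothing is raised and monotonicity
   suffices. *)
have step v : v < n -> dle D n s (e v) n s (e v.+1).
  move=> vn; have hlow i j : i < n -> j < n -> ~~ C i -> ~~ C j -> nx i = nx j ->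
      (i < v) = (j < v.+1) -> e v i < e v.+1 j.
    move=> hi hj Ci Cj enx eb; rewrite !eN // enx eb.
    by rewrite ltn_add2l; nia.
  case: (boolP (C v)) => [Cv|Cv].
    apply: dle_mono => //; [exact/ei/ltnW|exact: ei|] => i hi.
    case: (boolP (C i)) => Ci; first by rewrite !eC.
    apply/ltnW/hlow => //; rewrite ltnS [RHS]leq_eqVlt.
    by case: (eqVneq i v) Ci => // ->; rewrite Cv.
  apply: (move_down v) => //; [exact: ei|exact/ei/ltnW| | |].
  - by move=> c cn Cc; rewrite !eC.
  - rewrite !eN // ltnn ltnSn; have := nx_gt v vn Cv; have := off v v (ltnW vn) vn.
    have := off v.+1 v vn vn; nia.
  - move=> i j hi hj Ci Cj niv njv hsep; apply: hlow => //.
      wlog ij : i j hi hj Ci Cj niv njv hsep / i <= j => [hw|].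
        case: (leqP i j) => ij; first exact: hw.
        apply/esym/hw => //; last exact: ltnW.
        by move=> c cn Cc; rewrite andbC; apply: hsep.
      apply/eqP; rewrite eqn_leq nx_mono //=.
      have [h1 h2 _] := nxP i; have [_ _ h] := nxP j; apply: h => //.
      rewrite leqNgt; apply/negP => h3.
      have hn : nx i < n by lia.
      case: h2 => [Cn|]; last by lia.
      have := nx_gt i hi Ci => h4.
      by have := hsep (nx i) hn; rewrite Cn => /(_ isT); lia.
    by have := hsep v vn; rewrite eqxx orbT => /(_ isT); lia.
have chain v : v <= n -> dle D n s (e 0) n s (e v).
  elim: v => [|v ih] vn; first by apply: dle_refl => //; exact: ei.
  have h := ih (ltnW vn).
  apply: (dle_trans hs hs hs (ei 0 _) (ei v _) (ei v.+1 _) h (step v vn)) => //; exact: ltnW.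
have final i : i < n -> ~~ C i -> e n i < e 0 i.
  move=> hi Ci; rewrite !eN // hi /=; have := nx_gt i hi Ci; have := off n i (leqnn _) hi; nia.
(* Off [C], the values of [e 0] exceed those of [e n], so monotonicity reverses [chain], and
   antisymmetry gives a contradiction. *)
have hle : dle D n s (e n) n s (e 0).
  apply: dle_mono => //; [exact: ei|exact: ei|] => i hi.
  by case: (boolP (C i)) => Ci; [rewrite !eC|exact/ltnW/final].
have [_ _ /(_ i0 i0n) heq] := dle_anti hs hs (ei 0 (leq0n _)) (ei n (leqnn _)) (chain n (leqnn _)) hle.
by have := final i0 i0n Ci0; rewrite heq ltnn.
Qed.

End Priority.

(** * Priority enumerations and domination between terms *)

Section Dominance.

Variable D : predilator.

(** Two evaluations of the same term are compared lexicographically along the enumeration [u] of its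
    variables. *)
Definition priority (t : nat * nat) (u : nat -> nat) : Prop :=
  [/\ forall l, l < t.1 -> u l < t.1,
      forall l l', l < t.1 -> l' < t.1 -> u l = u l' -> l = l'
    & forall l, l < t.1 -> forall f g, incr t.1 f -> incr t.1 g ->
        (forall l', l' < l -> f (u l') = g (u l')) -> f (u l) < g (u l) ->
        ~ dle D t.1 t.2 g t.1 t.2 f].

Definition fullt (t : nat * nat) : Prop := full D t.1 t.2.

(** [priority_exists] is iterated, with the variables already chosen as [C]. *)
Lemma priority_ex t : fullt t -> exists u, priority t u.
Proof.
case: t => n s ht; have: forall k, k <= n -> exists u : seq nat,
    [/\ size u = k, uniq u, forall i, i \in u -> i < n
      & forall l, l < k -> forall f g, incr n f -> incr n g ->
        (forall l', l' < l -> f (nth 0 u l') = g (nth 0 u l')) ->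
        f (nth 0 u l) < g (nth 0 u l) -> ~ dle D n s g n s f].
  elim=> [|k ih] hk; first by exists [::].
  have [u [su uu un hu]] := ih (ltnW hk).
  have [|v [vn vu hv]] := @priority_exists D n s ht (fun i => i \in u).
    apply: contrapT => hno; have : size (iota 0 n) <= size u.
      apply: uniq_leq_size; first exact: iota_uniq.
      move=> i; rewrite mem_iota add0n => hi; apply: contrapT => /negP iu.
      by apply: hno; exists i.
    by rewrite size_iota su leqNgt hk.
  exists (rcons u v); split; [by rewrite size_rcons su|by rewrite rcons_uniq vu| |].
    by move=> i; rewrite mem_rcons inE => /orP[/eqP->|/un].
  move=> l; rewrite ltnS leq_eqVlt => /orP[/eqP->|lk] f g hf hg.
    move=> hag; rewrite nth_rcons su ltnn eqxx; apply: hv => // c cn /(nthP 0)[l' hl' <-].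
    by have := hag l'; rewrite -su hl' nth_rcons hl' => ->.
  move=> hag; rewrite nth_rcons su lk => hl; apply: hu hl => // l' hl'.
  by have := hag l' hl'; rewrite nth_rcons su (ltn_trans hl' lk).
move=> /(_ n (leqnn n))[u [su uu un hu]]; exists (nth 0 u); split=> //=.
- by move=> l hl; apply/un/mem_nth; rewrite su.
- by move=> l l' hl hl' /eqP; rewrite nth_uniq ?su // => /eqP.
Qed.

(* [pr t l] is the variable of [t] whose priority is the [l]-th highest. *)
Definition pr (t : nat * nat) : nat -> nat :=
  if pselect (exists u, priority t u) is left h then projT1 (cid h) else id.

Lemma prP t : fullt t -> priority t (pr t).
Proof.
move=> ht; rewrite /pr; case: pselect => [h|[]]; last exact: priority_ex.
by case: cid.
Qed.

Lemma pr_lt t l : fullt t -> l < t.1 -> pr t l < t.1.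
Proof. by move=> /prP[h _ _]; apply: h. Qed.

Lemma pr_inj t l l' : fullt t -> l < t.1 -> l' < t.1 -> pr t l = pr t l' -> l = l'.
Proof. by move=> /prP[_ h _]; apply: h. Qed.

Lemma pr_surj t i : fullt t -> i < t.1 -> exists2 l, l < t.1 & pr t l = i.
Proof.
move=> ht hi; have hs : {subset mkseq (pr t) t.1 <= iota 0 t.1}.
  by move=> x /mapP[l]; rewrite !mem_iota /= add0n => hl ->; apply: pr_lt.
have hu : uniq (mkseq (pr t) t.1).
  rewrite map_inj_in_uniq ?iota_uniq // => l l'; rewrite !mem_iota /= add0n.
  exact: pr_inj.
have [|_ h] := uniq_min_size hu hs; first by rewrite size_mkseq size_iota.
have : i \in iota 0 t.1 by rewrite mem_iota.
by rewrite -h => /mapP[l]; rewrite mem_iota add0n => hl ->; exists l.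
Qed.

Definition tle (t : nat * nat) (f : nat -> nat) (t' : nat * nat) (g : nat -> nat) : Prop :=
  dle D t.1 t.2 f t'.1 t'.2 g.

Definition agree (k : nat) (t : nat * nat) (f : nat -> nat) (t' : nat * nat)
    (g : nat -> nat) : Prop :=
  forall l, l < k -> f (pr t l) = g (pr t' l).

(** A descent caused by the terms alone, which no choice of the remaining variables can undo. A
    branch needs terms without domination, for then the values of the variables decide, by
    [dominates_squeeze]. *)
Definition dominates (k : nat) (t t' : nat * nat) : Prop :=
  forall f g, incr t.1 f -> incr t'.1 g -> agree k t f t' g -> ~ tle t f t' g.

(* Any other configuration [(h', h)] can be squeezed, keeping the first [k]
   variables, so that the images of the [k]-th variables under [h'] and [h]
   both lie between their images under [g] and [f]. *)
Lemma dominates_squeeze k t f t' g : fullt t -> fullt t' -> k < t.1 -> k < t'.1 ->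
  incr t.1 f -> incr t'.1 g -> agree k t f t' g ->
  g (pr t' k) < f (pr t k) -> tle t f t' g -> dominates k t' t.
Proof.
move=> ht ht' kt kt' hf hg hag hv hle h h' hh hh' hag' hle'.
set v := pr t k in hv; set v' := pr t' k in hv.
have vt : v < t.1 by apply: pr_lt.
have vt' : v' < t'.1 by apply: pr_lt.
have lt l : l < k -> pr t l < t.1 by move=> ?; apply: pr_lt => //; lia.
have lt' l : l < k -> pr t' l < t'.1 by move=> ?; apply: pr_lt => //; lia.
pose mx := maxn (h' v) (h v'); pose mn := minn (h' v) (h v').
(* The factor 4 leaves room for the two extra points, just above [mx] and just below [mn], between
   the scaled values of [h'] and [h]. *)
pose p (x : 'I_k + bool) := match x with
  | inl l => f (pr t l) | inr true => f v | inr false => g v' end.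
pose p' (x : 'I_k + bool) := match x with
  | inl l => 4 * h' (pr t l) + 2 | inr true => 4 * mx + 3 | inr false => 4 * mn + 1 end.
have [A hA] := bounded_below t.1 f; have [B hB] := bounded_below t'.1 g.
have below l : l < k -> f (pr t l) < f v -> h' (pr t l) < h' v.
  by move=> lk; have := lt l lk => ltl; rewrite (incr_inv hf) // (incr_inv hh').
have above l : l < k -> f v < f (pr t l) -> h' v < h' (pr t l).
  by move=> lk; have := lt l lk => ltl; rewrite (incr_inv hf) // (incr_inv hh').
have below' l : l < k -> f (pr t l) < g v' -> h' (pr t l) < h v'.
  by move=> lk; rewrite hag // -hag' // (incr_inv hg) ?(incr_inv hh) //; apply: lt'.
have above' l : l < k -> g v' < f (pr t l) -> h v' < h' (pr t l).
  by move=> lk; rewrite hag // -hag' // (incr_inv hg) ?(incr_inv hh) //; apply: lt'.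
have [||K [phi [K0 hphi phiE _]]] := @extend_incr ('I_k + bool)%type p p' (maxn A B).
- move=> [l|[]] [l'|[]] /=; rewrite ?ltnn //; try by rewrite /mx /mn; lia.
  + rewrite (incr_inv hf) //; try exact: lt.
    move=> e.
    by have := hh' _ _ e (lt l' (ltn_ord l')); lia.
  + by move/(below l (ltn_ord l)); rewrite /mx; lia.
  + move=> e; have e1 := below' l (ltn_ord l) e.
    by have := below l (ltn_ord l) (ltn_trans e hv); rewrite /mn; lia.
  + move=> e; have e1 := above l' (ltn_ord l') e.
    by have := above' l' (ltn_ord l') (ltn_trans hv e); rewrite /mx; lia.
  + by move/(above' l' (ltn_ord l')); rewrite /mn; lia.
- have ne1 (l : 'I_k) : f (pr t l) <> f v.
    move/(incr_inj hf (lt l (ltn_ord l)) vt)/(pr_inj ht) => e.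
    by have := ltn_ord l; rewrite e ?ltnn //; have := ltn_ord l; lia.
  have ne2 (l : 'I_k) : f (pr t l) <> g v'.
    rewrite hag // => /(incr_inj hg (lt' l (ltn_ord l)) vt')/(pr_inj ht') => e.
    by have := ltn_ord l; rewrite e ?ltnn //; have := ltn_ord l; lia.
  move=> [l|[]] [l'|[]] //=.
  + by move/(incr_inj hf (lt l (ltn_ord l)) (lt l' (ltn_ord l'))) => ->.
  + by move/ne1.
  + by move/ne2.
  + by move/esym/ne1.
  + by move=> e; rewrite e ltnn in hv.
  + by move/esym/ne2.
  + by move=> e; rewrite e ltnn in hv.
have hfN i : i < t.1 -> f i < maxn A B by move=> /hA; lia.
have hgN i : i < t'.1 -> g i < maxn A B by move=> /hB; lia.
pose sc x := K * (4 * x + 2).+1.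
have hsc N : incr N sc by move=> x y xy _; rewrite /sc ltn_pmul2l //; lia.
have hf1 : incr t.1 (fun i => phi (f i)) by apply: incr_comp hphi.
have hg1 : incr t'.1 (fun i => phi (g i)) by apply: incr_comp hphi.
have hS' : incr t.1 (fun i => sc (h' i)) by move=> i j ij jt; apply: (hsc (h' j).+1) => //; apply: hh'.
have hS : incr t'.1 (fun i => sc (h i)) by move=> i j ij jt; apply: (hsc (h j).+1) => //; apply: hh.
(* The contradiction is the chain [h <= h' <= phi f <= phi g] of evaluated terms, closed by
   [phi g < h]. The second and the last comparison are decided by the [k]-th variables of [t] and
   [t']. *)
have [_ _ /(_ k kt _ _ hS' hf1) pt] := prP ht.
have [_ _ /(_ k kt' _ _ hg1 hS) pt'] := prP ht'.
apply: pt'.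
- by move=> l lk; rewrite -hag // (phiE (inl (Ordinal lk))) /= /sc hag'.
- by rewrite (phiE (inr false)) /= /sc ltn_pmul2l // /mn -/v'; lia.
have [A1 hA1] := bounded_below t.1 h'; have [B1 hB1] := bounded_below t'.1 h.
have l1 : dle D t'.1 t'.2 (fun i => sc (h i)) t.1 t.2 (fun i => sc (h' i)).
  apply: ((dle_comp (N := maxn A1 B1) ht' ht hh hh' _ _ (hsc _)).1 hle').
    by move=> i /hB1; lia.
  by move=> i /hA1; lia.
have l2 : dle D t.1 t.2 (fun i => sc (h' i)) t.1 t.2 (fun i => phi (f i)).
  case: (dle_total ht ht hS' hf1) => // /pt [].
    by move=> l lk; rewrite (phiE (inl (Ordinal lk))).
  by rewrite (phiE (inr true)) /= /sc ltn_pmul2l // /mx -/v; lia.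
have l3 : dle D t.1 t.2 (fun i => phi (f i)) t'.1 t'.2 (fun i => phi (g i)).
  exact: ((dle_comp ht ht' hf hg hfN hgN hphi).1 hle).
exact: (dle_trans ht' ht ht' hS hf1 hg1 (dle_trans ht' ht ht hS hS' hf1 l1 l2) l3).
Qed.

(** A single configuration with [b] above [c] suffices: an increasing map moves [fc] onto a scaled
    copy of the given [g], keeping [b] above [c], and [a] lies above this [b] by domination. *)
Lemma dominates_trans k a b c fb fc : fullt a -> fullt b -> fullt c -> k <= c.1 ->
  incr b.1 fb -> incr c.1 fc -> agree k b fb c fc -> ~ tle b fb c fc ->
  dominates k a b -> dominates k a c.
Proof.
move=> ha hb hc kc hfb hfc hag hgt hdom f g hf hg hag' hle; apply: hgt.
have [A hA] := bounded_below b.1 fb; have [B hB] := bounded_below c.1 fc.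
have [||K [phi [K0 hphi phiE _]]] :=
  @extend_incr 'I_c.1 (fun i => fc i) (fun i => g i) (maxn A B).
- by move=> i j; rewrite (incr_inv hfc) ?(incr_inv hg).
- by move=> i j /(incr_inj hfc) -> //.
have hbN i : i < b.1 -> fb i < maxn A B by move=> /hA; lia.
have hcN i : i < c.1 -> fc i < maxn A B by move=> /hB; lia.
have hb1 : incr b.1 (fun i => phi (fb i)) by apply: incr_comp hphi.
have sci n q : incr n q -> incr n (fun i => K * (q i).+1).
  by move=> hq i j ij jn; rewrite ltn_pmul2l // ltnS hq.
apply/(dle_comp hb hc hfb hfc hbN hcN hphi).
apply: (@dle_eq D _ _ (fun i => phi (fb i)) _ _ _ (fun j => K * (g j).+1)) => // [i hi|].
  by rewrite -(phiE (Ordinal hi)).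
apply: (dle_trans hb ha hc hb1 (sci _ _ hf) (sci _ _ hg)).
  case: (dle_total hb ha hb1 (sci _ _ hf)) => // /hdom [] //; first exact: sci.
  move=> l lk; rewrite hag' // hag //.
  have lc : pr c l < c.1 by apply: pr_lt => //; lia.
  by rewrite -(phiE (Ordinal lc)).
exact/(dle_scale K0 ha hc hf hg).
Qed.

(** All variables of [a] are shared, so agreement already fixes the relative positions of all
    variables, and one configuration decides every other. *)
Lemma dominates_all k a b fa fb : fullt a -> fullt b -> a.1 = k -> k <= b.1 ->
  incr a.1 fa -> incr b.1 fb -> agree k a fa b fb -> ~ tle a fa b fb ->
  dominates k a b.
Proof.
move=> ha hb ak kb hfa hfb hag hgt f g hf hg hag' hle; apply: hgt.
have pat i j : i < a.1 -> j < b.1 ->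
    exists l, [/\ l < k, fa i = fb (pr b l), f i = g (pr b l) & pr b l < b.1].
  move=> hi _; have [l hl <-] := pr_surj ha hi; rewrite ak in hl.
  by exists l; split=> //; [apply: hag|apply: hag'|apply: pr_lt => //; lia].
apply: (dle_pattern ha hb hfa hfb hf hg _).2 hle => i j hi hj.
have [l [lk -> -> lb]] := pat i j hi hj.
by rewrite !(incr_inv hfb) ?(incr_inv hg).
Qed.

End Dominance.

(** * Elements of D(X) as increasing assignments of the variables of a term *)

Section Assignments.

Variable X : linord.

Lemma lo_lt_trans x y z : lo_lt X x y -> lo_lt X y z -> lo_lt X x z.
Proof.
move=> [xy nxy] [yz nyz]; split; first exact: lo_trans yz.
by move=> e; subst z; apply: nxy; apply: lo_anti yz.
Qed.

Lemma lo_lt_irr x : ~ lo_lt X x x.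
Proof. by case. Qed.

Lemma lo_ltN x y : lo_lt X x y -> ~ X y x.
Proof. by move=> [xy nxy] yx; apply: nxy; apply: lo_anti yx. Qed.

Lemma lo_trichotomy x y : lo_set X x -> lo_set X y ->
  [\/ lo_lt X x y, x = y | lo_lt X y x].
Proof.
move=> hx hy; case: (pselect (x = y)) => [|ne]; first by constructor 2.
case: (lo_total hx hy) => h; [constructor 1|constructor 3]; split=> //.
exact: nesym.
Qed.

Lemma lo_lt_set x y : lo_lt X x y -> lo_set X x /\ lo_set X y.
Proof. by move=> [/lo_field]. Qed.

Definition into (n : nat) (f : nat -> nat) : Prop :=
  (forall i, i < n -> lo_set X (f i)) /\
  forall i j, i < j -> j < n -> lo_lt X (f i) (f j).

Lemma into_lt n f i j : into n f -> i < n -> j < n -> lo_lt X (f i) (f j) <-> i < j.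
Proof.
move=> [hs hl] hi hj; split=> [h|ij]; last exact: hl.
case: (ltngtP i j) => // [ji|e]; first by case: (lo_lt_irr (lo_lt_trans h (hl _ _ ji hi))).
by subst; case: (lo_lt_irr h).
Qed.

Lemma into_inj n f i j : into n f -> i < n -> j < n -> f i = f j -> i = j.
Proof.
move=> hf hi hj e; case: (ltngtP i j) => // h.
  by have := hf.2 _ _ h hj; rewrite e => /lo_lt_irr.
by have := hf.2 _ _ h hi; rewrite e => /lo_lt_irr.
Qed.

Definition lob (x y : nat) : bool := `[< X x y >].

Definition enum_fun (a : {fset nat}) (i : nat) : nat := nth 0 (sort lob a) i.

Lemma lob_trans : transitive lob.
Proof. by move=> y x z /asboolP xy /asboolP yz; apply/asboolP; apply: lo_trans yz. Qed.

Lemma into_enum_fun (a : {fset nat}) :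
  (forall x, x \in a -> lo_set X x) -> into #|` a| (enum_fun a).
Proof.
move=> aX; have sz : size (sort lob a) = #|` a| by rewrite size_sort.
have mem i : i < #|` a| -> enum_fun a i \in a.
  by move=> hi; rewrite -(mem_sort lob) mem_nth // sz.
split=> [i /mem /aX //|i j ij hj].
have hs : sorted lob (sort lob a).
  apply: (@sort_sorted_in _ [in a]); last by apply/allP.
  move=> x y /aX xX /aX yX.
  by case: (lo_total xX yX) => h; apply/orP; [left|right]; apply/asboolP.
split.
  by apply/asboolP; apply: (sorted_ltn_nth lob_trans 0 hs); rewrite ?inE ?sz // (ltn_trans ij).
move=> /eqP; rewrite /enum_fun nth_uniq ?sz ?sort_uniq ?fset_uniq //; last exact: ltn_trans hj.
by lia.
Qed.

Definition img (n : nat) (f : nat -> nat) : {fset nat} := seq_fset tt (mkseq f n).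

Lemma mem_img n f x : (x \in img n f) = (x \in mkseq f n).
Proof. by rewrite seq_fsetE. Qed.

Lemma mem_enum_fun (a : {fset nat}) i : i < #|` a| -> enum_fun a i \in a.
Proof. by move=> hi; rewrite -(mem_sort lob) mem_nth // size_sort. Qed.

Lemma into_img n f : into n f ->
  #|` img n f| = n /\ forall i, i < n -> enum_fun (img n f) i = f i.
Proof.
move=> hf; have hs : sort lob (img n f) = mkseq f n.
  apply: (@sorted_eq_in _ lob).
  - by move=> x y z _ _ _; apply: lob_trans.
  - move=> x y _ _ /andP[/asboolP h1 /asboolP h2]; exact: lo_anti h2.
  - apply: (@sort_sorted_in _ [in img n f]); last by apply/allP.
    move=> x y; rewrite !mem_img => /mapP[i]; rewrite mem_iota add0n => hi -> /mapP[j].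
    rewrite mem_iota add0n => hj ->; have := lo_total (hf.1 i hi) (hf.1 j hj).
    by case=> h; apply/orP; [left|right]; apply/asboolP.
  - apply/(sortedP 0) => i; rewrite size_mkseq => hi.
    by rewrite !nth_mkseq ?(ltnW hi) //; apply/asboolP; apply: (hf.2 _ _ _ hi).1.
  - rewrite perm_sort; apply: uniq_perm; first exact: fset_uniq.
      rewrite map_inj_in_uniq ?iota_uniq // => i j; rewrite !mem_iota /= add0n => hi hj.
      exact: into_inj hf hi hj.
    by move=> x; rewrite mem_img.
split; first by rewrite -(size_sort lob) hs size_mkseq.
by move=> i hi; rewrite /enum_fun hs nth_mkseq.
Qed.

Variable D : predilator.

Definition same_order n (f f' : nat -> nat) m (g g' : nat -> nat) : Prop :=
  forall i j, i < n -> j < m ->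
    (f' i < g' j <-> lo_lt X (f i) (g j)) /\ (g' j < f' i <-> lo_lt X (g j) (f i)).

Lemma same_order_pattern n (f f1 f2 : nat -> nat) m (g g1 g2 : nat -> nat) :
  same_order n f f1 m g g1 -> same_order n f f2 m g g2 -> same_pattern n f1 f2 m g1 g2.
Proof.
move=> h1 h2 i j hi hj; have [a b] := h1 i j hi hj; have [c d] := h2 i j hi hj.
by split; apply/idP/idP; rewrite ?a ?b ?c ?d // -?a -?b -?c -?d.
Qed.

(** The inclusions of [a] and [b] into their union serve as [f] and [g]. *)
Lemma enum_fun_same_order (a b : {fset nat}) :
  (forall x, x \in a -> lo_set X x) -> (forall x, x \in b -> lo_set X x) ->
  exists f g, [/\ incr #|` a| f, incr #|` b| g,
    same_order #|` a| (enum_fun a) f #|` b| (enum_fun b) g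
    & forall s t, full D #|` a| s -> full D #|` b| t ->
        dbar_le D X (s, a) (t, b) <-> dle D #|` a| s f #|` b| t g].
Proof.
move=> aX bX; pose c := (a `|` b)%fset.
have cX x : x \in c -> lo_set X x by rewrite inE => /orP[/aX|/bX].
have [|ha [haP haU]] := @card_incl_exists_unique X a c _ cX.
  by move=> x; rewrite inE => ->.
have [|hb [hbP hbU]] := @card_incl_exists_unique X b c _ cX.
  by move=> x; rewrite inE orbC => ->.
have ic := into_enum_fun cX; have ia := into_enum_fun aX; have ib := into_enum_fun bX.
pose f i := if insub i is Some i' then (ha i' : nat) else 0.
pose g i := if insub i is Some i' then (hb i' : nat) else 0.
have fE (i : 'I_#|` a|) : ha i = f i :> nat by rewrite /f valK.
have gE (i : 'I_#|` b|) : hb i = g i :> nat by rewrite /g valK.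
have fP i : i < #|` a| -> f i < #|` c| /\ enum_fun c (f i) = enum_fun a i.
  by move=> hi; rewrite -(fE (Ordinal hi)); split=> //; exact: haP.
have gP i : i < #|` b| -> g i < #|` c| /\ enum_fun c (g i) = enum_fun b i.
  by move=> hi; rewrite -(gE (Ordinal hi)); split=> //; exact: hbP.
exists f, g; split.
- move=> i j ij hj; have [h1 h2] := fP i (ltn_trans ij hj); have [h3 h4] := fP j hj.
  by apply/(into_lt ic h1 h3); rewrite h2 h4; apply: ia.2.
- move=> i j ij hj; have [h1 h2] := gP i (ltn_trans ij hj); have [h3 h4] := gP j hj.
  by apply/(into_lt ic h1 h3); rewrite h2 h4; apply: ib.2.
- move=> i j hi hj; have [h1 h2] := fP i hi; have [h3 h4] := gP j hj.
  by rewrite -(into_lt ic h1 h3) -(into_lt ic h3 h1) h2 h4.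
move=> s t hs ht; rewrite (dleE (p := ha) (q := hb)) //; split.
  by move=> [ha' [hb' [/haU <- /hbU <-]]].
by exists ha, hb.
Qed.

(** Comparison in D(X) can be read off from any natural numbers in the same relative order, so that
    the results about [dle] apply. *)
Lemma dbar_leE n s f m t g f' g' : full D n s -> full D m t -> into n f -> into m g ->
  incr n f' -> incr m g' -> same_order n f f' m g g' ->
  dbar_le D X (s, img n f) (t, img m g) <-> dle D n s f' m t g'.
Proof.
move=> hs ht hf hg hf' hg' hso.
have [en ef] := into_img hf; have [em eg] := into_img hg.
have [x||f0 [g0 []]] := @enum_fun_same_order (img n f) (img m g).
- by rewrite mem_img => /mapP[i]; rewrite mem_iota add0n => hi ->; apply: hf.1.
- by move=> x; rewrite mem_img => /mapP[i]; rewrite mem_iota add0n => hi ->; apply: hg.1.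
rewrite en em => hf0 hg0 hso0 -> //.
apply: dle_pattern => //; apply: same_order_pattern hso.
by move=> i j hi hj; have := hso0 i j hi hj; rewrite ef ?eg.
Qed.

Lemma dbar_img n s f : full D n s -> into n f -> dbar_set D X (s, img n f).
Proof.
move=> [hs1 hs2] hf; have [en _] := into_img hf; split=> /=; rewrite ?en //.
by move=> x; rewrite mem_img => /mapP[i]; rewrite mem_iota add0n => hi ->; apply: hf.1.
Qed.

Lemma img_enum_fun (a : {fset nat}) : img #|` a| (enum_fun a) = a.
Proof.
apply/fsetP => x; rewrite mem_img -[RHS](mem_sort lob).
by rewrite -[in RHS](mkseq_nth 0 (sort lob a)) size_sort.
Qed.

End Assignments.

(** * Linear orders from strict relations; the order omega^2 *)

Section OrderOf.

Variables (dom : nat -> Prop) (R : nat -> nat -> Prop).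
Hypothesis R_irr : forall x, ~ R x x.
Hypothesis R_trans : forall x y z, dom x -> dom y -> dom z -> R x y -> R y z -> R x z.
Hypothesis R_total : forall x y, dom x -> dom y -> [\/ x = y, R x y | R y x].

Definition strict_le (x y : nat) : Prop := [/\ dom x, dom y & x = y \/ R x y].

Lemma strict_le_field x y : strict_le x y -> strict_le x x /\ strict_le y y.
Proof. by move=> [hx hy _]; split; split=> //; left. Qed.

Lemma strict_le_anti x y : strict_le x y -> strict_le y x -> x = y.
Proof.
move=> [hx hy [//|xy]] [_ _ [//|yx]].
by case: (R_irr (R_trans hx hy hx xy yx)).
Qed.

Lemma strict_le_trans x y z : strict_le x y -> strict_le y z -> strict_le x z.
Proof.
move=> [hx hy [<-//|xy]] [_ hz [<-|yz]]; split=> //; right=> //.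
exact: R_trans yz.
Qed.

Lemma strict_le_total x y : strict_le x x -> strict_le y y -> strict_le x y \/ strict_le y x.
Proof.
move=> [hx _ _] [hy _ _]; case: (R_total hx hy) => [->|h|h].
- by left; split=> //; left.
- by left; split=> //; right.
- by right; split=> //; right.
Qed.

Definition order_of : linord :=
  LinOrd strict_le_field strict_le_anti strict_le_trans strict_le_total.

Lemma order_of_set x : lo_set order_of x <-> dom x.
Proof. by split=> [[]//|hx]; split=> //; left. Qed.

Lemma order_of_lt x y : lo_lt order_of x y <-> [/\ dom x, dom y & R x y].
Proof.
split=> [[[hx hy [//|h]]]|[hx hy h]] //; split; first by split=> //; right.
by move=> e; subst; case: (R_irr h).
Qed.

End OrderOf.

Lemma nat_eventually_constant (u : nat -> nat) :
  (forall i, u i.+1 <= u i) -> exists N, forall i, N <= i -> u i = u N.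
Proof.
move=> hu; have hle i j : i <= j -> u j <= u i.
  by move=> /subnK <-; elim: (j - i) => // k ih; exact: leq_trans (hu _) ih.
have [|[N hN] hmin] := @leastP (fun v => exists i, u i = v); first by exists (u 0), 0.
exists N => i Ni; apply/eqP; rewrite eqn_leq hle //= hN hmin //.
by exists i.
Qed.

Definition lex_key (x : nat) : nat * nat := odflt (0, 0) (choice.unpickle x).

(** Membership demands a canonical code; thus elements with the same key are equal. *)
Definition lex_dom (x : nat) : Prop := choice.pickle (lex_key x) = x.

Definition lex_lt (x y : nat) : Prop :=
  (lex_key x).1 < (lex_key y).1 \/
  (lex_key x).1 = (lex_key y).1 /\ (lex_key x).2 < (lex_key y).2.

Lemma lex_irr x : ~ lex_lt x x.
Proof. by rewrite /lex_lt !ltnn => -[|[]]. Qed.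

Lemma lex_trans x y z : lex_dom x -> lex_dom y -> lex_dom z ->
  lex_lt x y -> lex_lt y z -> lex_lt x z.
Proof. by rewrite /lex_lt; lia. Qed.

Lemma lex_total x y : lex_dom x -> lex_dom y -> [\/ x = y, lex_lt x y | lex_lt y x].
Proof.
rewrite /lex_dom /lex_lt => hx hy.
case: (ltngtP (lex_key x).1 (lex_key y).1) => h1; [by constructor 2; left|by constructor 3; left|].
case: (ltngtP (lex_key x).2 (lex_key y).2) => h2; [by constructor 2; right|by constructor 3; right|].
by constructor 1; rewrite -hx -hy (surjective_pairing (lex_key x)) h1 h2 -surjective_pairing.
Qed.

Definition omega2 : linord := order_of lex_irr lex_trans lex_total.

Lemma lex_keyK p : lex_key (choice.pickle p) = p.
Proof. by rewrite /lex_key choice.pickleK. Qed.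

Lemma omega2_set p : lo_set omega2 (choice.pickle (p : nat * nat)).
Proof. by apply/order_of_set; rewrite /lex_dom lex_keyK. Qed.

Lemma omega2_wf M : well_order_in M omega2.
Proof.
move=> [F [_ hlt _]]; pose q i := lex_key (F i).
have hq i : (q i.+1).1 < (q i).1 \/ (q i.+1).1 = (q i).1 /\ (q i.+1).2 < (q i).2.
  by have /order_of_lt[_ _] := hlt i.
have [|N hN] := @nat_eventually_constant (fun i => (q i).1).
  by move=> i; case: (hq i); lia.
have hq2 i : (q (N + i.+1)).2 < (q (N + i)).2.
  have h1 := hN (N + i.+1) (leq_addr _ _); have h2 := hN (N + i) (leq_addr _ _).
  by case: (hq (N + i)); rewrite -addnS; lia.
have [|K hK] := @nat_eventually_constant (fun i => (q (N + i)).2).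
  by move=> i; apply: ltnW.
by have := hK K.+1 (leqnSn _); have := hq2 K; lia.
Qed.

(** * D(X) as a linear order, via ranks of finite parts of X *)

Section Ranks.

Variable X : linord.

(** Ranks of a finite part of [X] turn assignments into [X] into numerical ones; several elements of
    D(X) can then be compared inside one finite part. *)
Lemma rank_exists (c : {fset nat}) : (forall x, x \in c -> lo_set X x) ->
  exists r : nat -> nat, forall x y, x \in c -> y \in c -> (r x < r y) <-> lo_lt X x y.
Proof.
move=> cX; have ic := into_enum_fun cX; exists (fun x => index x (sort (lob X) c)).
have hx x : x \in c -> index x (sort (lob X) c) < #|` c| /\
    enum_fun X c (index x (sort (lob X) c)) = x.
  move=> xc; rewrite -(size_sort (lob X)) index_mem mem_sort; split=> //.
  by rewrite /enum_fun nth_index ?mem_sort.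
move=> x y /hx[h1 h2] /hx[h3 h4].
by rewrite -(into_lt ic h1 h3) h2 h4.
Qed.

Variable D : predilator.

Definition tm (p : nat * {fset nat}) : nat * nat := (#|` p.2|, p.1).

Definition tmf (p : nat * {fset nat}) : nat -> nat := enum_fun X p.2.

Lemma mem_tmf p i : i < (tm p).1 -> tmf p i \in p.2.
Proof. exact: mem_enum_fun. Qed.

Definition rank_on (r : nat -> nat) (c : {fset nat}) : Prop :=
  forall x y, x \in c -> y \in c -> (r x < r y) <-> lo_lt X x y.

Lemma dbar_full p : dbar_set D X p -> fullt D (tm p).
Proof. by case=> _ h1 h2; split. Qed.

Lemma dbar_into p : dbar_set D X p -> into X (tm p).1 (tmf p).
Proof. by case=> h _ _; apply: into_enum_fun. Qed.

Lemma rank_incr r c p : dbar_set D X p -> rank_on r c -> {subset p.2 <= c} ->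
  incr (tm p).1 (fun i => r (tmf p i)).
Proof.
move=> hp hr sub i j ij hj; apply/hr; first by apply/sub/mem_tmf/(ltn_trans ij).
  by apply/sub/mem_tmf.
by apply: (dbar_into hp).2.
Qed.

Lemma dbar_le_rank p q r c : dbar_set D X p -> dbar_set D X q -> rank_on r c ->
  {subset p.2 <= c} -> {subset q.2 <= c} ->
  dbar_le D X p q <->
  tle D (tm p) (fun i => r (tmf p i)) (tm q) (fun i => r (tmf q i)).
Proof.
case: p q => [s a] [t b] hp hq hr sp sq.
have := @dbar_leE X D (tm (s, a)).1 s (tmf (s, a)) (tm (t, b)).1 t (tmf (t, b))
  (fun i => r (tmf (s, a) i)) (fun i => r (tmf (t, b) i)).
rewrite /tmf /= !img_enum_fun; apply.
- exact: dbar_full hp.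
- exact: dbar_full hq.
- exact: dbar_into hp.
- exact: dbar_into hq.
- exact: rank_incr hp hr sp.
- exact: rank_incr hq hr sq.
- move=> i j hi hj; have hi' := sp _ (mem_enum_fun X hi : _ \in (s, a).2).
  by have hj' := sq _ (mem_enum_fun X hj : _ \in (t, b).2); rewrite !hr.
Qed.

Lemma rank3 p q u : dbar_set D X p -> dbar_set D X q -> dbar_set D X u ->
  exists r c, [/\ rank_on r c, {subset p.2 <= c}, {subset q.2 <= c} & {subset u.2 <= c}].
Proof.
move=> [hp _ _] [hq _ _] [hu _ _]; pose c := (p.2 `|` (q.2 `|` u.2))%fset.
have [|r hr] := @rank_exists c.
  by move=> x; rewrite !inE => /orP[/hp|/orP[/hq|/hu]].
by exists r, c; split=> // x hx; rewrite !inE hx ?orbT.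
Qed.

Lemma dbar_le_trans p q u : dbar_set D X p -> dbar_set D X q -> dbar_set D X u ->
  dbar_le D X p q -> dbar_le D X q u -> dbar_le D X p u.
Proof.
move=> hp hq hu; have [r [c [hr sp sq su]]] := rank3 hp hq hu.
rewrite !(dbar_le_rank _ _ hr) //; apply: dle_trans; try exact: dbar_full;
  exact: rank_incr hr _.
Qed.

Lemma dbar_le_anti p q : dbar_set D X p -> dbar_set D X q ->
  dbar_le D X p q -> dbar_le D X q p -> p = q.
Proof.
move=> hp hq; have [r [c [hr sp sq _]]] := rank3 hp hq hq.
have ip := rank_incr hp hr sp; have iq := rank_incr hq hr sq.
rewrite (dbar_le_rank hp hq hr) // (dbar_le_rank hq hp hr) // => h1 h2.
have [en es ef] := dle_anti (dbar_full hp) (dbar_full hq) ip iq h1 h2.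
case: p q hp hq sp sq en es ef {ip iq h1 h2} => [s a] [t b] hp hq /= sp sq en -> ef.
congr pair; rewrite -(img_enum_fun X a) -(img_enum_fun X b) -en.
congr seq_fset; apply/eq_in_map => i; rewrite mem_iota add0n => /= hi.
have ia := mem_enum_fun X hi; have ib : enum_fun X b i \in b.
  by apply: mem_enum_fun; rewrite -en.
case: (hp) (hq) => [aX _ _] [bX _ _].
have hne := ltnn (r (enum_fun X a i)).
case: (lo_trichotomy (aX _ ia) (bX _ ib)) => // /hr.
  by move=> /(_ (sp _ ia) (sq _ ib)); have := ef i hi; rewrite /tmf /= => ->; rewrite ltnn.
by move=> /(_ (sq _ ib) (sp _ ia)); have := ef i hi; rewrite /tmf /= => ->; rewrite ltnn.
Qed.

Lemma dbar_lt_trans p q u : dbar_set D X p -> dbar_set D X q -> dbar_set D X u ->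
  dbar_lt D X p q -> dbar_lt D X q u -> dbar_lt D X p u.
Proof.
move=> hp hq hu [h1 n1] [h2 n2]; split; first exact: dbar_le_trans h2.
by move=> e; subst u; apply: n1; apply: dbar_le_anti.
Qed.

Lemma dbar_ltI n s f m t g f' g' : full D n s -> full D m t -> into X n f -> into X m g ->
  incr n f' -> incr m g' -> same_order X n f f' m g g' -> ~ dle D n s f' m t g' ->
  dbar_lt D X (t, img m g) (s, img n f).
Proof.
move=> hs ht hf hg hf' hg' hso hn.
have hso' : same_order X m g g' n f f' by move=> i j hi hj; have [] := hso j i hj hi.
split; last first.
  move=> e; apply: hn; apply/(dbar_leE hs ht hf hg hf' hg' hso); rewrite e.
  by apply/(dbar_leE hs hs hf hf hf' hf'); [|exact: dle_refl] => i j hi hj;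
    rewrite !(into_lt hf) // !(incr_inv hf').
apply/(dbar_leE ht hs hg hf hg' hf' hso').
by case: (dle_total ht hs hg' hf').
Qed.

Lemma dbar_elt_code_inj p q : dbar_elt_code p = dbar_elt_code q -> p = q.
Proof.
case: p q => [s a] [t b] /(can_inj CodeSeq.codeK) [-> e]; congr pair.
by apply/fsetP => x; rewrite -(mem_sort leq) e mem_sort.
Qed.

End Ranks.

(* Realize the terms in omega^2 so that they share their first [k] variables:
   variables without priority follow the closest smaller shared one. *)
Lemma no_dominating_chain (D : predilator) k (t : nat -> nat * nat) : dilator D ->
  (forall j, fullt D (t j)) -> (forall j, k <= (t j).1) ->
  (forall j l l', l < k -> l' < k ->
     (pr D (t j) l < pr D (t j) l') = (pr D (t 0) l < pr D (t 0) l')) ->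
  (forall j, dominates D k (t j) (t j.+1)) -> False.
Proof.
move=> hD ht hk hpat hdom.
pose rk j i := \sum_(l < k) (pr D (t j) l <= i : nat).
pose pre j i := [exists l : 'I_k, pr D (t j) l == i].
pose off j i := if pre j i then 0 else i.+1.
have rk_mono j i i' : i < i' -> rk j i <= rk j i'.
  by move=> ii'; apply: leq_sum => l _; lia.
have rk_lt j i i' : i < i' -> pre j i' -> rk j i < rk j i'.
  move=> ii' /existsP[l /eqP e]; rewrite /rk (bigD1 l) //= [ltnRHS](bigD1 l) //= e leqnn.
  have -> : (i' <= i) = false by lia.
  by rewrite add0n add1n ltnS; apply: leq_sum => l' _; lia.
have rk_pr j l : l < k -> rk j (pr D (t j) l) = rk 0 (pr D (t 0) l).
  by move=> lk; apply: eq_bigr => l' _; rewrite leqNgt hpat // -leqNgt.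
have pre_pr j l : l < k -> pre j (pr D (t j) l).
  by move=> lk; apply/existsP; exists (Ordinal lk).
have off_le j i : off j i <= i.+1 by rewrite /off; case: (pre j i).
pose gO j i := choice.pickle (rk j i, off j i).
(* A copy of [gO] inside the natural numbers, faithful for indices with [i.+1 < N]; it is needed
   since [dominates] speaks about numerical assignments. *)
pose gN N j i := rk j i * N + off j i.
have gO_lt j j' i i' : lo_lt omega2 (gO j i) (gO j' i') <->
    rk j i < rk j' i' \/ rk j i = rk j' i' /\ off j i < off j' i'.
  rewrite order_of_lt /lex_lt !lex_keyK; split=> [[]//|h]; split=> //.
    by rewrite /lex_dom lex_keyK.
  by rewrite /lex_dom lex_keyK.
have lex_incr j i i' : i < i' -> rk j i < rk j i' \/ rk j i = rk j i' /\ off j i < off j i'.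
  move=> ii'; case: (boolP (pre j i')) => hp; first by left; apply: rk_lt.
  have := rk_mono j i i' ii'; rewrite leq_eqVlt => /orP[/eqP e|]; last by left.
  right; split=> //; rewrite {2}/off (negbTE hp); have := off_le j i; lia.
have gO_into j : into omega2 (t j).1 (gO j).
  by split=> [i _|i i' ii' _]; [exact: omega2_set|apply/gO_lt/lex_incr].
have gN_lt N j j' i i' : i.+1 < N -> i'.+1 < N -> (gN N j i < gN N j' i') <->
    rk j i < rk j' i' \/ rk j i = rk j' i' /\ off j i < off j' i'.
  move=> hi hi'; have h1 := off_le j i; have h2 := off_le j' i'; rewrite /gN.
  split; last by move=> [h|[-> h]]; nia.
  by case: (ltngtP (rk j i) (rk j' i')) => [h|h|->]; [left| |right; split=> //]; nia.
have gN_incr N j : (t j).1 < N -> incr (t j).1 (gN N j).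
  by move=> hN i i' ii' hi'; apply/gN_lt/lex_incr => //; lia.
have hlt j : dbar_lt D omega2 ((t j.+1).2, img (t j.+1).1 (gO j.+1)) ((t j).2, img (t j).1 (gO j)).
  pose N := (maxn (t j).1 (t j.+1).1).+1.
  have h1 : (t j).1 < N by rewrite /N; lia.
  have h2 : (t j.+1).1 < N by rewrite /N; lia.
  apply: (@dbar_ltI omega2 D _ _ _ _ _ _ (gN N j) (gN N j.+1)) => //; try exact: ht;
    try exact: gN_incr.
    by move=> i i' hi hi'; split; rewrite gO_lt gN_lt //; lia.
  apply: hdom; try exact: gN_incr.
  move=> l lk; rewrite /gN !rk_pr // /off !pre_pr //.
apply: (hD omega2 I (omega2_wf (M := _))).
exists (fun j => ((t j).2, img (t j).1 (gO j))); split=> // j.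
by apply: dbar_img; [exact: ht|exact: gO_into].
Qed.

(** * A branch from a descending sequence of a model *)

Lemma fin_det_pre T (G : set nat -> T) (h : nat -> nat) A :
  fin_det G (fun x => A (h x)) -> fin_det (fun A' => G (fun x => A' (h x))) A.
Proof.
move=> [b hb]; have [B hB] := bounded_below b h.
by exists B => A' hA; apply: hb => x xb; apply: hA; apply: hB.
Qed.

Definition left (A : set nat) : set nat := fun x => A (pair_code 0 x).
Definition right (A : set nat) : set nat := fun x => A (pair_code 1 x).

Lemma left_join A B : left (join A B) = A.
Proof. by apply/funext => x; rewrite /left join0. Qed.

Lemma right_join A B : right (join A B) = B.
Proof. by apply/funext => x; rewrite /right join1. Qed.

Lemma sort_eq_in (s : seq nat) (r r' : rel nat) : uniq s -> {in s &, r =2 r'} ->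
  sort r s = sort r' s.
Proof.
move=> us e; rewrite -(val_seq_sub_enum us) !sort_map.
congr [seq _ | _ <- sort _ _]; apply/funext => x; apply/funext => y /=.
by apply: e; apply: valP.
Qed.

Definition pair_rel (A : set nat) (x y : nat) : bool := `[< A (pair_code x y) >].

Lemma pair_rel_lo_code (X : linord) : pair_rel (lo_code X) = lob X.
Proof.
apply/funext => x; apply/funext => y; apply/asboolP/asboolP => [/rel_codeE//|h].
exact/rel_codeE.
Qed.

Lemma fin_det_sort (s : seq nat) A : uniq s -> fin_det (fun A' => sort (pair_rel A') s) A.
Proof.
move=> us; have [b hb] := bounded_below (size s) (fun i => nth 0 s i).
exists (pair_code b b) => A' hA; apply: sort_eq_in => // x y /(nthP 0)[i hi <-] /(nthP 0)[j hj <-].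
rewrite /pair_rel hA // /pair_code; have := hb _ hi; have := hb _ hj.
move: (nth 0 s i) (nth 0 s j) => u v h1 h2.
have : (u + v) ^ 2 <= (b + b) ^ 2 by rewrite leq_exp2r //; lia.
by lia.
Qed.

Section Path.

Variable D : predilator.

Definition decode_elt (z : nat) : nat * {fset nat} :=
  let s := CodeSeq.decode z in (head 0 s, seq_fset tt (behead s)).

Lemma decode_eltK p : decode_elt (dbar_elt_code p) = p.
Proof.
case: p => s a; rewrite /decode_elt /dbar_elt_code CodeSeq.codeK; congr pair.
by apply/fsetP => x; rewrite seq_fsetE mem_sort.
Qed.

(* The variable of priority [k] in the element [i + N] of the sequence coded by
   the right half of [A]. *)
Definition priority_value (k N : nat) (A : set nat) (i : nat) : nat :=
  let p := decode_elt (val_at (right A) (N + i)) in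
  nth 0 (sort (pair_rel (left A)) p.2) (pr D (tm p) k).

Lemma priority_valueE k N (X : linord) (F : nat -> nat * {fset nat}) i :
  priority_value k N (join (lo_code X) (graph (fun i => dbar_elt_code (F i)))) i =
  tmf X (F (N + i)) (pr D (tm (F (N + i))) k).
Proof.
by rewrite /priority_value left_join right_join val_at_graph decode_eltK pair_rel_lo_code.
Qed.

Lemma cont_at_priority_value k N A z :
  cont_at (fun A => graph (priority_value k N A)) (join A (graph z)).
Proof.
apply: cont_at_graph => i; set B := join _ _.
have h1 : fin_det (fun A' => val_at (right A') (N + i)) B.
  apply: (@fin_det_pre _ (fun C => val_at C (N + i))).
  by rewrite -/(right B) right_join; apply: fin_det_val_at.
apply: (fin_det_bind (H := fun v A => let p := decode_elt v in
  nth 0 (sort (pair_rel (left A)) p.2) (pr D (tm p) k)) h1).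
apply: (fin_det_map (fun s => nth 0 s _)).
apply: (@fin_det_pre _ (fun C => sort (pair_rel C) _)).
by apply: fin_det_sort; apply: fset_uniq.
Qed.

(* An infinite branch through the terms of [D]: each [E k] has its [k + 1] most
   important variables in common with all later terms, and a smaller value of
   the first differing one of these decides the comparison. *)
Record branch (E : nat -> nat * nat) : Prop := {
  branch_full : forall k, fullt D (E k);
  branch_size : forall k, k < (E k).1;
  branch_order : forall k k' l l', l <= k -> l <= k' -> l' <= k -> l' <= k' ->
    (pr D (E k) l < pr D (E k) l') = (pr D (E k') l < pr D (E k') l');
  branch_gt : forall k k' i f g, i <= k -> i <= k' -> incr (E k).1 f -> incr (E k').1 g ->
    agree D i (E k) f (E k') g -> g (pr D (E k') i) < f (pr D (E k) i) ->
    ~ tle D (E k) f (E k') g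
}.

Variables (M : omega_model) (X : linord) (F : nat -> nat * {fset nat}).
Hypothesis hD : dilator D.
Hypothesis hM : forall A, M A -> cont_at thin A -> M (thin A).
Hypothesis hv : forall k N, M (graph (fun i => tmf X (F (N + i)) (pr D (tm (F (N + i))) k))).
Hypothesis hX : well_order_in M X.
Hypothesis hF : forall i, dbar_set D X (F i).
Hypothesis hdesc : forall i, dbar_lt D X (F i.+1) (F i).

Let t i := tm (F i).
Let f i := tmf X (F i).

Lemma F_desc i j : i < j -> dbar_lt D X (F j) (F i).
Proof.
move=> /subnK <-; elim: (j - i.+1) => [|k ih]; first exact: hdesc.
by rewrite addSn; apply: dbar_lt_trans ih.
Qed.

Lemma F_gt i j r c : i < j -> rank_on X r c -> {subset (F i).2 <= c} ->
  {subset (F j).2 <= c} ->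
  ~ tle D (t i) (fun l => r (f i l)) (t j) (fun l => r (f j l)).
Proof.
move=> ij hr si sj /(dbar_le_rank (hF i) (hF j) hr si sj) h.
by have [h1 h2] := F_desc ij; apply: h2; apply: dbar_le_anti.
Qed.

Lemma rank2 i j : exists r c, [/\ rank_on X r c, {subset (F i).2 <= c} & {subset (F j).2 <= c}].
Proof. by have [r [c [h1 h2 h3 _]]] := rank3 (hF i) (hF j) (hF j); exists r, c. Qed.

Definition share k i j : Prop := forall l, l < k -> f i (pr D (t i) l) = f j (pr D (t j) l).

Lemma share_agree k i j (r : nat -> nat) : share k i j ->
  agree D k (t i) (fun l => r (f i l)) (t j) (fun l => r (f j l)).
Proof. by move=> h l lk; rewrite h. Qed.

Lemma ft i : fullt D (t i). Proof. exact: dbar_full (hF i). Qed.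

Lemma pr_lt_share k i j l l' : k <= (t i).1 -> k <= (t j).1 -> share k i j ->
  l < k -> l' < k -> (pr D (t i) l < pr D (t i) l') = (pr D (t j) l < pr D (t j) l').
Proof.
move=> ki kj hs lk lk'; have hlt n m : m < k -> k <= (t n).1 -> pr D (t n) m < (t n).1.
  by move=> h1 h2; apply: pr_lt; [exact: ft|lia].
have e n : k <= (t n).1 -> (pr D (t n) l < pr D (t n) l') <->
    lo_lt X (f n (pr D (t n) l)) (f n (pr D (t n) l')).
  by move=> kn; rewrite (into_lt (dbar_into (hF n))) //; apply: hlt.
apply/idP/idP => /e; first by rewrite !hs // => /(_ ki)/e -> .
by rewrite -!hs // => /(_ kj)/e -> .
Qed.

(** Otherwise dominations can be found arbitrarily late. The upper term of each next one comes no
    earlier than the lower term of the last, and since the sequence descends, [dominates_trans]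
    links them to a chain. The chain need not belong to [M], so the true dilator property is
    used. *)
Lemma eventually_undominated k N :
  (forall i j, N <= i -> N <= j -> k <= (t i).1 /\ share k i j) ->
  exists2 N', N <= N' & forall i j, N' <= i -> i < j -> ~ dominates D k (t i) (t j).
Proof.
move=> hN; apply: contrapT => hno.
have step n : N <= n -> exists i j, [/\ n <= i, i < j & dominates D k (t i) (t j)].
  move=> Nn; apply: contrapT => h; apply: hno; exists n => // i j ni ij hd.
  by apply: h; exists i, j.
have [nxt hnxt] : exists nxt : nat -> nat * nat, forall n, N <= n ->
    [/\ n <= (nxt n).1, (nxt n).1 < (nxt n).2 & dominates D k (t (nxt n).1) (t (nxt n).2)].
  have h n : exists p : nat * nat, N <= n ->
      [/\ n <= p.1, p.1 < p.2 & dominates D k (t p.1) (t p.2)].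
    case: (leqP N n) => [/step[i [j h]]|_]; first by exists (i, j).
    by exists (0, 0).
  by have [g hg] := choice h; exists g.
pose b := fix b j := if j is j'.+1 then (nxt (b j')).2 else N.
have hb j : N <= b j.
  by elim: j => //= j ih; have [h1 h2 _] := hnxt _ ih; lia.
pose a j := (nxt (b j)).1.
have ha j : N <= a j by have [h1 _ _] := hnxt _ (hb j); exact: leq_trans h1.
apply: (@no_dominating_chain D k (fun j => t (a j)) hD) => [j|j|j l l' lk lk'|j].
- exact: ft.
- by have [] := hN _ _ (ha j) (ha j).
- have [h1 h2] := hN _ _ (ha j) (ha 0); have [h3 _] := hN _ _ (ha 0) (ha 0).
  exact: pr_lt_share h2 _ _.
have [_ _ hd] := hnxt _ (hb j); have [h1 _ _] := hnxt _ (hb j.+1).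
rewrite -[(nxt (b j)).2]/(b j.+1) in hd.
move: h1; rewrite leq_eqVlt => /orP[/eqP e|lt]; first by rewrite /a -e.
have [r [c [hr s1 s2]]] := rank2 (b j.+1) (a j.+1).
apply: (dominates_trans (ft _) (ft _) (ft _) _
  (rank_incr (hF _) hr s1) (rank_incr (hF _) hr s2) _ _ hd).
- by have [] := hN _ _ (ha j.+1) (ha j.+1).
- by apply: share_agree; have [] := hN _ _ (hb j.+1) (ha j.+1).
- exact: F_gt lt hr s1 s2.
Qed.

Definition settled k N : Prop :=
  [/\ forall i, N <= i -> k < (t i).1, forall i j, N <= i -> N <= j -> share k.+1 i j
    & forall i j, N <= i -> N <= j -> ~ dominates D k (t i) (t j)].

(** From the stage where domination stops, a term without a [k]-th variable (counted from 0), or a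
    rise of its value, would again be a domination, by [dominates_all] and [dominates_squeeze]. So
    this value descends weakly in [X], and as a sequence of [M] it becomes constant. *)
Lemma settled_step k N :
  (forall i j, N <= i -> N <= j -> k <= (t i).1 /\ share k i j) ->
  exists N', settled k N'.
Proof.
move=> hN; have [N1 NN1 hdom] := eventually_undominated hN.
have hN1 i j : N1 <= i -> N1 <= j -> k <= (t i).1 /\ share k i j.
  by move=> h1 h2; apply: hN; exact: leq_trans NN1 _.
have hk i : N1 <= i -> k < (t i).1.
  move=> Ni; have [h1 h2] := hN1 i i.+1 Ni (leqW Ni).
  have [h3 _] := hN1 i.+1 i.+1 (leqW Ni) (leqW Ni).
  rewrite ltn_neqAle h1 andbT; apply/eqP => e; apply: (hdom i i.+1) => //.
  have [r [c [hr s1 s2]]] := rank2 i i.+1.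
  apply: (dominates_all (ft _) (ft _) (esym e) h3
    (rank_incr (hF _) hr s1) (rank_incr (hF _) hr s2)); first exact: share_agree.
  exact: F_gt (ltnSn i) hr s1 s2.
pose v i := f i (pr D (t i) k).
have vX i : N1 <= i -> lo_set X (v i).
  by move=> Ni; apply: (dbar_into (hF i)).1; apply: pr_lt; [exact: ft|exact: hk].
have hv1 i : N1 <= i -> v i.+1 = v i \/ lo_lt X (v i.+1) (v i).
  move=> Ni; have Ni1 : N1 <= i.+1 by exact: leqW.
  case: (lo_trichotomy (vX _ Ni1) (vX _ Ni)) => [|->|lt]; [by right|by left|].
  exfalso; apply: (hdom i i.+1) => //.
  have [r [c [hr s1 s2]]] := rank2 i i.+1.
  have i1 := rank_incr (hF _) hr s1; have i2 := rank_incr (hF _) hr s2.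
  apply: (dominates_squeeze (ft i.+1) (ft i) (hk _ Ni1) (hk _ Ni) i2 i1).
  - by apply: share_agree; have [] := hN1 i.+1 i Ni1 Ni.
  - apply/hr => //; [apply: s1|apply: s2]; apply: mem_tmf; apply: pr_lt; try exact: ft;
      exact: hk.
  - case: (dle_total (ft i.+1) (ft i) i2 i1) => // h.
    by case: (F_gt (ltnSn i) hr s1 s2).
have [|||||N2 hN2] := eventually_constant (F := fun i => v (N1 + i)) hM hX.
- by [].
- by move=> x y z _ _ _; apply: lo_lt_trans.
- by move=> i; apply: vX; exact: leq_addr.
- by move=> i; rewrite addnS; apply: hv1; exact: leq_addr.
- exact: hv.
have hc i : N1 + N2 <= i -> v i = v (N1 + N2).
  move=> h; have := hN2 (i - N1); rewrite subnKC; last by lia.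
  by apply; lia.
exists (N1 + N2); split=> [i hi|i j hi hj l|i j hi hj hd].
- by apply: hk; lia.
- rewrite ltnS leq_eqVlt => /orP[/eqP->|lk]; first by rewrite -/(v i) -/(v j) !hc.
  have [_ h] : k <= (t i).1 /\ share k i j by apply: hN1; lia.
  exact: h.
have hi1 : N1 <= i by lia.
have hj1 : N1 <= j by lia.
case: (ltngtP i j) => [ij|ji|e].
- exact: (hdom i j).
- have [r [c [hr s1 s2]]] := rank2 i j.
  have i1 := rank_incr (hF _) hr s1; have i2 := rank_incr (hF _) hr s2.
  apply: (hd _ _ i1 i2); first by apply: share_agree; have [] := hN1 i j hi1 hj1.
  case: (dle_total (ft i) (ft j) i1 i2) => // h.
  by case: (F_gt ji hr s2 s1).
- subst j; have [r [c [hr s1 s2]]] := rank2 i i.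
  have i1 := rank_incr (hF _) hr s1.
  by apply: (hd _ _ i1 i1) => //; apply: dle_refl => //; exact: ft.
Qed.

(** [E k] is a term from a stage at which all priorities up to [k] have settled. A violation of
    [branch_gt] would be a domination between settled terms, by [dominates_squeeze]. *)
Lemma branch_exists : exists E, branch E.
Proof.
have hs k : exists N, settled k N.
  elim: k => [|k [N [h1 h2 h3]]]; first by apply: (@settled_step 0 0).
  by apply: (@settled_step k.+1 N) => i j hi hj; split; [exact: h1|exact: h2].
have [N hN] := choice hs; pose m k := \max_(l < k.+1) N l.
have Nm i k : i <= k -> N i <= m k.
  by rewrite -ltnS => ik; apply: (leq_bigmax_cond (F := fun l : 'I_k.+1 => N l) (Ordinal ik)).
exists (fun k => t (m k)); split.
- by move=> k; exact: ft.
- by move=> k; have [h _ _] := hN k; apply: h; exact: Nm.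
- move=> k k' l l' lk lk' l'k l'k'.
  have [h1 h2 _] := hN (maxn l l').
  apply: (@pr_lt_share (maxn l l').+1); rewrite ?ltnS ?leq_maxl ?leq_maxr //.
  + by apply: h1; apply: Nm; lia.
  + by apply: h1; apply: Nm; lia.
  + by apply: h2; apply: Nm; lia.
- move=> k k' i g g' ik ik' hg hg' hag hlt hle.
  have [h1 _ h3] := hN i.
  apply: (h3 (m k') (m k)); [exact: Nm|exact: Nm|].
  by apply: (dominates_squeeze (ft _) (ft _) _ _ hg hg' hag hlt hle); apply: h1; exact: Nm.
Qed.

End Path.

(** * The order 2^X *)

Section Exp2.

Variable X : linord.

Lemma exp2_lt_irr s : ~ exp2_lt X s s.
Proof. by elim: s => [|x s ih] //= [/lo_lt_irr|[_ /ih]]. Qed.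

Lemma exp2_lt_trans s t u : exp2_lt X s t -> exp2_lt X t u -> exp2_lt X s u.
Proof.
elim: u s t => [|z u ih] [|x s] [|y t] //= [xy|[<- st]] [yz|[<- tu]].
- by left; apply: lo_lt_trans yz.
- by left.
- by left.
- by right; split=> //; apply: ih tu.
Qed.

Lemma exp2_lt_total s t : (forall x, x \in s -> lo_set X x) -> (forall x, x \in t -> lo_set X x) ->
  [\/ s = t, exp2_lt X s t | exp2_lt X t s].
Proof.
elim: s t => [|x s ih] [|y t] hs ht; [by constructor 1|by constructor 2|by constructor 3|].
have hx : lo_set X x by apply: hs; rewrite inE eqxx.
have hy : lo_set X y by apply: ht; rewrite inE eqxx.
case: (lo_trichotomy hx hy) => [h|<-|h]; [by constructor 2; left| |by constructor 3; left].
case: (ih t) => [z hz|z hz|->|h|h].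
- by apply: hs; rewrite inE hz orbT.
- by apply: ht; rewrite inE hz orbT.
- by constructor 1.
- by constructor 2; right.
- by constructor 3; right.
Qed.

Lemma exp2_lt_cat p s t : exp2_lt X s t -> exp2_lt X (p ++ s) (p ++ t).
Proof. by elim: p => //= x p ih h; right; split=> //; apply: ih. Qed.

Lemma descending_set s x : descending X s -> x \in s -> lo_set X x.
Proof.
elim: s => //= y s ih [hy _ hs]; rewrite inE => /orP[/eqP->//|]; exact: ih.
Qed.

Lemma descending_filter (v : nat -> nat) (a : pred nat) m n :
  (forall l l', l < l' -> l' < m + n -> lo_lt X (v l') (v l)) ->
  (forall l, l < m + n -> lo_set X (v l)) ->
  descending X [seq v l | l <- iota m n & a l].
Proof.
move=> hlt hset; elim: n m hlt hset => [|n ih] m hlt hset //=.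
have {}ih : descending X [seq v l | l <- iota m.+1 n & a l].
  by apply: ih; rewrite addSnnS.
case: ifP => //= _; split=> //; first by apply: hset; lia.
case e : [seq v l | l <- iota m.+1 n & a l] => [//|y t].
have : y \in [seq v l | l <- iota m.+1 n & a l] by rewrite e inE eqxx.
move=> /mapP[l]; rewrite mem_filter mem_iota => /andP[_ hl] ->.
by apply: hlt; lia.
Qed.

(** The lists agree before [l0]; there the second one contains [v l0], which exceeds all later
    entries of the first. *)
Lemma exp2_lt_filter (v : nat -> nat) (a b : pred nat) l0 N :
  (forall l l', l < l' -> l' < N -> lo_lt X (v l') (v l)) ->
  l0 < N -> b l0 -> ~~ a l0 -> (forall l, l < l0 -> a l = b l) ->
  exp2_lt X [seq v l | l <- iota 0 N & a l] [seq v l | l <- iota 0 N & b l].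
Proof.
move=> hlt hl0 hb ha hab; have -> : N = l0 + (1 + (N - l0.+1)) by lia.
rewrite iotaD !filter_cat !map_cat.
have -> : [seq l <- iota 0 l0 | a l] = [seq l <- iota 0 l0 | b l].
  by apply/eq_in_filter => l; rewrite mem_iota => h; apply: hab; lia.
apply: exp2_lt_cat; rewrite add0n iotaD /= (negbTE ha) hb /=.
case e : [seq v l | l <- iota (l0 + 1) (N - l0.+1) & a l] => [//|y t].
have : y \in [seq v l | l <- iota (l0 + 1) (N - l0.+1) & a l] by rewrite e inE eqxx.
move=> /mapP[l]; rewrite mem_filter mem_iota => /andP[_ hl] ->.
by left; apply: hlt; lia.
Qed.

End Exp2.

Lemma filter_iota_widen (P : pred nat) i N : i < N ->
  [seq l <- iota 0 i.+1 | P l] = [seq l <- iota 0 N | (l <= i) && P l].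
Proof.
move=> iN; have -> : N = i.+1 + (N - i.+1) by lia.
rewrite iotaD filter_cat -[LHS]cats0; congr (_ ++ _).
  by apply/eq_in_filter => l; rewrite mem_iota => h; have -> : l <= i by lia.
apply/esym/eqP; rewrite -size_eq0 size_filter -leqn0 leqNgt -has_count -all_predC.
by apply/allP => l; rewrite mem_iota /= => h; have -> : (l <= i) = false by lia.
Qed.

(** * Stacks of guesses *)

(** A guess codes an element [x] of the order and a number [n], claimed to have no [m] that makes
    the matrix of the Pi^0_2 formula true at [x]. In what follows, [d m n x] means that [m] refutes
    this claim. *)
Definition guess_val (c : nat) : nat := (lex_key c).1.
Definition guess_wit (c : nat) : nat := (lex_key c).2.

Section Stack.

Variables (r : rel nat) (d : nat -> nat -> nat -> bool).

Definition blt (x y : nat) : bool := r x y && (x != y).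

Definition standing (s c : nat) : bool :=
  r (guess_val c) (guess_val c) &&
  ~~ has (fun m => d m (guess_wit c) (guess_val c)) (iota 0 s).

(** Searching below the stage [s] only keeps the choice computable; preferring the least code makes
    it converge. *)
Definition next_guess (s c : nat) : option nat :=
  ohead [seq c' <- iota 0 s | blt (guess_val c') (guess_val c) && standing s c'].

Fixpoint grow (s n c : nat) : seq nat :=
  c :: (if n is n'.+1 then
          if next_guess s c is Some c' then grow s n' c' else [::]
        else [::]).

Definition stack (c s : nat) : seq nat := grow s s c.

End Stack.

Section TrueStack.

Variables (X : linord) (d : nat -> nat -> nat -> bool) (c0 : nat).

Definition correct (c : nat) : Prop :=
  lo_set X (guess_val c) /\ forall m, ~~ d m (guess_wit c) (guess_val c).

Hypothesis correct0 : correct c0.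
Hypothesis correct_below : forall c, correct c ->
  exists2 c', correct c' & lo_lt X (guess_val c') (guess_val c).

Local Notation st := (stack (lob X) d c0).

Lemma bltP x y : reflect (lo_lt X x y) (blt (lob X) x y).
Proof.
by apply: (iffP andP) => -[h /eqP ne]; split=> //; apply/asboolP.
Qed.

(** The least correct guess below [c] is eventually chosen: of the finitely many smaller codes, each
    one that lies below [c] in the order is refuted by some stage. *)
Lemma next_guess_stable c : correct c -> exists c' s0, correct c' /\
  forall s, s0 <= s -> next_guess (lob X) d s c = Some c'.
Proof.
move=> hc; pose P c' := correct c' /\ lo_lt X (guess_val c') (guess_val c).
have [|[h1 h2] hmin] := @leastP P; first by have [c' h h'] := correct_below hc; exists c'.
set c' := least P in h1 h2 hmin; exists c'.
have wrong x : exists s0, x < c' -> forall s, s0 <= s ->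
    ~~ (blt (lob X) (guess_val x) (guess_val c) && standing (lob X) d s x).
  case: (pselect (x < c' /\ lo_lt X (guess_val x) (guess_val c))) => [[hx hlt]|h]; last first.
    exists 0 => hx s _; apply/negP => /andP[/bltP hlt _]; exact: h.
  have : ~ correct x.
    by move=> hx'; have := hmin x (conj hx' hlt); lia.
  case: (pselect (exists m, d m (guess_wit x) (guess_val x))) => [[m hm] _|hn hx'].
    exists m.+1 => _ s ms; apply/negP => /andP[_ /andP[_ /hasPn/(_ m)]].
    by rewrite mem_iota hm => /(_ ms).
  case: hx'; split; first by have [] := lo_lt_set hlt.
  by move=> m; apply/negP => hm; apply: hn; exists m.
have [g hg] := choice wrong; exists (maxn c'.+1 (\max_(x < c') g x)); split=> // s hs.
have es : iota 0 s = iota 0 c' ++ c' :: iota c'.+1 (s - c'.+1).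
  have {1}-> : s = c' + (1 + (s - c'.+1)) by lia.
  by rewrite iotaD add0n iotaD /= addn1.
rewrite /next_guess es filter_cat.
rewrite (_ : [seq _ <- iota 0 c' | _] = [::]); last first.
  apply/eqP; rewrite -size_eq0 size_filter -leqn0 leqNgt -has_count -all_predC.
  apply/allP => x; rewrite mem_iota add0n => /= hx; apply: hg => //.
  have hgx : g x <= \max_(y < c') g y.
    exact: (leq_bigmax_cond (F := fun y : 'I_c' => g y) (P := xpredT) (Ordinal hx) isT).
  exact: leq_trans hgx (leq_trans (leq_maxr _ _) hs).
rewrite /=; case: ifP => // /negP[]; apply/andP; split; first exact/bltP.
apply/andP; split; first by apply/asboolP; exact: h1.1.
by apply/hasPn => m _; apply: h1.2.
Qed.

Lemma grow_stable i c : correct c -> exists l s0, size l = i.+1 /\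
  forall s n, s0 <= s -> i <= n -> take i.+1 (grow (lob X) d s n c) = l.
Proof.
elim: i c => [|i ih] c hc; first by exists [:: c], 0; split=> // s [|n] _ _ //=; rewrite take0.
have [c' [s1 [hc' h1]]] := next_guess_stable hc; have [l [s2 [sl h2]]] := ih c' hc'.
exists (c :: l), (maxn s1 s2); split=> [/=|s [|n] hs hn //=]; first by rewrite sl.
by rewrite h1; [congr (_ :: _); apply: h2; lia|lia].
Qed.

Lemma stack_stable i : exists l s0, size l = i.+1 /\ forall s, s0 <= s -> take i.+1 (st s) = l.
Proof.
have [l [s0 [h1 h2]]] := grow_stable i correct0.
by exists l, (maxn i s0); split=> // s hs; apply: h2; lia.
Qed.

Lemma grow_path s n c l : lo_set X (guess_val c) -> l.+1 < size (grow (lob X) d s n c) ->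
  lo_lt X (guess_val (nth 0 (grow (lob X) d s n c) l.+1))
          (guess_val (nth 0 (grow (lob X) d s n c) l)).
Proof.
elim: n c l => [|n ih] c l hc //=; case e : next_guess => [c'|] //=.
have hlt : lo_lt X (guess_val c') (guess_val c).
  have : c' \in [seq c' <- iota 0 s | blt (lob X) (guess_val c') (guess_val c) &&
      standing (lob X) d s c'].
    by move: e; rewrite /next_guess; case: (filter _ _) => //= a t [->]; rewrite inE eqxx.
  by rewrite mem_filter => /andP[/andP[/bltP]].
case: l => [_|l]; first by case: (n).
rewrite ltnS => hl /=; apply: ih => //.
by have [] := lo_lt_set hlt.
Qed.

Lemma stack_lt s l l' : l < l' -> l' < size (st s) ->
  lo_lt X (guess_val (nth 0 (st s) l')) (guess_val (nth 0 (st s) l)).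
Proof.
have hp k : k.+1 < size (st s) ->
    lo_lt X (guess_val (nth 0 (st s) k.+1)) (guess_val (nth 0 (st s) k)).
  by apply: grow_path; case: correct0.
elim: l' => // l' ih; rewrite ltnS leq_eqVlt => /orP[/eqP->|h] hl; first exact: hp.
by apply: lo_lt_trans (hp _ hl) _; apply: ih => //; apply: ltnW.
Qed.

Lemma stack_set s l : l < size (st s) -> lo_set X (guess_val (nth 0 (st s) l)).
Proof.
case: l => [_|l hl]; last by have [] := lo_lt_set (stack_lt (ltnSn l) hl).
by rewrite /stack; case: (s) => [|n]; case: correct0.
Qed.

Lemma stack_head s : take 1 (st s) = [:: c0].
Proof. by rewrite /stack; case: s => //= n; rewrite take0. Qed.

End TrueStack.

Fixpoint exp2b (r : rel nat) (s t : seq nat) : bool :=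
  match s, t with
  | _, [::] => false
  | [::], _ :: _ => true
  | x :: s', y :: t' => blt r x y || ((x == y) && exp2b r s' t')
  end.

Lemma exp2bP (X : linord) s t : reflect (exp2_lt X s t) (exp2b (lob X) s t).
Proof.
apply: (iffP idP); elim: s t => [|x s ih] [|y t] //=.
  by move=> /orP[/bltP|/andP[/eqP-> /ih]]; [left|right].
by move=> [/bltP->//|[<- /ih->]]; rewrite eqxx orbT.
Qed.

(** * Nodes as values for the variables of the branch *)

Section Nodes.

Variables (D : predilator) (E : nat -> nat * nat).

(* The order of the variables with priorities [i] and [j]. *)
Definition xlt (i j : nat) : bool :=
  pr D (E (maxn i j)) i < pr D (E (maxn i j)) j.

Section History.

Variable st : nat -> seq nat.

(* The last stage up to [s] at which the first [i + 2] entries changed. *)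
Fixpoint nid (i s : nat) : nat :=
  if s is s'.+1 then
    if take i.+2 (st s) == take i.+2 (st s') then nid i s' else s
  else 0.

(** The element of 2^X whose exponents come from the levels [l <= i] with a variable not above that
    of level [i]. This choice makes [theta] increase with the variables at every stage, see
    [theta_mono], while [theta] takes values in an order that is well-founded in the model. *)
Definition theta (i s : nat) : seq nat :=
  [seq guess_val (nth 0 (st s) l) | l <- iota 0 i.+1 & ~~ xlt i l].

Definition node_key (z : nat) : seq nat * nat * nat * nat :=
  odflt ([::], 0, 0, 0) (choice.unpickle z).

(* [([::], 0, 0, q)] is the [q]-th element below all nodes. *)
Definition node_dom (z : nat) : bool :=
  let: (th, i, s, q) := node_key z in
  (choice.pickle (node_key z) == z) &&
  ([&& th == [::], i == 0 & s == 0] ||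
   [&& i < size (st s), nid i s == s & th == theta i s]).

(** [nid] looks at one guess beyond level [i]: a change of guess [i.+1] is paid for by the node of
    level [i], whose [theta] involves only the unchanged guesses. The last component separates
    variables placed in the same block. *)
Definition node (i s q : nat) : nat := choice.pickle (theta i s, i, nid i s, q).

Definition bottom_node (q : nat) : nat := choice.pickle ([::] : seq nat, 0, 0, q).

Definition last_level (s : nat) : nat := (size (st s)).-1.

Definition lower_neighbour (k u : nat) : option 'I_k.+1 :=
  [pick l : 'I_k.+1 | (pr D (E k) l <= u) &&
     [forall l' : 'I_k.+1, (pr D (E k) l' <= u) ==> (pr D (E k) l' <= pr D (E k) l)]].

(** As in the realization in omega^2, variables without a level follow the nearest lower variable
    that has one; if there is none, they go to the bottom nodes. *)
Definition place (s u : nat) : nat :=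
  if lower_neighbour (last_level s) u is Some l then
    node l s (if pr D (E (last_level s)) l == u then 0 else u.+1)
  else bottom_node u.+1.

Definition placed_term (s : nat) : nat * {fset nat} :=
  ((E (last_level s)).2, img (E (last_level s)).1 (place s)).

Lemma nidS i s :
  nid i s.+1 = if take i.+2 (st s.+1) == take i.+2 (st s) then nid i s else s.+1.
Proof. by []. Qed.

Lemma take_nid i s : take i.+2 (st (nid i s)) = take i.+2 (st s).
Proof. by elim: s => //= s ih; case: eqP => [->|]. Qed.

Lemma nid_idem i s : nid i (nid i s) = nid i s.
Proof.
elim: s => //= s ih; case: eqP => // /eqP h /=.
by rewrite (negbTE h).
Qed.

Lemma nid_le i s : nid i s <= s.
Proof. by elim: s => //= s ih; case: eqP => // _; exact: leqW. Qed.

Lemma take_lower i j (s t : seq nat) : j <= i -> take i s = take i t -> take j s = take j t.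
Proof. by move=> ji e; rewrite -(take_takel s ji) e take_takel. Qed.

Lemma size_take_lt i (s t : seq nat) : take i.+1 s = take i.+1 t -> i < size s -> i < size t.
Proof.
move=> e; have := congr1 size e; rewrite !size_take_min; lia.
Qed.

Lemma theta_take i s s' : take i.+1 (st s) = take i.+1 (st s') -> theta i s = theta i s'.
Proof.
move=> e; apply/eq_in_map => l; rewrite mem_filter mem_iota => /andP[_ hl].
by rewrite -(nth_take 0 (n0 := i.+1)) ?e ?nth_take //; lia.
Qed.

Lemma theta_nid i s : theta i (nid i s) = theta i s.
Proof. by apply: theta_take; apply: take_lower (take_nid i s). Qed.

Lemma nid_stable i s0 : (forall s, s0 <= s -> take i.+2 (st s) = take i.+2 (st s0)) ->
  forall s, s0 <= s -> nid i s = nid i s0.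
Proof.
move=> h s /subnK <-; elim: (s - s0) => // n ih.
by rewrite addSn /= !h ?eqxx //; lia.
Qed.

End History.

Section HistoryExt.

Variables (st st' : nat -> seq nat) (n : nat).
Hypothesis e : forall s, s <= n -> st s = st' s.

Lemma nid_ext i s : s <= n -> nid st i s = nid st' i s.
Proof. by elim: s => //= s ih hs; rewrite !e ?ih //; exact: ltnW. Qed.

Lemma theta_ext i s : s <= n -> theta st i s = theta st' i s.
Proof. by move=> hs; rewrite /theta e. Qed.

Lemma placed_term_ext : placed_term st n = placed_term st' n.
Proof.
rewrite /placed_term /last_level e //; congr (_, img _ _).
apply/funext => u; rewrite /place /last_level e //.
by case: lower_neighbour => // l; rewrite /node theta_ext // nid_ext.
Qed.

Lemma node_dom_ext z : (node_key z).1.2 <= n -> node_dom st z = node_dom st' z.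
Proof.
rewrite /node_dom; case: (node_key z) => [[[th i] s] q] /= hs.
by rewrite e // theta_ext // nid_ext.
Qed.

End HistoryExt.

Hypothesis hE : branch D E.

Lemma xltE k i j : i <= k -> j <= k -> xlt i j = (pr D (E k) i < pr D (E k) j).
Proof.
by move=> ik jk; apply: branch_order => //; rewrite ?leq_maxl ?leq_maxr.
Qed.

Lemma xlt_irr i : xlt i i = false.
Proof. by rewrite /xlt ltnn. Qed.

Lemma xlt_trans i j l : xlt i j -> xlt j l -> xlt i l.
Proof.
pose k := maxn i (maxn j l).
by rewrite !(@xltE k) /k; try lia; exact: ltn_trans.
Qed.

Lemma pr_E_lt k l : l <= k -> pr D (E k) l < (E k).1.
Proof. by move=> h; apply: pr_lt; [exact: branch_full|have := branch_size hE k; lia]. Qed.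

Lemma lower_neighbourP k u :
  match lower_neighbour k u with
  | Some l => pr D (E k) l <= u /\
      forall l', l' <= k -> pr D (E k) l' <= u -> pr D (E k) l' <= pr D (E k) l
  | None => forall l, l <= k -> u < pr D (E k) l
  end.
Proof.
rewrite /lower_neighbour; case: pickP => [l /andP[h1 /forallP h2]|hn].
  by split=> // l' l'k hl'; have := h2 (Ordinal (l'k : l' < k.+1)); rewrite /= hl'.
move=> l lk; rewrite ltnNge; apply/negP => hl.
pose P (i : 'I_k.+1) := pr D (E k) i <= u.
have hP : P (Ordinal (lk : l < k.+1)) by [].
case: (arg_maxnP (fun i : 'I_k.+1 => pr D (E k) i) hP) => i Pi hmax.
have := hn i; rewrite [_ <= _]Pi /= => /negbT /forallPn[j].
by rewrite negb_imply => /andP[Pj /negP]; apply; exact: hmax.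
Qed.

Lemma lower_neighbour_pr k l : l <= k ->
  exists2 l' : 'I_k.+1, lower_neighbour k (pr D (E k) l) = Some l' & l' = l :> nat.
Proof.
move=> lk; have := lower_neighbourP k (pr D (E k) l).
case: lower_neighbour => [l' [h1 h2]|/(_ l lk)]; last by rewrite ltnn.
exists l' => //; have h3 := h2 l lk (leqnn _).
have hk := branch_size hE k; have := ltn_ord l'; rewrite ltnS => l'k.
by apply: (pr_inj (branch_full hE k)); lia.
Qed.

End Nodes.

(** Later stages count as smaller. This is harmless because the guesses seen by a node of a fixed
    level change only finitely often. *)
Definition node_lt (r : rel nat) (z z' : nat) : bool :=
  let: (th, i, s, q) := node_key z in
  let: (th', i', s', q') := node_key z' in
  exp2b r th th' ||
  (th == th') && ((i < i') || (i == i') && ((s' < s) || (s == s') && (q < q'))).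

(** * The order W of nodes and the descending sequence in D(W) *)

Section NodeOrder.

Variables (D : predilator) (E : nat -> nat * nat) (hE : branch D E).
Variables (X : linord) (d : nat -> nat -> nat -> bool) (c0 : nat).
Hypothesis correct0 : correct X d c0.
Hypothesis correct_below : forall c, correct X d c ->
  exists2 c', correct X d c' & lo_lt X (guess_val c') (guess_val c).

Local Notation st := (stack (lob X) d c0).

Lemma theta_descending i s : i < size (st s) -> descending X (theta D E st i s).
Proof.
move=> hi; apply: descending_filter => [l l' h1 h2|l h].
  by apply: (stack_lt correct0) => //; lia.
by apply: (stack_set correct0); lia.
Qed.

(** At the first level that is in the index set of [j] but not in that of [i], the larger term gains
    an exponent. Before it nothing is lost: up to [j], the set of [i] is contained in that of [j] by
    transitivity of [xlt]. *)
Lemma theta_mono i j s : i < size (st s) -> j < size (st s) -> xlt D E i j ->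
  exp2_lt X (theta D E st i s) (theta D E st j s).
Proof.
move=> hi hj hij; rewrite /theta (filter_iota_widen _ hi) (filter_iota_widen _ hj).
pose a l := (l <= i) && ~~ xlt D E i l; pose b l := (l <= j) && ~~ xlt D E j l.
have bj : b j by rewrite /b leqnn xlt_irr.
have aj : ~~ a j by rewrite /a hij andbF.
have [|[hb ha] hmin] := @leastP (fun l => b l /\ ~~ a l); first by exists j.
set l0 := least _ in hb ha hmin.
have l0j : l0 <= j by case/andP: hb.
apply: (@exp2_lt_filter X _ a b l0) => //; [|by lia|].
  by move=> l l'; exact: (stack_lt correct0).
move=> l hl; apply/idP/idP => hal; last first.
  by apply: contrapT => /negP na; have := hmin l (conj hal na); lia.
rewrite /b; have -> /= : l <= j by lia.
case/andP: hal => li nil; apply: contra nil; exact: (xlt_trans hE hij).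
Qed.

Lemma node_keyK p : node_key (choice.pickle p) = p.
Proof. by rewrite /node_key choice.pickleK. Qed.

Lemma node_dom_node i s q : i < size (st s) -> node_dom D E st (node D E st i s q).
Proof.
move=> hi; rewrite /node_dom node_keyK eqxx /=; apply/orP; right.
rewrite nid_idem theta_nid !eqxx !andbT.
by apply: size_take_lt hi; apply: take_lower (esym (take_nid st i s)).
Qed.

Lemma node_dom_bottom q : node_dom D E st (bottom_node q).
Proof. by rewrite /node_dom node_keyK !eqxx. Qed.

Lemma node_domP z : node_dom D E st z ->
  [/\ choice.pickle (node_key z) = z, descending X (node_key z).1.1.1
    & (node_key z).1.2 = 0 \/
      nid st (node_key z).1.1.2 (node_key z).1.2 = (node_key z).1.2].
Proof.
rewrite /node_dom; case: (node_key z) => [[[th i] s] q] /= /andP[/eqP hz].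
case/orP => [/and3P[/eqP eth _ /eqP es]|/and3P[hi /eqP hn /eqP eth]]; split=> //.
- by rewrite eth.
- by left.
- by rewrite eth; apply: theta_descending.
- by right.
Qed.

Lemma node_lt_irr z : ~ node_lt (lob X) z z.
Proof.
rewrite /node_lt; case: (node_key z) => [[[th i] s] q].
by rewrite !ltnn !eqxx /= orbF => /exp2bP /exp2_lt_irr.
Qed.

Lemma node_lt_trans x y z : node_dom D E st x -> node_dom D E st y -> node_dom D E st z ->
  node_lt (lob X) x y -> node_lt (lob X) y z -> node_lt (lob X) x z.
Proof.
move=> _ _ _; rewrite /node_lt.
case: (node_key x) (node_key y) (node_key z) =>
  [[[th1 i1] s1] q1] [[[th2 i2] s2] q2] [[[th3 i3] s3] q3].
move=> /orP[/exp2bP h1|/andP[/eqP-> h1]] /orP[/exp2bP h2|/andP[/eqP<- h2]].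
- by apply/orP; left; apply/exp2bP; exact: exp2_lt_trans h2.
- by apply/orP; left; apply/exp2bP.
- by apply/orP; left; apply/exp2bP.
- by apply/orP; right; rewrite eqxx /=; lia.
Qed.

Lemma node_lt_total x y : node_dom D E st x -> node_dom D E st y ->
  [\/ x = y, node_lt (lob X) x y | node_lt (lob X) y x].
Proof.
move=> /node_domP[ex dx _] /node_domP[ey dy _]; move: ex dx ey dy; rewrite /node_lt.
case: (node_key x) (node_key y) => [[[th1 i1] s1] q1] [[[th2 i2] s2] q2] /= <- dx <- dy.
case: (exp2_lt_total (fun a => descending_set dx) (fun a => descending_set dy)).
- move=> ->; case: (ltngtP i1 i2) => hi; [by constructor 2; rewrite eqxx ?orbT|
    by constructor 3; rewrite eqxx ?orbT|].
  case: (ltngtP s1 s2) => hs; [by constructor 3; rewrite eqxx /= ?orbT|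
    by constructor 2; rewrite eqxx /= ?orbT|].
  case: (ltngtP q1 q2) => hq; [by constructor 2; rewrite eqxx /= ?orbT|
    by constructor 3; rewrite eqxx /= ?orbT|].
  by constructor 1; rewrite hi hs hq.
- by move=> /exp2bP h; constructor 2; rewrite h.
- by move=> /exp2bP h; constructor 3; rewrite h.
Qed.

Definition node_order : linord := order_of node_lt_irr node_lt_trans node_lt_total.

Local Notation W := node_order.

Lemma node_ltP z z' : node_dom D E st z -> node_dom D E st z' ->
  node_lt (lob X) z z' -> lo_lt W z z'.
Proof. by move=> h1 h2 h3; apply/order_of_lt; split. Qed.

Lemma lt_node_node i i' s s' q q' : i < size (st s) -> i' < size (st s') ->
  exp2_lt X (theta D E st i s) (theta D E st i' s') \/
  theta D E st i s = theta D E st i' s' /\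
    (i < i' \/ i = i' /\ (nid st i' s' < nid st i s \/ nid st i s = nid st i' s' /\ q < q')) ->
  lo_lt W (node D E st i s q) (node D E st i' s' q').
Proof.
move=> hi hi' h; apply: node_ltP; try exact: node_dom_node.
rewrite /node_lt !node_keyK; case: h => [/exp2bP->//|[-> h]].
by rewrite eqxx /=; apply/orP; right; lia.
Qed.

Lemma stack_size s : 0 < size (st s).
Proof. by have := congr1 size (stack_head X d c0 s); rewrite size_take_min /=; lia. Qed.

Lemma last_level_lt s : last_level st s < size (st s).
Proof. by rewrite /last_level; have := stack_size s; lia. Qed.

Lemma place_pr s l : l <= last_level st s ->
  place D E st s (pr D (E (last_level st s)) l) = node D E st l s 0.
Proof.
move=> hl; rewrite /place; have [l' -> e] := lower_neighbour_pr hE hl.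
by rewrite e eqxx.
Qed.

(** Inside one block the last component increases with the variable, between blocks [theta]
    increases, and bottom nodes are lowest because every other [theta] is nonempty. *)
Lemma place_into s : into W (E (last_level st s)).1 (place D E st s).
Proof.
set k := last_level st s; have hk : k < size (st s) by exact: last_level_lt.
have dom u : node_dom D E st (place D E st s u).
  rewrite /place -/k; case: lower_neighbour => [l|]; last exact: node_dom_bottom.
  by apply: node_dom_node; have := ltn_ord l; lia.
split=> [u _|u u' uu' _]; first exact/order_of_set/dom.
apply: node_ltP => //; rewrite /place -/k.
have := lower_neighbourP D E k u; have := lower_neighbourP D E k u'.
case: lower_neighbour => [l' [h1' h2']|h']; case: lower_neighbour => [l [h1 h2]|h].
- have lk : l <= k by have := ltn_ord l; rewrite ltnS.
  have lk' : l' <= k by have := ltn_ord l'; rewrite ltnS.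
  have hll : pr D (E k) l <= pr D (E k) l' by apply: h2' => //; lia.
  case: (eqVneq (l : nat) l') => [e|ne].
    rewrite /node_lt !node_keyK e !eqxx !ltnn /=; apply/orP; right.
    have -> : (pr D (E k) l' == u') = false by move: h1; rewrite e; lia.
    by case: eqP => _; lia.
  have hx : xlt D E l l'.
    rewrite (xltE hE lk lk') ltn_neqAle hll andbT; apply: contra ne => /eqP h.
    apply/eqP; apply: (pr_inj (branch_full hE k)) h; exact: leq_ltn_trans (branch_size hE k).
  rewrite /node_lt !node_keyK; apply/orP; left; apply/exp2bP; apply: theta_mono hx; lia.
- rewrite /node_lt !node_keyK; apply/orP; left.
  have : theta D E st l' s != [::].
    rewrite -size_eq0 size_map size_filter -lt0n -has_count; apply/hasP.
    by exists (l' : nat); rewrite ?mem_iota ?xlt_irr //= add0n.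
  by case: (theta _ _ _ _ _).
- by exfalso; have := h' l; have := ltn_ord l; rewrite ltnS => lk /(_ lk); lia.
- by rewrite /node_lt !node_keyK !eqxx /=; lia.
Qed.

Lemma placed_term_dbar s : dbar_set D W (placed_term D E st s).
Proof. by apply: dbar_img; [exact: branch_full|exact: place_into]. Qed.

Lemma placed_term_eq s : st s.+1 = st s -> placed_term D E st s.+1 = placed_term D E st s.
Proof.
move=> e; rewrite /placed_term /last_level e; congr (_, img _ _).
apply/funext => u; rewrite /place /last_level e; case: lower_neighbour => // l.
by rewrite /node nidS e eqxx /theta e.
Qed.

(* At the first level [i] where the stacks differ, the node of level [i]
   moves to a later stage, hence down in [W]. *)
Lemma placed_term_lt s : st s.+1 <> st s ->
  dbar_lt D W (placed_term D E st s.+1) (placed_term D E st s).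
Proof.
move=> ne; have [|ne2 hmin] := @leastP (fun i => take i.+2 (st s.+1) <> take i.+2 (st s)).
  exists (size (st s.+1) + size (st s)) => h; apply: ne.
  by move: h; rewrite !take_oversize //; lia.
set i := least _ in ne2 hmin.
have hlow : take i.+1 (st s.+1) = take i.+1 (st s).
  case: i ne2 hmin => [|i] _ hmin; first by rewrite !stack_head.
  by apply: contrapT => /hmin; rewrite ltnn.
have is1 : i < size (st s.+1).
  rewrite ltnNge; apply/negP => h; apply: ne2; move: hlow.
  rewrite (take_oversize (n := i.+1)) ?(leqW h) // => e.
  have : size (st s) <= i by have := congr1 size e; rewrite size_take_min; lia.
  by move=> h'; move: e; rewrite !take_oversize //; lia.
have is0 : i < size (st s) by exact: size_take_lt is1.
have low l : l < i -> take l.+2 (st s.+1) = take l.+2 (st s).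
  by move=> li; apply: take_lower hlow.
set k := last_level st s; set k' := last_level st s.+1.
have ik : i <= k by rewrite /k /last_level; lia.
have ik' : i <= k' by rewrite /k' /last_level; lia.
have i0 := place_into s; have i1 := place_into s.+1.
have [|r hr] := @rank_exists W (img (E k).1 (place D E st s) `|` img (E k').1 (place D E st s.+1))%fset.
  move=> x; rewrite inE !mem_img => /orP[|] /mapP[u]; rewrite mem_iota add0n => hu ->.
    exact: i0.1.
  exact: i1.1.
have m0 u : u < (E k).1 -> place D E st s u \in
    (img (E k).1 (place D E st s) `|` img (E k').1 (place D E st s.+1))%fset.
  by move=> hu; rewrite inE !mem_img map_f ?mem_iota.
have m1 u : u < (E k').1 -> place D E st s.+1 u \in
    (img (E k).1 (place D E st s) `|` img (E k').1 (place D E st s.+1))%fset.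
  by move=> hu; rewrite inE orbC !mem_img map_f ?mem_iota.
have r0 : incr (E k).1 (fun u => r (place D E st s u)).
  by move=> u v uv hv; apply/hr; [exact/m0/(ltn_trans uv)|exact: m0|exact: i0.2].
have r1 : incr (E k').1 (fun u => r (place D E st s.+1 u)).
  by move=> u v uv hv; apply/hr; [exact/m1/(ltn_trans uv)|exact: m1|exact: i1.2].
apply: (dbar_ltI (branch_full hE k) (branch_full hE k') i0 i1 r0 r1).
  by move=> u v hu hv; rewrite !hr //; [exact: m1|exact: m0|exact: m0|exact: m1].
apply: (branch_gt hE ik ik' r0 r1).
  move=> l li; rewrite !place_pr; try by rewrite -/k -/k'; lia.
  rewrite /node nidS low // eqxx (theta_take D E (s' := s)) //.
  by apply: take_lower hlow; lia.
apply/hr.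
- by apply: m1; apply: pr_E_lt.
- by apply: m0; apply: pr_E_lt.
rewrite !place_pr //; apply: lt_node_node => //; right.
split; first exact: theta_take.
right; split=> //; left; rewrite nidS; case: eqP => // _.
by rewrite ltnS nid_le.
Qed.

(** The stacks grow beyond every length, and [E k] has more than [k] variables, so a constant term
    would have too few variables. *)
Lemma placed_term_not_constant N : ~ forall s, N <= s ->
  placed_term D E st s = placed_term D E st N.
Proof.
move=> h; pose m := #|` (placed_term D E st N).2|.
have [l [s0 [sl hs0]]] := stack_stable correct0 correct_below m.
have := h (maxn N s0) (leq_maxl _ _); have := hs0 (maxn N s0) (leq_maxr _ _).
set s := maxn N s0 => e1 e2.
have : (E (last_level st s)).1 = m.
  by rewrite /m -e2; have [-> _] := into_img (place_into s).
have := branch_size hE (last_level st s); have := congr1 size e1.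
by rewrite sl size_take_min /last_level; lia.
Qed.

(** Along a descending sequence the components stabilize one after the other: [theta] by
    well-foundedness of 2^X in [M], then the level. Afterwards the stage can only rise, and it is
    bounded because the relevant part of the stack stabilizes; the last component then descends in
    the natural numbers. *)
Lemma node_order_wf (M : omega_model) :
  (forall A, M A -> cont_at thin A -> M (thin A)) ->
  (forall F : nat -> nat, M (graph F) ->
     M (graph (fun i => CodeSeq.code (node_key (F i)).1.1.1))) ->
  well_founded_in M CodeSeq.code [set s | descending X s]%classic (exp2_lt X) ->
  well_order_in M W.
Proof.
move=> hthin hkey hwf [F [hset hlt MF]].
have hdom i : node_dom D E st (F i) by move/order_of_set: (hset i).
have hl i : node_lt (lob X) (F i.+1) (F i) by have /order_of_lt[] := hlt i.
pose th i := (node_key (F i)).1.1.1; pose lv i := (node_key (F i)).1.1.2.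
pose sg i := (node_key (F i)).1.2; pose q i := (node_key (F i)).2.
have {}hl i : exp2_lt X (th i.+1) (th i) \/ th i.+1 = th i /\
    (lv i.+1 < lv i \/ lv i.+1 = lv i /\ (sg i < sg i.+1 \/ sg i.+1 = sg i /\ q i.+1 < q i)).
  have := hl i; rewrite /node_lt /th /lv /sg /q.
  case: (node_key (F i)) (node_key (F i.+1)) => [[[? ?] ?] ?] [[[? ?] ?] ?] /=.
  by move=> /orP[/exp2bP|/andP[/eqP-> h]]; [left|right; split=> //; lia].
have [|||||N hN] := eventually_constant (F := th) hthin hwf.
- by move=> x y _ _; apply: (can_inj CodeSeq.codeK).
- by move=> x y z _ _ _; apply: exp2_lt_trans.
- by move=> i; case: (node_domP (hdom i)).
- by move=> i; case: (hl i) => [|[-> _]]; [right|left].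
- exact: hkey.
have {}hl i : lv (N + i.+1) < lv (N + i) \/ lv (N + i.+1) = lv (N + i) /\
    (sg (N + i) < sg (N + i.+1) \/ sg (N + i.+1) = sg (N + i) /\ q (N + i.+1) < q (N + i)).
  have := hl (N + i); rewrite -addnS (hN (N + i)) ?(hN (N + i.+1)) ?leq_addr //.
  by case=> [/exp2_lt_irr|[]].
have [|N1 hN1] := @nat_eventually_constant (fun i => lv (N + i)).
  by move=> i; have := hl i; lia.
have {}hl i : sg (N + (N1 + i)) < sg (N + (N1 + i.+1)) \/
    sg (N + (N1 + i.+1)) = sg (N + (N1 + i)) /\ q (N + (N1 + i.+1)) < q (N + (N1 + i)).
  have := hl (N1 + i); rewrite -addnS /= hN1 ?leq_addr // hN1 ?leq_addr // ltnn.
  by case=> [//|[_]].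
(* From [s0] on, the guesses relevant for the final level no longer change, so no node of that level
   carries a stage beyond [s0]. *)
have [l [s0 [_ hs0]]] := stack_stable correct0 correct_below (lv (N + N1)).+1.
have sg_le i : sg (N + (N1 + i)) <= s0.
  have e := hN1 (N1 + i) (leq_addr _ _).
  case: (node_domP (hdom (N + (N1 + i)))) => _ _ [h|h]; first by rewrite /sg h.
  rewrite leqNgt; apply/negP => hlt'.
  rewrite -/(lv (N + (N1 + i))) -/(sg (N + (N1 + i))) e in h.
  have e2 : nid st (lv (N + N1)) (sg (N + (N1 + i))) = nid st (lv (N + N1)) s0.
    by apply: nid_stable; [move=> s hs; rewrite !hs0|exact: ltnW].
  by have := nid_le st (lv (N + N1)) s0; rewrite -e2 h leqNgt hlt'.
have [|N2 hN2] := @nat_eventually_constant (fun i => s0 - sg (N + (N1 + i))).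
  by move=> i; have := hl i; lia.
have {}hl i : q (N + (N1 + (N2 + i.+1))) < q (N + (N1 + (N2 + i))).
  have := hl (N2 + i); have h1 := hN2 (N2 + i) (leq_addr _ _).
  have h2 := hN2 (N2 + i.+1) (leq_addr _ _).
  have h3 := sg_le (N2 + i); have h4 := sg_le (N2 + i.+1); have h5 := sg_le N2.
  by rewrite -addnS; lia.
have [|N3 hN3] := @nat_eventually_constant (fun i => q (N + (N1 + (N2 + i)))).
  by move=> i; apply: ltnW.
by have := hl N3; have := hN3 N3.+1 (leqnSn _); lia.
Qed.

End NodeOrder.

(** * Continuity of the stacks and nodes in the order and the matrix *)

Definition rel_of (A : set nat) : rel nat := pair_rel (left A).

Definition refutes (A : set nat) (m n x : nat) : bool :=
  `[< right A (triple_code m n x) >].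

Definition stack_of (c0 : nat) (A : set nat) : nat -> seq nat :=
  stack (rel_of A) (refutes A) c0.

Lemma fin_det_blt x y A : fin_det (fun A' => blt (rel_of A') x y) A.
Proof.
exact: (fin_det_map (fun P => `[< P >] && (x != y)) (fin_det_bit _ A)).
Qed.

Lemma fin_det_has (l : seq nat) (H : nat -> set nat -> bool) A :
  (forall i, fin_det (H i) A) -> fin_det (fun A' => has (fun i => H i A') l) A.
Proof.
move=> h; elim: l => [|i l ih]; first exact: fin_det_const.
exact: (fin_det_map2 orb).
Qed.

Lemma fin_det_standing s c A : fin_det (fun A' => standing (rel_of A') (refutes A') s c) A.
Proof.
apply: (fin_det_map2 andb); first exact: (fin_det_map asbool (fin_det_bit _ A)).
apply: (fin_det_map negb); apply: (@fin_det_has _ (fun m A' => refutes A' m _ _)) => m.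
exact: (fin_det_map asbool (fin_det_bit _ A)).
Qed.

Lemma fin_det_grow s n c A : fin_det (fun A' => grow (rel_of A') (refutes A') s n c) A.
Proof.
elim: n c => [|n ih] c /=; first exact: fin_det_const.
apply: (fin_det_map (cons c)).
apply: (fin_det_bind (G := fun A' => next_guess (rel_of A') (refutes A') s c)
  (H := fun o A' => if o is Some c' then grow (rel_of A') (refutes A') s n c' else [::])).
  apply: (fin_det_map ohead); apply: (@fin_det_filter _ _
    (fun c' A' => blt (rel_of A') _ _ && standing (rel_of A') (refutes A') s c')) => c' _.
  by apply: (fin_det_map2 andb); [exact: fin_det_blt|exact: fin_det_standing].
by case: next_guess => // ; exact: fin_det_const.
Qed.

(** A finite history uses finitely many bits of [A], since each stage of the stack is a bounded
    search. *)
Lemma fin_det_history T c0 n (H : (nat -> seq nat) -> T) A :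
  (forall st st', (forall s, s <= n -> st s = st' s) -> H st = H st') ->
  fin_det (fun A' => H (stack_of c0 A')) A.
Proof.
move=> hH.
have [b hb] := @fin_det_seq _ _ (iota 0 n.+1) (fun s A' => stack_of c0 A' s) A
  (fun s _ => fin_det_grow s s c0 A).
exists b => A' /hb /eq_in_map e; apply: hH => s hs.
by apply: e; rewrite mem_iota.
Qed.

Lemma fin_det_exp2b s t A : fin_det (fun A' => exp2b (rel_of A') s t) A.
Proof.
elim: s t => [|x s ih] [|y t] /=; try exact: fin_det_const.
apply: (fin_det_map2 (fun a b => a || (x == y) && b)); first exact: fin_det_blt.
exact: ih.
Qed.

Lemma fin_det_node_lt z z' A : fin_det (fun A' => node_lt (rel_of A') z z') A.
Proof.
rewrite /node_lt; case: (node_key z) (node_key z') => [[[? ?] ?] ?] [[[? ?] ?] ?].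
exact: (fin_det_map (fun a => a || _) (fin_det_exp2b _ _ A)).
Qed.

(** * A branch yields the second alternative *)

Section TransfiniteInduction.

Variables (D : predilator) (E : nat -> nat * nat) (hE : branch D E).

(** [Y] is chosen before the model, so the operators depend on the branch and on a first guess [c0],
    which ranges over all numbers; the order, the formula and its parameters enter through the
    argument [A]. *)
Definition node_operator (e : nat * nat) (A : set nat) : set nat :=
  match e with
  | (0, _) => thin A
  | (1, _) => graph (fun i => CodeSeq.code (node_key (val_at A i)).1.1.1)
  | (2, c0) => rel_code (strict_le (node_dom D E (stack_of c0 A)) (node_lt (rel_of A)))
  | (_, c0) => graph (fun s => dbar_elt_code (placed_term D E (stack_of c0 A) s))
  end.

Lemma cont_at_node_operator1 c F : cont_at (node_operator (1, c)) (graph F).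
Proof.
apply: (cont_at_graph (Z := fun A i => CodeSeq.code (node_key (val_at A i)).1.1.1)) => i.
exact: (fin_det_map (fun z => CodeSeq.code (node_key z).1.1.1) (fin_det_val_at F i)).
Qed.

Lemma cont_at_node_operator2 c0 A : cont_at (node_operator (2, c0)) A.
Proof.
apply: (cont_at_rel_code (R := fun A =>
  strict_le (node_dom D E (stack_of c0 A)) (node_lt (rel_of A)))) => x y.
have hd z : fin_det (fun A' => node_dom D E (stack_of c0 A') z) A.
  apply: (@fin_det_history _ c0 (node_key z).1.2 (fun st => node_dom D E st z)) => st st' e.
  exact: (node_dom_ext _ _ e (leqnn _)).
pose h (a b c : bool) : Prop := [/\ a, b & x = y \/ c].
exact: (fin_det_bind (H := fun a A' => h a _ _) (hd x)
  (fin_det_map2 (h _) (hd y) (fin_det_node_lt x y A))).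
Qed.

Lemma cont_at_node_operator3 c0 A : cont_at (node_operator (3, c0)) A.
Proof.
apply: (cont_at_graph (Z := fun A s => dbar_elt_code (placed_term D E (stack_of c0 A) s))) => s.
apply: (@fin_det_history _ c0 s
  (fun st => dbar_elt_code (placed_term D E st s))) => st st' e.
by congr dbar_elt_code; exact: placed_term_ext.
Qed.

Lemma branch_pi02_TI_star : omega_entails RCA0 [:: predilator_code D]
  (fun M => dilator_in M D -> pi02_TI_star M).
Proof.
exists (oracle node_operator) => M hM _ MY hdil X MX hwf p S v hp MS hprog x0 hx0.
apply: contrapT => hx0p.
have closed := oracle_closed hM MY.
case: p hp hprog hx0p => // -[] // p hp hprog hx0p.
have [B MB hB] := matrix_closed v hM MS hp.
pose A := join (lo_code X) B; have MA : M A by exact: join_closed.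
have erel : rel_of A = lob X by rewrite /rel_of left_join pair_rel_lo_code.
pose d := refutes A.
have hd m n x : d m n x <-> sat S (scons m (scons n (scons x v))) p.
  by rewrite /d /refutes right_join hB; split=> /asboolP.
have wrong x : lo_set X x -> ~ sat S (scons x v) (All (Ex p)) ->
    exists2 c, correct X d c & guess_val c = x.
  move=> hx hn; have [n hn'] : exists n, forall m, ~~ d m n x.
    apply: contrapT => h; apply: hn => n; apply: contrapT => hm; apply: h.
    by exists n => m; apply/negP => /hd hm'; apply: hm; exists m.
  by exists (choice.pickle (x, n)); rewrite /correct /guess_val /guess_wit !lex_keyK.
have below c : correct X d c -> exists2 c', correct X d c' & lo_lt X (guess_val c') (guess_val c).
  move=> [hc hcd]; apply: contrapT => hno.
  have : sat S (scons (guess_val c) v) (All (Ex p)).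
    apply: hprog => // y hy; apply: contrapT => hn.
    have [c' h1 h2] := wrong y (lo_lt_set hy).1 hn.
    by apply: hno; exists c' => //; rewrite h2.
  by move=> /(_ (guess_wit c)) [m /hd]; apply/negP.
have [c0 hc0 _] := wrong x0 hx0 hx0p.
have hthin A' : M A' -> cont_at thin A' -> M (thin A').
  by move=> MA'; exact: (closed (0, 0)).
pose W := node_order D E hc0.
have est : stack_of c0 A = stack (lob X) d c0 by rewrite /stack_of erel.
have MW : M (lo_code W).
  have := closed (2, c0) A MA (cont_at_node_operator2 c0 A).
  by rewrite /node_operator erel est.
have hW : well_order_in M W.
  apply: (node_order_wf below hthin) => //.
  move=> F MF; have := closed (1, 0) _ MF (cont_at_node_operator1 0 F).
  rewrite /node_operator; congr (M (graph _)).
  by apply/funext => i; rewrite val_at_graph.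
have hDW := hdil W MW hW.
have [|||||N hN] := eventually_constant
  (F := placed_term D E (stack (lob X) d c0)) hthin hDW; last first.
- exact: (placed_term_not_constant hE hc0 below hN).
- have := closed (3, c0) A MA (cont_at_node_operator3 c0 A).
  by rewrite /node_operator est.
- move=> s; case: (pselect (stack (lob X) d c0 s.+1 = stack (lob X) d c0 s)) => h.
    by left; exact: placed_term_eq.
  by right; exact: placed_term_lt.
- by move=> s; exact: placed_term_dbar.
- by move=> ? ? ?; exact: dbar_lt_trans.
- by move=> ? ? _ _; exact: dbar_elt_code_inj.
Qed.

End TransfiniteInduction.

(** * Failure of the first alternative yields a branch *)

Section FailureOfFirst.

Variable D : predilator.

Definition priority_operator (e : option (nat * nat)) (A : set nat) : set nat :=
  if e is Some (k, N) then graph (priority_value D k N A) else thin A.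

(** By contraposition: if there is no branch, [oracle priority_operator] witnesses the first
    alternative, since a descending sequence in a model that contains it would yield a branch. *)
Lemma not_entailed_branch : dilator D ->
  ~ omega_entails RCA0 [:: predilator_code D] (fun M => dilator_in M D) ->
  exists E, branch D E.
Proof.
move=> hD hno; apply: contrapT => hnb; apply: hno.
exists (oracle priority_operator) => M hM _ MY X MX hX [F [hF hdesc MF]].
have closed := oracle_closed hM MY.
apply: hnb; apply: (@branch_exists D M X F) => // [A MA|k N].
  exact: (closed None).
have MJ : M (join (lo_code X) (graph (fun i => dbar_elt_code (F i)))) by exact: join_closed.
have := closed (Some (k, N)) _ MJ (cont_at_priority_value D k N _ _).
rewrite /priority_operator; congr (M (graph _)).
by apply/funext => i; rewrite priority_valueE.
Qed.

End FailureOfFirst.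

(** * A countable Turing ideal over a generic set *)

(** Trees serve to make formulas countable, so that operators defined from formulas can be
    numbered. *)
Fixpoint tree_of_term (t : term) : GenTree.tree nat :=
  match t with
  | Var i => GenTree.Leaf i
  | Zero => GenTree.Node 0 [::]
  | One => GenTree.Node 1 [::]
  | Add s t => GenTree.Node 2 [:: tree_of_term s; tree_of_term t]
  | Mul s t => GenTree.Node 3 [:: tree_of_term s; tree_of_term t]
  end.

Fixpoint term_of_tree (t : GenTree.tree nat) : term :=
  match t with
  | GenTree.Leaf i => Var i
  | GenTree.Node 0 _ => Zero
  | GenTree.Node 2 [:: s; t] => Add (term_of_tree s) (term_of_tree t)
  | GenTree.Node 3 [:: s; t] => Mul (term_of_tree s) (term_of_tree t)
  | _ => One
  end.

Lemma tree_of_termK : cancel tree_of_term term_of_tree.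
Proof. by elim=> //= [s -> t ->|s -> t ->]. Qed.

Fixpoint tree_of_form (p : form) : GenTree.tree nat :=
  match p with
  | Eq s t => GenTree.Node 0 [:: tree_of_term s; tree_of_term t]
  | Lt s t => GenTree.Node 1 [:: tree_of_term s; tree_of_term t]
  | Defs.Mem t i => GenTree.Node 2 [:: tree_of_term t; GenTree.Leaf i]
  | Not p => GenTree.Node 3 [:: tree_of_form p]
  | And p q => GenTree.Node 4 [:: tree_of_form p; tree_of_form q]
  | Or p q => GenTree.Node 5 [:: tree_of_form p; tree_of_form q]
  | Imp p q => GenTree.Node 6 [:: tree_of_form p; tree_of_form q]
  | BAll t p => GenTree.Node 7 [:: tree_of_term t; tree_of_form p]
  | BEx t p => GenTree.Node 8 [:: tree_of_term t; tree_of_form p]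
  | All p => GenTree.Node 9 [:: tree_of_form p]
  | Ex p => GenTree.Node 10 [:: tree_of_form p]
  end.

Fixpoint form_of_tree (t : GenTree.tree nat) : form :=
  match t with
  | GenTree.Node 0 [:: s; t] => Eq (term_of_tree s) (term_of_tree t)
  | GenTree.Node 1 [:: s; t] => Lt (term_of_tree s) (term_of_tree t)
  | GenTree.Node 2 [:: s; GenTree.Leaf i] => Defs.Mem (term_of_tree s) i
  | GenTree.Node 3 [:: p] => Not (form_of_tree p)
  | GenTree.Node 4 [:: p; q] => And (form_of_tree p) (form_of_tree q)
  | GenTree.Node 5 [:: p; q] => Or (form_of_tree p) (form_of_tree q)
  | GenTree.Node 6 [:: p; q] => Imp (form_of_tree p) (form_of_tree q)
  | GenTree.Node 7 [:: t; p] => BAll (term_of_tree t) (form_of_tree p)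
  | GenTree.Node 8 [:: t; p] => BEx (term_of_tree t) (form_of_tree p)
  | GenTree.Node 9 [:: p] => All (form_of_tree p)
  | GenTree.Node 10 [:: p] => Ex (form_of_tree p)
  | _ => Eq Zero Zero
  end.

Lemma tree_of_formK : cancel tree_of_form form_of_tree.
Proof.
by elim=> /= [s t|s t|t i|p ->|p -> q ->|p -> q ->|p -> q ->|t p ->|t p ->|p ->|p ->];
  rewrite ?tree_of_termK.
Qed.

Lemma eval_local t : exists N, forall v v', (forall i, i < N -> v i = v' i) ->
  eval v t = eval v' t.
Proof.
elim: t => [i|||s [N hN] t [K hK]|s [N hN] t [K hK]] /=; try by exists 0.
- by exists i.+1 => v v' h; apply: h.
- by exists (maxn N K) => v v' h; rewrite (hN v v') ?(hK v v') // => i hi; apply: h; lia.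
- by exists (maxn N K) => v v' h; rewrite (hN v v') ?(hK v v') // => i hi; apply: h; lia.
Qed.

Definition agree_upto (N : nat) (S S' : nat -> set nat) (v v' : nat -> nat) : Prop :=
  (forall i, i < N -> S i = S' i) /\ (forall i, i < N -> v i = v' i).

(** Only finitely many parameters matter, which allows an instance of comprehension to have a finite
    code. *)
Lemma sat_local p : exists N, forall S S' v v', agree_upto N S S' v v' ->
  sat S v p = sat S' v' p.
Proof.
have mono N K S S' v v' : N <= K -> agree_upto K S S' v v' -> agree_upto N S S' v v'.
  by move=> NK [h1 h2]; split=> i hi; [apply: h1|apply: h2]; lia.
have cons N S S' v v' x : agree_upto N S S' v v' -> agree_upto N S S' (scons x v) (scons x v').
  by move=> [h1 h2]; split=> // -[|i] hi //=; apply: h2; lia.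
elim: p => [s t|s t|t i|p [N hN]|p [N hN] q [K hK]|p [N hN] q [K hK]|p [N hN] q [K hK]|
    t p [N hN]|t p [N hN]|p [N hN]|p [N hN]] /=.
- have [A hA] := eval_local s; have [B hB] := eval_local t.
  by exists (maxn A B) => S S' v v' [_ h]; rewrite (hA v v') ?(hB v v') // => i hi; apply: h; lia.
- have [A hA] := eval_local s; have [B hB] := eval_local t.
  by exists (maxn A B) => S S' v v' [_ h]; rewrite (hA v v') ?(hB v v') // => i hi; apply: h; lia.
- have [A hA] := eval_local t; exists (maxn A i.+1) => S S' v v' [h1 h2].
  by rewrite (hA v v') ?h1 //; [lia|move=> j hj; apply: h2; lia].
- by exists N => S S' v v' /hN ->.
- exists (maxn N K) => S S' v v' h.
  by rewrite (hN _ S' _ v') ?(hK _ S' _ v') //; apply: mono h; lia.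
- exists (maxn N K) => S S' v v' h.
  by rewrite (hN _ S' _ v') ?(hK _ S' _ v') //; apply: mono h; lia.
- exists (maxn N K) => S S' v v' h.
  by rewrite (hN _ S' _ v') ?(hK _ S' _ v') //; apply: mono h; lia.
- have [A hA] := eval_local t; exists (maxn A N) => S S' v v' h.
  have hx x : sat S (scons x v) p = sat S' (scons x v') p.
    by apply: hN; apply: cons; apply: mono h; lia.
  rewrite (hA v v') => [|i hi]; last by case: h => _; apply; lia.
  by apply: propext; split=> h' x /h'; rewrite hx.
- have [A hA] := eval_local t; exists (maxn A N) => S S' v v' h.
  have hx x : sat S (scons x v) p = sat S' (scons x v') p.
    by apply: hN; apply: cons; apply: mono h; lia.
  rewrite (hA v v') => [|i hi]; last by case: h => _; apply; lia.
  by apply: propext; split=> -[x [h1 h2]]; exists x; split=> //; move: h2; rewrite hx.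
- exists N => S S' v v' h.
  have hx x : sat S (scons x v) p = sat S' (scons x v') p by apply: hN; apply: cons.
  by apply: propext; split=> h' x; have := h' x; rewrite hx.
- exists N => S S' v v' h.
  have hx x : sat S (scons x v) p = sat S' (scons x v') p by apply: hN; apply: cons.
  by apply: propext; split=> -[x h']; exists x; move: h'; rewrite hx.
Qed.

Lemma fin_det_sat (Fam : nat -> set nat -> set nat) p A : delta00 p ->
  (forall i, cont_at (Fam i) A) ->
  forall v, fin_det (fun A' => sat (fun i => Fam i A') v p) A.
Proof.
move=> hp hF; elim: p hp => //= [s t|s t|t i|p ih|p ihp q ihq|p ihp q ihq|p ihp q ihq|t p ih|t p ih].
- by move=> _ v; exact: fin_det_const.
- by move=> _ v; exact: fin_det_const.
- by move=> _ v; exact: hF.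
- by move=> hp v; apply: fin_det_not; exact: ih.
- by move=> /andP[/ihp h1 /ihq h2] v; apply: (fin_det_map2 and).
- by move=> /andP[/ihp h1 /ihq h2] v; apply: (fin_det_map2 or).
- by move=> /andP[/ihp h1 /ihq h2] v; apply: (fin_det_map2 (fun P Q : Prop => P -> Q)).
- move=> hp v; apply: (@fin_det_forall_lt _ (fun x A' => sat (fun i => Fam i A') (scons x v) p)) => x _.
  exact: ih.
- move=> hp v; apply: (@fin_det_exists_lt _ (fun x A' => sat (fun i => Fam i A') (scons x v) p)) => x _.
  exact: ih.
Qed.

(* At an argument where [Ex p] and [All q] are equivalent, this is a continuous
   version of the set they define: one searches for a witness of [Ex p] and
   for a counterexample to [All q] at the same time. *)
Definition comprehension_op (p q : form) (Fam : nat -> set nat -> set nat) (v : nat -> nat)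
    (A : set nat) : set nat := fun n =>
  exists m, sat (fun i => Fam i A) (scons m (scons n v)) p /\
    forall m', m' < m -> sat (fun i => Fam i A) (scons m' (scons n v)) q.

Lemma comprehension_opP p q Fam v A : delta00 p -> delta00 q ->
  (forall i, cont_at (Fam i) A) ->
  (forall n, sat (fun i => Fam i A) (scons n v) (Ex p) <->
             sat (fun i => Fam i A) (scons n v) (All q)) ->
  cont_at (comprehension_op p q Fam v) A /\
  forall n, comprehension_op p q Fam v A n <-> sat (fun i => Fam i A) (scons n v) (Ex p).
Proof.
move=> hp hq hF heq; pose P A' m n := sat (fun i => Fam i A') (scons m (scons n v)) p.
pose Q A' m n := sat (fun i => Fam i A') (scons m (scons n v)) q.
have dP m n : fin_det (fun A' => P A' m n) A by exact: fin_det_sat.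
have dQ m n : fin_det (fun A' => Q A' m n) A by exact: fin_det_sat.
have hval n : comprehension_op p q Fam v A n <-> sat (fun i => Fam i A) (scons n v) (Ex p).
  split=> [[m [h _]]|h]; first by exists m.
  by have [m hm] := h; exists m; split=> // m' _; exact: (heq n).1 h m'.
split=> // n; case: (pselect (comprehension_op p q Fam v A n)) => hn.
  have [m [hm1 hm2]] := hn.
  have [b hb] := fin_det_map2 (fun X Y : Prop => X /\ Y) (dP m n)
    (@fin_det_forall_lt m (fun m' A' => Q A' m' n) A (fun m' _ => dQ m' n)).
  exists b => A' /hb e; apply: propext; split=> // _; exists m.
  by move: (conj hm1 hm2 : P A m n /\ (forall m', m' < m -> Q A m' n)); rewrite -e.
(* A counterexample [m0] to [q] rules out every candidate [m > m0] by the guard, so the absence of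
   [n] rests on finitely many bounded facts. *)
have [m0 hm0] : exists m0, ~ Q A m0 n.
  apply: contrapT => h; apply: hn; apply/hval/heq => m; apply: contrapT => h'.
  by apply: h; exists m.
have hnP m : ~ P A m n by move=> h; apply: hn; apply/hval; exists m.
have [b hb] := fin_det_map2 (fun X Y : Prop => X /\ Y) (fin_det_not (dQ m0 n))
  (@fin_det_forall_lt m0.+1 (fun m A' => ~ P A' m n) A (fun m _ => fin_det_not (dP m n))).
exists b => A' /hb e; apply: propext; split=> // -[m [h1 h2]]; exfalso.
have [k1 k2] : ~ Q A' m0 n /\ (forall m, m < m0.+1 -> ~ P A' m n).
  by rewrite e; split=> // m' _; exact: hnP.
case: (ltnP m0 m) => hm; first by apply: k1; exact: h2.
exact: (k2 m hm h1).
Qed.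

Section Ideal.

Variable Z : nat -> set nat.

Definition op_code : Type := nat + (GenTree.tree nat * GenTree.tree nat * seq nat * seq nat).

(* The operators of rank [n]; an operator defined by comprehension is coded by
   the two formulas, the operators for its set parameters, and its number
   parameters. *)
Fixpoint ideal_op (n k : nat) : set nat -> set nat :=
  match n with
  | 0 => if k is k'.+1 then fun _ => Z k' else id
  | n'.+1 =>
    match choice.unpickle k : option op_code with
    | Some (inl k') => ideal_op n' k'
    | Some (inr (tp, tq, l, vl)) => comprehension_op (form_of_tree tp) (form_of_tree tq)
        (fun i => if i < size l then ideal_op n' (nth 0 l i) else id) (nth 0 vl)
    | None => id
    end
  end.

Lemma ideal_opS n (c : op_code) : ideal_op n.+1 (choice.pickle c) =
  match c with
  | inl k => ideal_op n k
  | inr (tp, tq, l, vl) => comprehension_op (form_of_tree tp) (form_of_tree tq)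
      (fun i => if i < size l then ideal_op n (nth 0 l i) else id) (nth 0 vl)
  end.
Proof. by rewrite {1}/ideal_op choice.pickleK; case: c. Qed.

(** Elements are values at [G] of countably many named operators, restricted to names that are
    continuous at [G]. Meeting requirements for the names therefore controls the whole model. *)
Definition ideal (G : set nat) : omega_model := fun A =>
  exists n k, cont_at (ideal_op n k) G /\ A = ideal_op n k G.

Lemma ideal_generator G : ideal G G.
Proof. by exists 0, 0; split=> // n; exact: fin_det_bit. Qed.

Lemma ideal_parameter G k : ideal G (Z k).
Proof. by exists 0, k.+1; split=> // n; exact: fin_det_const. Qed.

Lemma ideal_op_lift n n' k : n <= n' -> exists k', ideal_op n' k' = ideal_op n k.
Proof.
move=> /subnK <-; elim: (n' - n) => [|m [k' ih]]; first by exists k.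
by exists (choice.pickle (inl k' : op_code)); rewrite addSn ideal_opS.
Qed.

(** Induction is true because the numbers are standard. For comprehension, names of the finitely
    many relevant parameters are lifted to a common rank [L], and [comprehension_op] names the new
    set one rank higher. *)
Lemma ideal_RCA0 G : RCA0 (ideal G).
Proof.
split=> [p S v _ _ h0 hS|]; first by elim.
move=> [] // p [] // q S v hp hq MS heq.
have [n hn] := choice MS; have [k hk] := choice hn.
have [N1 hN1] := sat_local p; have [N2 hN2] := sat_local q.
pose N := maxn N1 N2; pose L := \max_(i < N) n i.
have hlift i : exists k', i < N -> ideal_op L k' = ideal_op (n i) (k i).
  case: (ltnP i N) => hi; last by exists 0.
  have [|k' ek] := @ideal_op_lift (n i) L (k i); last by exists k'.
  exact: (leq_bigmax_cond (F := fun i : 'I_N => n i) (P := xpredT) (Ordinal hi) isT).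
have [g hg] := choice hlift; pose l := mkseq g N; pose vl := mkseq v N.
pose Fam i := if i < size l then ideal_op L (nth 0 l i) else id.
have hFam i : i < N -> Fam i = ideal_op (n i) (k i).
  by move=> hi; rewrite /Fam size_mkseq hi nth_mkseq // hg.
have cF i : cont_at (Fam i) G.
  case: (ltnP i N) => hi; first by rewrite hFam //; case: (hk i).
  by rewrite /Fam size_mkseq ltnNge hi => m; exact: fin_det_bit.
have ag K m c : K <= N -> agree_upto K (fun i => Fam i G) S
    (scons m (scons c (nth 0 vl))) (scons m (scons c v)).
  move=> KN; split=> i hi; first by rewrite hFam; [case: (hk i)|lia].
  by case: i hi => [|[|i]] //= hi; rewrite nth_mkseq //; lia.
have eP m c : sat (fun i => Fam i G) (scons m (scons c (nth 0 vl))) p =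
    sat S (scons m (scons c v)) p by apply: hN1; apply: ag; rewrite /N; lia.
have eQ m c : sat (fun i => Fam i G) (scons m (scons c (nth 0 vl))) q =
    sat S (scons m (scons c v)) q by apply: hN2; apply: ag; rewrite /N; lia.
have eEx c : sat (fun i => Fam i G) (scons c (nth 0 vl)) (Ex p) = sat S (scons c v) (Ex p).
  by apply: propext; split=> /= -[m h]; exists m; move: h; rewrite eP.
have eAll c : sat (fun i => Fam i G) (scons c (nth 0 vl)) (All q) = sat S (scons c v) (All q).
  by apply: propext; split=> /= h m; have := h m; rewrite eQ.
have [|hc hv] := @comprehension_opP p q Fam (nth 0 vl) G hp hq cF.
  by move=> c; rewrite eEx eAll.
exists (comprehension_op p q Fam (nth 0 vl) G); split; last by move=> c; rewrite hv eEx.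
exists L.+1, (choice.pickle (inr (tree_of_form p, tree_of_form q, l, vl) : op_code)).
by rewrite ideal_opS !tree_of_formK.
Qed.

End Ideal.

(** * A generic order of type omega + omega^* *)

(* A condition [(ls, rs)] describes the orders on all of [nat] in which [ls] is
   an initial and [rs] a final segment. *)
Definition compatible (X : linord) (ls rs : seq nat) : Prop :=
  [/\ forall x, lo_set X x, pairwise (blt (lob X)) ls, pairwise (blt (lob X)) rs,
      forall x z, x \in ls -> z \notin ls -> lo_lt X x z
    & forall y z, y \in rs -> z \notin rs -> lo_lt X z y].

Lemma blt_trans X : transitive (blt (lob X)).
Proof. by move=> y x z /bltP h1 /bltP h2; apply/bltP; apply: lo_lt_trans h2. Qed.

Lemma pairwise_index_lt X s x y : pairwise (blt (lob X)) s -> x \in s -> y \in s ->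
  lo_lt X x y <-> index x s < index y s.
Proof.
move=> hs; have hlt u w : u \in s -> w \in s -> index u s < index w s -> lo_lt X u w.
  move=> hu hw h; apply/bltP; move: hs; rewrite -(sorted_pairwise (@blt_trans X)) => hs.
  have := sorted_ltn_nth (@blt_trans X) 0 hs.
  by move=> /(_ (index u s) (index w s)); rewrite !inE !index_mem !nth_index //; apply.
move=> hx hy; split=> [h|]; last exact: hlt.
case: (ltngtP (index x s) (index y s)) => // [/(hlt _ _ hy hx)|e].
  by move=> /lo_ltN; case: h.
have exy : x = y by rewrite -(nth_index 0 hx) e nth_index.
by subst y; case: (lo_lt_irr h).
Qed.

Lemma pairwise_index X s x y : (forall x, lo_set X x) -> pairwise (blt (lob X)) s ->
  x \in s -> y \in s -> X x y <-> index x s <= index y s.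
Proof.
move=> hX hs hx hy; rewrite leqNgt; split=> [h|/negP h].
  by apply/negP => /(pairwise_index_lt hs hy hx)/lo_ltN.
case: (lo_trichotomy (hX x) (hX y)) => [[]//|<-|/(pairwise_index_lt hs hy hx)//].
exact: hX.
Qed.

Lemma compatible_pairwise X ls rs : compatible X ls rs -> uniq (ls ++ rs) ->
  pairwise (blt (lob X)) (ls ++ rs).
Proof.
move=> [_ hl hr hls _] hu; rewrite pairwise_cat hl hr !andbT.
apply/allrelP => x y hx hy; apply/bltP; apply: hls => //.
by move: hu; rewrite cat_uniq => /and3P[_ /hasPn/(_ y hy)].
Qed.

Lemma compatible_sub X ls ls' rs' rs : compatible X (ls ++ ls') (rs' ++ rs) ->
  uniq ((ls ++ ls') ++ (rs' ++ rs)) -> compatible X ls rs.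
Proof.
move=> [hX hl hr hls hrs]; rewrite cat_uniq => /and3P[ul _ ur].
move: hl hr ul ur; rewrite !pairwise_cat !cat_uniq => /and3P[a1 a2 a3] /and3P[b1 b2 b3].
move=> /and3P[_ ul _] /and3P[_ ur _].
split=> // [x z hx hz|y z hy hz].
  case: (boolP (z \in ls')) => hz'; first by apply/bltP; apply: (allrelP a1).
  by apply: hls; rewrite mem_cat ?hx // negb_or hz.
case: (boolP (z \in rs')) => hz'; first by apply/bltP; apply: (allrelP b1).
by apply: hrs; rewrite mem_cat ?hy ?orbT // negb_or hz hz'.
Qed.

(* Reads a descending sequence, restricted to the increasing list [A], as a
   binary numeral. *)
Definition numeral (A t : seq nat) : nat :=
  foldr (fun x n => (if x \in A then 2 ^ index x A else 0) + n) 0 t.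

Section Numerals.

Variables (X : linord) (ls rs : seq nat).
Hypothesis hc : compatible X ls rs.
Hypothesis hu : uniq (ls ++ rs).

Lemma descending_lt x t z : descending X (x :: t) -> z \in t -> lo_lt X z x.
Proof.
elim: t x => //= y t ih x [hx yx hd]; rewrite inE => /orP[/eqP->//|hz].
by apply: lo_lt_trans yx; apply: ih.
Qed.

Lemma descending_behead x t : descending X (x :: t) -> descending X t.
Proof. by case. Qed.

(** A descending sequence uses each binary place at most once, and only places below [a]. *)
Lemma numeral_lt A t a : pairwise (blt (lob X)) A -> descending X t ->
  (forall x, x \in t -> x \in A -> index x A < a) -> numeral A t < 2 ^ a.
Proof.
move=> hA; elim: t a => [|x t ih] a hd ha /=; first by rewrite expn_gt0.
have hdt := descending_behead hd.
case: (boolP (x \in A)) => hx; last first.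
  by rewrite add0n; apply: ih => // y hy; apply: ha; rewrite inE hy orbT.
have : numeral A t < 2 ^ index x A.
  apply: ih => // y hy hyA; apply/(pairwise_index_lt hA hyA hx).
  exact: descending_lt hy.
have : 2 ^ (index x A).+1 <= 2 ^ a.
  by rewrite leq_exp2l //; apply: ha => //; rewrite inE eqxx.
by rewrite expnS; lia.
Qed.

Lemma numeral_eq0 A t : (forall x, x \in t -> x \notin A) -> numeral A t = 0.
Proof.
elim: t => //= x t ih h; have /negbTE-> : x \notin A by apply: h; rewrite inE eqxx.
by rewrite add0n; apply: ih => y hy; apply: h; rewrite inE hy orbT.
Qed.

Lemma below_notin_rs x y : lo_lt X x y -> y \notin rs -> x \notin rs.
Proof.
case: hc => _ _ _ _ hrs xy hy; apply/negP => hx.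
exact: lo_ltN (hrs _ _ hx hy) xy.1.
Qed.

Lemma below_ls x y : lo_lt X x y -> y \in ls -> x \in ls.
Proof.
case: hc => _ _ _ hls _ [xy _] hy; apply: contrapT => /negP hx.
exact: lo_ltN (hls _ _ hy hx) xy.
Qed.

Lemma ls_notin_rs x : x \in ls -> x \notin rs.
Proof.
move=> hx; apply/negP => hx'; move: hu; rewrite cat_uniq => /and3P[_ /hasPn/(_ x hx')].
by rewrite /= hx.
Qed.

Lemma pairwise_ls : pairwise (blt (lob X)) ls. Proof. by case: hc. Qed.
Lemma pairwise_rs : pairwise (blt (lob X)) rs. Proof. by case: hc. Qed.

Lemma head_below x y t z : lo_lt X x y -> descending X (x :: t) -> z \in x :: t -> lo_lt X z y.
Proof.
move=> xy hd; rewrite inE => /orP[/eqP->//|hz].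
exact: lo_lt_trans (descending_lt hd hz) xy.
Qed.

Lemma numeral_below A x y t : pairwise (blt (lob X)) A -> y \in A -> lo_lt X x y ->
  descending X (x :: t) -> numeral A (x :: t) < 2 ^ index y A.
Proof.
move=> hA hy xy hd; apply: numeral_lt => // z hz hzA.
by apply/(pairwise_index_lt hA hzA hy); exact: head_below hz.
Qed.

(** The entry of [t] at the first difference decides. If it is in [rs], the [rs] numeral drops. If
    it is in [ls], everything from there on lies in the initial segment [ls], so the [rs] numerals
    agree and the [ls] numeral drops. *)
Lemma numeral_step t t' : descending X t -> descending X t' -> exp2_lt X t' t ->
  {subset t <= ls ++ rs} ->
  numeral rs t' < numeral rs t \/
  [/\ numeral rs t' = numeral rs t, {subset t' <= ls ++ rs} & numeral ls t' < numeral ls t].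
Proof.
elim: t t' => [|y t ih] [|x t'] // hd hd' hlt hs.
- have hy : y \in ls ++ rs by apply: hs; rewrite inE eqxx.
  move: hy; rewrite mem_cat => /orP[hy|hy].
    right; split=> //=; last by rewrite hy ltn_addr // expn_gt0.
    apply/esym/(@numeral_eq0 rs (y :: t)) => z; rewrite inE => /orP[/eqP->|hz].
      exact: ls_notin_rs.
    by apply: below_notin_rs (ls_notin_rs hy); exact: descending_lt hz.
  by left; rewrite /= hy ltn_addr // expn_gt0.
have hy : y \in ls ++ rs by apply: hs; rewrite inE eqxx.
case: hlt => [xy|[exy h]].
  move: hy; rewrite mem_cat => /orP[hy|hy]; last first.
    by left; have := numeral_below pairwise_rs hy xy hd'; rewrite /= hy; lia.
  right; have hz z : z \in x :: t' -> z \in ls.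
    by move=> hz; apply: below_ls hy; exact: head_below hz.
  split.
  - rewrite !numeral_eq0 // => z; last by move=> /hz /ls_notin_rs.
    rewrite inE => /orP[/eqP->|hz']; first exact: ls_notin_rs.
    by apply: below_notin_rs (ls_notin_rs hy); exact: descending_lt hz'.
  - by move=> z /hz; rewrite mem_cat => ->.
  - have -> : numeral ls (y :: t) = 2 ^ index y ls + numeral ls t by rewrite /= hy.
    by have := numeral_below pairwise_ls hy xy hd'; lia.
subst y; have hs' : {subset t <= ls ++ rs} by move=> z hz; apply: hs; rewrite inE hz orbT.
case: (ih t' (descending_behead hd) (descending_behead hd') h hs') => [h1|[h1 h2 h3]] /=.
  by left; rewrite ltn_add2l.
right; split; [by rewrite h1| |by rewrite ltn_add2l].
by move=> z; rewrite inE => /orP[/eqP->//|]; exact: h2.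
Qed.

(* The initial segment [ls] is finite, so a descending sequence in 2^X cannot
   keep the part of its entries that lies in [rs] forever. *)
Lemma numeral_rs_drops (F : nat -> seq nat) j : (forall i, descending X (F i)) ->
  (forall i, exp2_lt X (F i.+1) (F i)) -> {subset F j <= ls ++ rs} ->
  exists i, numeral rs (F i) < numeral rs (F j).
Proof.
move=> hd hlt hs; apply: contrapT => hno.
have h i : [/\ numeral rs (F (j + i)) = numeral rs (F j), {subset F (j + i) <= ls ++ rs}
    & numeral ls (F (j + i)) + i <= numeral ls (F j)].
  elim: i => [|i [h1 h2 h3]]; first by rewrite !addn0.
  rewrite addnS; case: (numeral_step (hd (j + i)) (hd (j + i).+1) (hlt _) h2).
    by move=> h; case: hno; exists (j + i).+1; rewrite -h1.
  by move=> [k1 k2 k3]; split=> //; [rewrite k1|lia].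
by have [_ _] := h (numeral ls (F j)).+1; lia.
Qed.

End Numerals.

Definition descends (X : linord) (F : nat -> seq nat) : Prop :=
  (forall i, descending X (F i)) /\ forall i, exp2_lt X (F i.+1) (F i).

Definition avoids (Phi : set nat -> set nat) (ls rs : seq nat) : Prop :=
  forall X F, compatible X ls rs -> cont_at Phi (lo_code X) -> descends X F ->
    Phi (lo_code X) <> graph (fun i => CodeSeq.code (F i)).

(* Every finite part of a compatible order is determined by an extension of [ls]
   only: elements outside of [rs] may be moved to the initial segment. *)
Lemma extend_condition X ls rs K : compatible X ls rs -> uniq (ls ++ rs) ->
  exists ls', [/\ uniq ((ls ++ ls') ++ rs), forall x, x < K -> x \in (ls ++ ls') ++ rs
    & forall X', compatible X' (ls ++ ls') rs -> agree_below K (lo_code X) (lo_code X')].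
Proof.
move=> hc hu; have [hX hl hr hls hrs] := hc.
pose ls' := sort (lob X) [seq x <- iota 0 K | x \notin ls ++ rs].
have mem x : (x \in ls') = (x \notin ls ++ rs) && (x < K).
  by rewrite mem_sort mem_filter mem_iota.
have uls' : uniq ls' by rewrite sort_uniq filter_uniq // iota_uniq.
have hu' : uniq ((ls ++ ls') ++ rs).
  have -> : uniq ((ls ++ ls') ++ rs) = uniq ((ls ++ rs) ++ ls').
    by apply: perm_uniq; rewrite perm_catAC.
  rewrite cat_uniq hu uls' andbT /=; apply/hasPn => x; rewrite mem.
  by case/andP.
have hp : pairwise (blt (lob X)) ((ls ++ ls') ++ rs).
  rewrite !pairwise_cat hl hr /=.
  have -> : pairwise (blt (lob X)) ls'.
    rewrite -(sorted_pairwise (@blt_trans X)).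
    have hs : sorted (lob X) ls'.
      apply: sort_sorted => x y; case: (lo_total (hX x) (hX y)) => h; apply/orP.
        by left; apply/asboolP.
      by right; apply/asboolP.
    have : sorted (fun x y => lob X x y && (x != y)) ls'; last by [].
    move: hs; rewrite !(sorted_pairwise) //; last exact: lob_trans; last exact: blt_trans.
    by move: uls'; rewrite uniq_pairwise => h1 h2; rewrite pairwise_relI h2.
  rewrite !andbT; apply/andP; split.
    apply/allrelP => x y hx hy; apply/bltP; apply: hrs => //.
    move: hx; rewrite mem_cat => /orP[hx|]; first exact: (ls_notin_rs hu).
    by rewrite mem mem_cat negb_or => /andP[/andP[]].
  apply/allrelP => x y hx; rewrite mem mem_cat negb_or => /andP[/andP[hy _] _].
  by apply/bltP; apply: hls.
have hall x : x < K -> x \in (ls ++ ls') ++ rs.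
  move=> hx; rewrite mem_cat [x \in ls ++ _]mem_cat mem hx andbT mem_cat negb_or.
  by case: (x \in ls) => //; case: (x \in rs).
exists ls'; split=> // X' hc' k hk; apply: propext.
have hX' : forall x, lo_set X' x by case: hc'.
have hp' := compatible_pairwise hc' hu'.
split=> -[x [y [h e]]]; exists x, y; split=> //; have [h1 h2] := leq_pair_code x y;
  have hx : x \in (ls ++ ls') ++ rs by [apply: hall; lia];
  have hy : y \in (ls ++ ls') ++ rs by [apply: hall; lia].
  by apply/(pairwise_index hX hp hx hy)/(pairwise_index hX' hp' hx hy).
by apply/(pairwise_index hX' hp' hx hy)/(pairwise_index hX hp hx hy).
Qed.

(** If [Phi] gives a descending sequence for some compatible order, extending [ls] alone forces one
    of its entries [t]. Any later counterexample shares this entry and has another one with smaller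
    [numeral rs], which is forced next. As [rs] stays fixed, this measure can be compared between
    conditions, and the process ends. *)
Lemma avoid (Phi : set nat -> set nat) ls rs : uniq (ls ++ rs) ->
  exists ls', uniq ((ls ++ ls') ++ rs) /\ avoids Phi (ls ++ ls') rs.
Proof.
have settle X F ls0 i : compatible X ls0 rs -> uniq (ls0 ++ rs) -> cont_at Phi (lo_code X) ->
    Phi (lo_code X) = graph (fun i => CodeSeq.code (F i)) ->
    exists ls', [/\ uniq ((ls0 ++ ls') ++ rs), {subset F i <= (ls0 ++ ls') ++ rs}
      & forall X', compatible X' (ls0 ++ ls') rs ->
          Phi (lo_code X') (pair_code i (CodeSeq.code (F i)))].
  move=> hc hu hcont hF; have [b hb] := hcont (pair_code i (CodeSeq.code (F i))).
  (* [K] covers both the bits used by [Phi] and all exponents in [F i]. *)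
  pose K := maxn b (\sum_(x <- F i) x.+1).
  have [ls' [h1 h2 h3]] := extend_condition K hc hu.
  exists ls'; split=> // [x hx|X' hc'].
    apply: h2; rewrite /K; have : x.+1 <= \sum_(x <- F i) x.+1; last by lia.
    by rewrite (big_rem x) //= leq_addr.
  rewrite hb; first by rewrite hF; apply/graphE.
  by move=> x hx; apply: h3 => //; rewrite /K; lia.
have loop m : forall ls j t, uniq (ls ++ rs) -> {subset t <= ls ++ rs} -> numeral rs t < m ->
    (forall X, compatible X ls rs -> Phi (lo_code X) (pair_code j (CodeSeq.code t))) ->
    exists ls', uniq ((ls ++ ls') ++ rs) /\ avoids Phi (ls ++ ls') rs.
  elim: m => // m ih ls0 j t hu ht htm hPhi.
  case: (pselect (avoids Phi ls0 rs)) => [h|]; first by exists [::]; rewrite cats0.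
  move=> /existsNP[X /existsNP[F hn]].
  have [hc hcont [hd hlt] hF] : [/\ compatible X ls0 rs, cont_at Phi (lo_code X), descends X F
      & Phi (lo_code X) = graph (fun i => CodeSeq.code (F i))].
    by apply: contrapT => h; apply: hn => h1 h2 h3 h4; apply: h.
  have eFj : F j = t.
    by apply: (can_inj CodeSeq.codeK); have := hPhi X hc; rewrite hF => /graphE.
  have [i hi] := numeral_rs_drops hc hu hd hlt (j := j) ltac:(by rewrite eFj).
  have [ls1 [h1 h2 h3]] := settle X F ls0 i hc hu hcont hF.
  have [|ls2 [h4 h5]] := ih _ _ _ h1 h2 _ h3; first by rewrite eFj in hi; lia.
  by exists (ls1 ++ ls2); rewrite catA.
move=> hu; case: (pselect (avoids Phi ls rs)) => [h|]; first by exists [::]; rewrite cats0.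
move=> /existsNP[X /existsNP[F hn]].
have [hc hcont _ hF] : [/\ compatible X ls rs, cont_at Phi (lo_code X), descends X F
    & Phi (lo_code X) = graph (fun i => CodeSeq.code (F i))].
  by apply: contrapT => h; apply: hn => h1 h2 h3 h4; apply: h.
have [ls1 [h1 h2 h3]] := settle X F ls 0 hc hu hcont hF.
have [ls2 [h4 h5]] := loop _ _ _ _ h1 h2 (ltnSn _) h3.
by exists (ls1 ++ ls2); rewrite catA.
Qed.

(** Conditions grow only between their left and right parts, which leaves the order of the old
    elements unchanged. *)
Lemma index_insert (l m r : seq nat) x y : uniq ((l ++ m) ++ r) ->
  x \in l ++ r -> y \in l ++ r ->
  (index x ((l ++ m) ++ r) < index y ((l ++ m) ++ r)) = (index x (l ++ r) < index y (l ++ r)).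
Proof.
rewrite -catA cat_uniq => /and3P[_ /hasPn hl]; rewrite cat_uniq => /and3P[_ /hasPn hm _].
have e z : z \in l ++ r -> index z (l ++ m ++ r) =
    if z \in l then index z (l ++ r) else size m + index z (l ++ r).
  rewrite !index_cat mem_cat; case: (boolP (z \in l)) => //= _ hz.
  by rewrite (negbTE (hm z hz)); lia.
have lt z : z \in l -> index z (l ++ r) < size l by move=> h; rewrite index_cat h index_mem.
have ge z : z \notin l -> size l <= index z (l ++ r).
  by move=> /negbTE h; rewrite index_cat h leq_addr.
move=> hx hy; rewrite !e //.
case: (boolP (x \in l)) (boolP (y \in l)) => h1 [] h2 //.
- by have := lt x h1; have := ge y h2; lia.
- by have := lt y h2; have := ge x h1; lia.
- by rewrite ltn_add2l.
Qed.

(** * Construction of the generic order and failure of induction along it *)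

Section Generic.

Variable Phi : nat -> set nat -> set nat.

(** What [avoid] achieves survives any further growth of the condition, by [compatible_sub]. The new
    least element [b] of the right part is what makes the left part progressive in the end. *)
Lemma conditions_exist : exists ls rs : nat -> seq nat,
  [/\ forall j, uniq (ls j ++ rs j),
      forall j, exists m b, [/\ ls j.+1 = ls j ++ m, rs j.+1 = b :: rs j &
        forall X, compatible X (ls j.+1) (rs j.+1) -> forall F,
          cont_at (Phi j) (lo_code X) -> descends X F ->
          Phi j (lo_code X) <> graph (fun i => CodeSeq.code (F i))]
    & forall x, x \in ls x.+1 ++ rs x.+1].
Proof.
pose P (c : seq nat * seq nat) := uniq (c.1 ++ c.2).
have step (c : nat * (seq nat * seq nat)) : exists c' : seq nat * seq nat, P c.2 ->
    [/\ P c', exists m b, [/\ c'.1 = c.2.1 ++ m, c'.2 = b :: c.2.2 &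
        forall X, compatible X c'.1 c'.2 -> forall F,
          cont_at (Phi c.1) (lo_code X) -> descends X F ->
          Phi c.1 (lo_code X) <> graph (fun i => CodeSeq.code (F i))]
      & c.1 \in c'.1 ++ c'.2].
  case: c => j [ls rs] /=; case: (pselect (uniq (ls ++ rs))) => [hu|hn]; last first.
    by exists (ls, rs) => /hn.
  have [ls' [hu' hav]] := avoid (Phi j) hu.
  pose q := if j \in (ls ++ ls') ++ rs then [::] else [:: j].
  (* The sum exceeds every member of the list, so [b] is fresh. *)
  pose l2 := (ls ++ ls') ++ q; pose b := \sum_(x <- l2 ++ rs) x.+1.
  have hb : b \notin l2 ++ rs.
    apply/negP => h; have : b.+1 <= b; last by lia.
    by rewrite {2}/b (big_rem b) //= leq_addr.
  have hu2 : uniq (l2 ++ rs).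
    have -> : uniq (l2 ++ rs) = uniq (((ls ++ ls') ++ rs) ++ q).
      by apply: perm_uniq; rewrite perm_catAC.
    rewrite cat_uniq hu' /q; case: ifP => //= h; rewrite orbF andbT.
    by rewrite h.
  have hu3 : uniq (l2 ++ b :: rs).
    have -> : uniq (l2 ++ b :: rs) = uniq (b :: l2 ++ rs).
      by apply: perm_uniq; rewrite -cat1s perm_catCA.
    by rewrite /= hb hu2.
  exists (l2, b :: rs) => _; split=> //=.
    exists (ls' ++ q), b; split=> // [|X hX F]; first by rewrite /l2 catA.
    by apply: hav; apply: (@compatible_sub X (ls ++ ls') q [:: b] rs).
  rewrite mem_cat inE /l2 mem_cat /q; case: ifP; last by rewrite inE eqxx orbT.
  by rewrite mem_cat => /orP[->//|->]; rewrite !orbT.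
have [g hg] := choice step.
pose c := fix c j := if j is j'.+1 then g (j', c j') else ([::], [::]).
have hc j : P (c j) by elim: j => //= j ih; case: (hg (j, c j) ih).
exists (fun j => (c j).1), (fun j => (c j).2); split=> // j.
  by have [_ h _] := hg (j, c j) (hc j).
by have [_ _] := hg (j, c j) (hc j).
Qed.

(** The order is the union of the finite orders [s j], which cohere by [index_insert]. *)
Lemma generic_order : exists X (ls rs : nat -> seq nat),
  [/\ forall j, compatible X (ls j) (rs j), forall j, exists b, rs j.+1 = b :: rs j,
      forall x, exists j, x \in ls j ++ rs j
    & forall j F, cont_at (Phi j) (lo_code X) -> descends X F ->
        Phi j (lo_code X) <> graph (fun i => CodeSeq.code (F i))].
Proof.
have [ls [rs [hu hstep hall]]] := conditions_exist; pose s j := ls j ++ rs j.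
have chain i j : i <= j -> exists m b, ls j = ls i ++ m /\ rs j = b ++ rs i.
  move=> /subnK <-; elim: (j - i) => [|n [m [b [h1 h2]]]].
    by exists [::], [::]; rewrite cats0.
  have [m' [b' [h3 h4 _]]] := hstep (n + i).
  by exists (m ++ m'), (b' :: b); rewrite addSn h3 h4 h1 h2 catA.
have sub i j x : i <= j -> x \in s i -> x \in s j.
  move=> /chain[m [b [e1 e2]]]; rewrite /s e1 e2 !mem_cat => /orP[->//|->].
  by rewrite !orbT.
have stab i j x y : i <= j -> x \in s i -> y \in s i ->
    (index x (s j) < index y (s j)) = (index x (s i) < index y (s i)).
  move=> /chain[m [b [e1 e2]]] hx hy; have := hu j; rewrite /s e1 e2 => huj.
  have -> : (ls i ++ m) ++ b ++ rs i = (ls i ++ (m ++ b)) ++ rs i by rewrite !catA.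
  by apply: index_insert => //; rewrite !catA in huj *.
pose R x y := exists j, [/\ x \in s j, y \in s j & index x (s j) < index y (s j)].
have RE j x y : x \in s j -> y \in s j -> R x y <-> index x (s j) < index y (s j).
  move=> hx hy; split=> [[i [hx' hy' h]]|h]; last by exists j.
  have [h1 h2] : i <= maxn i j /\ j <= maxn i j by rewrite leq_maxl leq_maxr.
  by rewrite -(stab _ _ _ _ h2) // (stab _ _ _ _ h1).
have common x y z : exists j, [/\ x \in s j, y \in s j & z \in s j].
  exists (x + y + z).+1; split.
  - by apply: (sub x.+1) (hall x); lia.
  - by apply: (sub y.+1) (hall y); lia.
  - by apply: (sub z.+1) (hall z); lia.
have Rirr x : ~ R x x by move=> [j [_ _]]; rewrite ltnn.
have Rtr x y z : True -> True -> True -> R x y -> R y z -> R x z.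
  move=> _ _ _; have [j [hx hy hz]] := common x y z.
  by rewrite !(RE j) //; exact: ltn_trans.
have Rtot x y : True -> True -> [\/ x = y, R x y | R y x].
  move=> _ _; have [j [hx hy _]] := common x y y.
  case: (ltngtP (index x (s j)) (index y (s j))) => h.
  - by constructor 2; apply/(RE j).
  - by constructor 3; apply/(RE j).
  - by constructor 1; rewrite -(nth_index 0 hx) h nth_index.
pose X := order_of Rirr Rtr Rtot.
have ltX x y : R x y -> lo_lt X x y by move=> h; apply/order_of_lt.
have hc j : compatible X (ls j) (rs j).
  have := hu j; rewrite cat_uniq => /and3P[ul /hasPn ulr ur].
  split=> [x|||x z hx hz|y z hy hz].
  - exact/order_of_set.
  - apply/(pairwiseP 0) => i i'; rewrite !inE => hi hi' ii'; apply/bltP/ltX/(RE j);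
      rewrite /s ?mem_cat ?mem_nth // !index_cat !mem_nth // !index_uniq //.
  - have nl i : i < size (rs j) -> nth 0 (rs j) i \in ls j = false.
      by move=> hi; apply/negbTE/ulr/mem_nth.
    apply/(pairwiseP 0) => i i'; rewrite !inE => hi hi' ii'; apply/bltP/ltX/(RE j);
      rewrite /s ?mem_cat ?mem_nth ?orbT // !index_cat !nl // !index_uniq //.
    by rewrite ltn_add2l.
  - have hjz : j <= maxn j z.+1 by rewrite leq_maxl.
    have hz' : z \in s (maxn j z.+1) by apply: sub (hall z); rewrite leq_maxr.
    have hx' : x \in s (maxn j z.+1) by apply: sub hjz _; rewrite mem_cat hx.
    apply/ltX/(RE (maxn j z.+1)) => //.
    have [m [b [e1 e2]]] := chain _ _ hjz.
    rewrite /s e1 -!catA !index_cat hx (negbTE hz) /=; apply: (leq_trans (n := size (ls j))).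
      by rewrite index_mem.
    exact: leq_addr.
  - have hjz : j <= maxn j z.+1 by rewrite leq_maxl.
    have hz' : z \in s (maxn j z.+1) by apply: sub (hall z); rewrite leq_maxr.
    have hy' : y \in s (maxn j z.+1) by apply: sub hjz _; rewrite mem_cat hy orbT.
    apply/ltX/(RE (maxn j z.+1)) => //.
    have [m [b [e1 e2]]] := chain _ _ hjz.
    have := hu (maxn j z.+1); rewrite /s e2 catA cat_uniq => /and3P[_ /hasPn/(_ y hy) ny _].
    move: hz'; rewrite /s e2 catA mem_cat (negbTE hz) orbF => hz'.
    rewrite (index_cat z _ (rs j)) hz' (index_cat y _ (rs j)) (negbTE ny) /=; apply: (leq_trans (n := size (ls (maxn j z.+1) ++ b))).
      by rewrite index_mem.
    exact: leq_addr.
exists X, ls, rs; split=> // [j|x|j F hcont hd].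
- by have [m [b [_ h _]]] := hstep j; exists b.
- by exists x.+1; exact: hall.
- by have [m [b [_ _ h]]] := hstep j; apply: h.
Qed.

End Generic.

Lemma not_pi02_TI_star (Z : nat -> set nat) : exists M : omega_model,
  [/\ RCA0 M, forall k, M (Z k) & ~ pi02_TI_star M].
Proof.
pose dec j := odflt (0, 0) (choice.unpickle j : option (nat * nat)).
have [X [ls [rs [hc hrs hall hav]]]] :=
  generic_order (fun j => ideal_op Z (dec j).1 (dec j).2).
exists (ideal Z (lo_code X)); split; [exact: ideal_RCA0|exact: ideal_parameter|].
have hX x : lo_set X x by case: (hc 0).
pose S (_ : nat) := lo_code X; pose v (_ : nat) := 0.
(* Unboundedly many numbers lie at or above [x]: a Pi^0_2 property that holds on the left part and
   fails on the right. *)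
pose p := All (Ex (And (Lt (Var 1) (Var 0)) (Defs.Mem (pairT (Var 2) (Var 0)) 0))).
have satp x : sat S (scons x v) p <-> forall n, exists2 m, n < m & X x m.
  rewrite /p /=; split=> h n.
    have [m [h1 h2]] := h n; exists m => //; rewrite mulnn in h2.
    exact/rel_codeE.
  have [m h1 h2] := h n; exists m; split=> //; rewrite mulnn.
  exact/rel_codeE.
have fresh n (s : seq nat) : exists2 m, n < m & m \notin s.
  pose m := (n + \sum_(x <- s) x.+1).+1; exists m; first by rewrite /m; lia.
  apply/negP => h; have : m.+1 <= \sum_(x <- s) x.+1 by rewrite (big_rem m) //= leq_addr.
  by rewrite /m; lia.
have satL j x : x \in ls j -> sat S (scons x v) p.
  move=> hx; apply/satp => n; have [m nm hm] := fresh n (ls j); exists m => //.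
  by case: (hc j) => _ _ _ /(_ x m hx hm) [].
have satR j x : x \in rs j -> ~ sat S (scons x v) p.
  move=> hx /satp /(_ (\sum_(x <- rs j) x.+1)) [m hm hxm].
  have hmr : m \notin rs j.
    apply/negP => h; have : m.+1 <= \sum_(x <- rs j) x.+1 by rewrite (big_rem m) //= leq_addr.
    by lia.
  by case: (hc j) => _ _ _ _ /(_ x m hx hmr) /lo_ltN.
move=> hTI; have [b0 e0] := hrs 0.
apply: (satR 1 b0); first by rewrite e0 inE eqxx.
apply: (hTI X (ideal_generator Z _) _ p S v) => // [[F [hd hlt [n [k [hcont e]]]]]|i|x _ hprog].
- have := hav (choice.pickle (n, k)) F; rewrite /dec choice.pickleK /= => /(_ hcont).
  by apply=> //; rewrite -e.
- exact: ideal_generator.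
(* An element of the right part has the element [b] of the next stage below it, where the property
   fails, so only the left part remains. *)
- have [j] := hall x; rewrite mem_cat => /orP[|hx]; first exact: satL.
  have [b eb] := hrs j; exfalso; apply: (satR j.+1 b); first by rewrite eb inE eqxx.
  apply: hprog; case: (hc j.+1) => _ _; rewrite eb /= => /andP[/allP/(_ x hx)/bltP].
  by [].
Qed.

Theorem theorem1p5 (D : predilator) (hD : dilator D) :
  (omega_entails RCA0 [:: predilator_code D] (fun M => dilator_in M D)
   \/ omega_entails RCA0 [:: predilator_code D]
        (fun M => dilator_in M D -> pi02_TI_star M))
  /\ ~ (omega_entails RCA0 [:: predilator_code D] (fun M => dilator_in M D)
        /\ omega_entails RCA0 [:: predilator_code D]
             (fun M => dilator_in M D -> pi02_TI_star M)).
Proof.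
split.
  case: (pselect (omega_entails RCA0 [:: predilator_code D] (fun M => dilator_in M D))).
    by left.
  by move=> /(not_entailed_branch hD)[E hE]; right; exact: branch_pi02_TI_star hE.
move=> [[Y1 h1] [Y2 h2]].
pose Z k := match k with 0 => predilator_code D | 1 => Y1 | _ => Y2 end.
have [M [hM MZ hTI]] := not_pi02_TI_star Z; apply: hTI.
have hD' : ([set` [:: predilator_code D]] `<=` M)%classic.
  by move=> A /=; rewrite inE => /eqP ->; exact: (MZ 0).
by apply: (h2 M hM hD' (MZ 2)); apply: (h1 M hM hD' (MZ 1)).
Qed.
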